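(* Let $(X^n,\overline X^n,M^n,M^{n,\bot},S^n)_{n\ge1}$ be the processes defined in the context. Any weak limit (limit in law, along a subsequence, in the space of continuous functions on $[0,T]$) $(X,\overline X,S,M,M^\bot)$ of $(X^n,\overline X^n,S^n,M^n,M^{n,\bot})_{n\ge1}$ satisfies, on $[0,T]$, $$\begin{cases}X_t=V_0t+\int_0^tK(t-s)\big(\theta s-\lambda\overline X_s+\nu M_s\big)\,ds,\\ \overline X_t=\max_{0\le s\le t}X_s,\\ S_t=S_0\exp\big(\rho M_t+\sqrt{1-\rho^2}\,M^\bot_t-\tfrac12\overline X_t\big),\\ M,M^\bot\text{ are continuous martingales with }\langle M\rangle=\langle M^\bot\rangle=\overline X,\ \langle M,M^\bot\rangle=0\text{ and }M_0=M^\bot_0=0.\end{cases}$$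
   Context: Fix $T>0$, $\rho\in[-1,1]$ and strictly positive constants $S_0,V_0,\theta,\lambda,\nu$; $Y_0=\log S_0$. Martingale properties of the limit are with respect to some filtration to which all limit processes are adapted (equivalently, the filtration they generate). Grids: $\pi_n=\{0=t^n_0<t^n_1<\dots<t^n_n=T\}$ with mesh $\max_k(t^n_{k+1}-t^n_k)\to0$ as $n\to\infty$; write $t_k=t^n_k$. $\eta_n(s)=t^n_k$ for $s\in[t^n_k,t^n_{k+1})$, $\eta_n(T)=T$. Standing assumption on $K$: $K\in L^2([0,T])$ is nonnegative, not identically $0$, non-increasing and continuous (on $(0,T]$, possibly singular at $0$). It has a resolvent of the first kind $L$, i.e. a finite measure $L$ on $[0,T]$ with $\int_{[0,t]}K(t-s)\,L(ds)=1$ for all $t\in(0,T]$; $L$ is nonnegative, and for every $t\ge0$ the map $s\mapsto L([s,s+t])$ is non-increasing (for those $s\ge 0$ with $s+t\le T$). Moreover there are constants $C>0$, $H>0$ such that for all $0\le t\le T$, $n\ge1$, $\delta\in(0,T-t]$, $$\int_t^{t+\delta}|K(t+\delta-\eta_n(s))|^2ds\le C\delta^{2H},\qquad \int_0^t|K(t+\delta-\eta_n(s))-K(t-\eta_n(s))|^2ds\le C\delta^{2H}.$$ Discrete scheme in continuous time: let $B,B^\bot$ be independent standard Brownian motions. Set $M^n_0=M^{n,\bot}_0=0$, and for $t\in[0,T]$ $$X^n_t=V_0t+\int_0^tK(t-\eta_n(s))\big(\theta\eta_n(s)-\lambda\overline X^n_{\eta_n(s)}+\nu M^n_{\eta_n(s)}\big)ds,\qquad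 \overline X^n_{t_k}=\max_{0\le j\le k}X^n_{t_j},$$ and for $t\in[t_{k-1},t_k]$, $$\overline X^n_t=\overline X^n_{t_{k-1}}+(\overline X^n_{t_k}-\overline X^n_{t_{k-1}})\frac{t-t_{k-1}}{t_k-t_{k-1}},$$ $$M^n_t=M^n_{t_{k-1}}+\sqrt{\overline X^n_{t_k}-\overline X^n_{t_{k-1}}}\,\frac{B_t-B_{t_{k-1}}}{\sqrt{t_k-t_{k-1}}},\qquad M^{n,\bot}_t=M^{n,\bot}_{t_{k-1}}+\sqrt{\overline X^n_{t_k}-\overline X^n_{t_{k-1}}}\,\frac{B^\bot_t-B^\bot_{t_{k-1}}}{\sqrt{t_k-t_{k-1}}}.$$ Finally $S^n_t=\exp(Y^n_t)$ with $Y^n_t=Y_0+\rho M^n_t+\sqrt{1-\rho^2}\,M^{n,\bot}_t-\frac12\overline X^n_t$. *)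

(* Defs.v *)
From HB Require Import structures.
From mathcomp Require Import all_boot all_order all_algebra.
From mathcomp Require Import all_classical all_reals all_analysis.
Export numFieldNormedType.Exports.

Set Implicit Arguments.
Unset Strict Implicit.
Unset Printing Implicit Defensive.

Import Order.TTheory GRing.Theory Num.Theory.

Local Open Scope classical_set_scope.
Local Open Scope ring_scope.

(* A process with horizon T is a function of a real time and of an outcome;
   only its values at times in `[0, T] are ever used. *)

Section Grid.
Context {R : realType}.

(* 0 = t 0 < t 1 < ... < t n = T; values of t beyond n are ignored. *)
Definition is_grid (T : R) (n : nat) (t : nat -> R) : Prop :=
  [/\ t 0%N = 0, t n = T & forall k, (k < n)%N -> t k < t k.+1].

Definition mesh (n : nat) (t : nat -> R) : R :=
  \big[Num.max/0]_(k < n) (t k.+1 - t k).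

(* The step function equal to t k on `[t k, t k.+1[ and to T at T. *)
Definition eta (T : R) (n : nat) (t : nat -> R) (s : R) : R :=
  (\sum_(k < n) t k * \1_`[t k, t k.+1[ s) + T * \1_[set T] s.

End Grid.

Section Kernel.
Context {R : realType}.
Local Notation mu := (@lebesgue_measure R).

(* A nonnegative resolvent of the first kind of K on `[0, T], seen as a finite
   Borel measure on the line carried by `[0, T]. *)
Definition is_resolvent_first_kind (T : R) (K : R -> R)
    (L : {finite_measure set (measurableTypeR R) -> \bar R}) : Prop :=
  L (~` `[0, T]) = 0%E /\
  forall t : R, t \in `]0, T] ->
    (\int[L]_(s in `[0%R, t]) (K (t - s))%:E = 1)%E.

(* K 0 is arbitrary: K may be singular at 0. *)
Record kernel_assumption (T : R) (t_ : nat -> nat -> R) (K : R -> R) : Prop :=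
  KernelAssumption {
  kernel_measurable : measurable_fun `[0, T] K ;
  kernel_sq_integrable : mu.-integrable `[0, T] (fun s : R => (K s ^+ 2)%:E) ;
  kernel_ge0 : forall s : R, s \in `]0, T] -> 0 <= K s ;
  kernel_neq0 : exists2 s : R, s \in `]0, T] & K s != 0 ;
  kernel_nonincreasing : {in `]0, T] &, {homo K : x y /~ x <= y}} ;
  kernel_continuous : {within `]0, T], continuous K} ;
  kernel_resolvent :
    exists2 L : {finite_measure set (measurableTypeR R) -> \bar R},
      is_resolvent_first_kind T K L &
      forall t s s' : R, 0 <= t -> 0 <= s -> s <= s' -> s' + t <= T ->
        (L `[s', (s' + t)%R]%classic <= L `[s, (s + t)%R]%classic)%E ;
  kernel_moduli : exists C H : R, [/\ 0 < C, 0 < H &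
    forall (t : R) (n : nat) (delta : R), t \in `[0, T] -> (0 < n)%N -> delta \in `]0, T - t] ->
      let e := eta T n (t_ n) in
      (\int[mu]_(s in `[t, (t + delta)%R])
          (`|K (t + delta - e s)| ^+ 2)%:E <= (C * delta `^ (2 * H))%:E)%E /\
      (\int[mu]_(s in `[0%R, t])
          (`|K (t + delta - e s) - K (t - e s)| ^+ 2)%:E
        <= (C * delta `^ (2 * H))%:E)%E]
}.

End Kernel.

Section Processes.
Context {R : realType} {d : measure_display} {Omega : measurableType d}.
Implicit Types (X M N : R -> Omega -> R) (F : R -> set (set Omega)).

Definition continuous_paths (T : R) X : Prop :=
  forall w, {within `[0, T], continuous (X ^~ w)}.

(* sigma(X_s : s in D) *)
Definition sigma_generated (D : set R) X : set (set Omega) :=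
  <<s \bigcup_(s in D) preimage_set_system setT (X s) measurable >>.

Definition independent_systems (P : probability Omega R)
    (G H : set (set Omega)) : Prop :=
  forall A B, G A -> H B -> P (A `&` B) = (P A * P B)%E.

Record brownian_motion (P : probability Omega R) (T : R) (B : R -> Omega -> R)
    : Prop := BrownianMotion {
  bm_measurable : forall t : R, t \in `[0, T] -> measurable_fun setT (B t) ;
  bm_continuous : continuous_paths T B ;
  bm_start : {ae P, forall w, B 0 w = 0} ;
  bm_normal : forall s t : R, 0 <= s -> s < t -> t <= T ->
    forall U : set R, measurable U ->
      P [set w | U (B t w - B s w)] = normal_prob 0 (Num.sqrt (t - s)) U ;
  bm_independent : forall s t : R, 0 <= s -> s < t -> t <= T ->
    independent_systems P (sigma_generated `[0, s] B)
      (preimage_set_system setT (fun w => B t w - B s w) measurable)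
}.

Definition filtration (T : R) F : Prop :=
  (forall t : R, t \in `[0, T] -> sigma_algebra setT (F t) /\ F t `<=` measurable)
  /\ {in `[0, T] &, forall s t, s <= t -> F s `<=` F t}.

Definition adapted (T : R) F X : Prop :=
  forall t : R, t \in `[0, T] ->
    preimage_set_system setT (X t) measurable `<=` F t.

(* The last clause spells out E[M t | F s] = M s almost surely. *)
Definition martingale (P : probability Omega R) (T : R) F M : Prop :=
  [/\ adapted T F M,
      forall t : R, t \in `[0, T] -> P.-integrable setT (fun w => (M t w)%:E) &
      {in `[0, T] &, forall s t, s <= t -> forall A, F s A ->
        (\int[P]_(w in A) (M t w)%:E = \int[P]_(w in A) (M s w)%:E)%E}].

Definition stopping_time (T : R) F (tau : Omega -> R) : Prop :=
  forall t : R, t \in `[0, T] -> F t [set w | tau w <= t].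

Definition continuous_local_martingale (P : probability Omega R) (T : R) F M
    : Prop :=
  [/\ adapted T F M, continuous_paths T M &
  exists tau : nat -> Omega -> R,
    [/\ forall k, stopping_time T F (tau k),
        forall k w, 0 <= tau k w <= tau k.+1 w,
        {ae P, forall w, exists k, T <= tau k w} &
        forall k,
          martingale P T F (fun t w => M (Num.min t (tau k w)) w - M 0 w)]].

(* A is a version of <M, N>: the process of finite variation, unique up to
   indistinguishability, that makes M N - A a local martingale.
   The quadratic variation <M> is <M, M>. *)
Definition is_bracket (P : probability Omega R) (T : R) F M N (A : R -> Omega -> R) : Prop :=
  [/\ adapted T F A, continuous_paths T A, {ae P, forall w, A 0 w = 0},
      {ae P, forall w, bounded_variation 0 T (A ^~ w)} &
      continuous_local_martingale P T F (fun t w => M t w * N t w - A t w)].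

End Processes.

Section ConvergenceInLaw.
Context {R : realType} {d d' : measure_display}.
Context {Omega : measurableType d} {Omega' : measurableType d'}.

(* C([0, T], E) with the topology of uniform convergence on [0, T]; a
   continuous functional cannot separate functions that agree on [0, T]. *)
Definition path_space (T : R) (E : uniformType) : set {uniform` `[0, T] -> E} :=
  [set f | {within `[0, T], continuous (f : R -> E)}].
Arguments path_space : clear implicits.

(* Weak convergence of the laws of the C([0, T], E)-valued variables Z_ n. *)
Definition cvg_in_law (P : probability Omega R) (P' : probability Omega' R)
    (T : R) (E : uniformType)
    (Z_ : nat -> R -> Omega -> E) (Z : R -> Omega' -> E) : Prop :=
  forall F : {uniform` `[0, T] -> E} -> R,
    {within path_space T E, continuous F} ->
    (exists c : R, forall f, path_space T E f -> `|F f| <= c) ->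
    ('E_P[fun w => F (Z_ n ^~ w)] @[n --> \oo] --> 'E_P'[fun w => F (Z ^~ w)])%E.

End ConvergenceInLaw.

Section Scheme.
Context {R : realType} {d : measure_display} {Omega : measurableType d}.
Local Notation mu := (@lebesgue_measure R).

(* The scheme on the grid t 0 < ... < t n. The equations determine X, Xbar, M
   and Mperp on `[0, T]: X on `]t k, t k.+1] depends on Xbar and M only through
   their values at t 0, ..., t k. *)
Record is_scheme (T V0 theta lambda nu : R) (n : nat) (t : nat -> R)
    (K : R -> R) (B Bperp X Xbar M Mperp : R -> Omega -> R) : Prop := IsScheme {
  scheme_X : forall (u : R) w, u \in `[0, T] ->
    X u w = V0 * u + \int[mu]_(s in `[0, u])
      (K (u - eta T n t s) * (theta * eta T n t s
         - lambda * Xbar (eta T n t s) w + nu * M (eta T n t s) w)) ;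
  scheme_Xbar_grid : forall k w, (k <= n)%N ->
    Xbar (t k) w = \big[Num.max/X (t 0%N) w]_(j < k.+1) X (t j) w ;
  scheme_Xbar : forall k (u : R) w, (k < n)%N -> u \in `[t k, t k.+1] ->
    Xbar u w = Xbar (t k) w
      + (Xbar (t k.+1) w - Xbar (t k) w) * ((u - t k) / (t k.+1 - t k)) ;
  scheme_M0 : forall w, M 0 w = 0 ;
  scheme_M : forall k (u : R) w, (k < n)%N -> u \in `[t k, t k.+1] ->
    M u w = M (t k) w + Num.sqrt (Xbar (t k.+1) w - Xbar (t k) w)
      * ((B u w - B (t k) w) / Num.sqrt (t k.+1 - t k)) ;
  scheme_Mperp0 : forall w, Mperp 0 w = 0 ;
  scheme_Mperp : forall k (u : R) w, (k < n)%N -> u \in `[t k, t k.+1] ->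
    Mperp u w = Mperp (t k) w + Num.sqrt (Xbar (t k.+1) w - Xbar (t k) w)
      * ((Bperp u w - Bperp (t k) w) / Num.sqrt (t k.+1 - t k))
}.

Definition scheme_price (S0 rho : R) (Xbar M Mperp : R -> Omega -> R)
    (t : R) (w : Omega) : R :=
  expR (ln S0 + rho * M t w + Num.sqrt (1 - rho ^+ 2) * Mperp t w
        - 2^-1 * Xbar t w).

End Scheme.

(* Main.v *)
Require Import Defs.
From HB Require Import structures.
From mathcomp Require Import all_boot all_order all_algebra.
From mathcomp Require Import all_classical all_reals all_analysis.
From mathcomp Require Import measurable_realfun ring lra.
Set Implicit Arguments.
Unset Strict Implicit.
Unset Printing Implicit Defensive.
Import Order.TTheory GRing.Theory Num.Theory.
Local Open Scope classical_set_scope.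
Local Open Scope ring_scope.

Local Notation eta := Defs.eta.

(* On a grid, Xbar is the clock of M and Mperp: given the past, each cell adds to
   M a Gaussian increment whose variance is the increment of Xbar. Hence M, Mperp,
   M^2 - Xbar, Mperp^2 - Xbar, M Mperp and M^4 - 6 M^2 Xbar + 3 Xbar^2 are
   martingales already for the scheme; the last one gives E M^4 <= 36 E Xbar^2. The
   moduli of K bound Xbar_T^2 by an affine function of the time integral of M^2,
   so E Xbar_T^2 <= a + b E Xbar_T, which makes all these moments bounded uniformly
   in n; the same argument gives X a modulus of continuity with an integrable
   random constant.
   In the limit only continuous functionals of finitely many times are used. The
   equation for X is obtained by replacing the kernel by its version on a fixed grid
   m, letting n go to infinity in law, then m pathwise. The maximum is squeezed
   between X_s <= Xbar_t (up to the modulus) and Xbar_t <= the maximum of X over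
   finitely many times (up to the modulus). The martingale identities pass to the
   limit against bounded functionals of the past because second moments are bounded,
   and extend to the generated filtration by a pi-lambda argument. *)

(** * Gaussian moments *)

(** Two features of the scheme make the clock exact. The kernel sum giving X at [t k.+1] reads Xbar
    and M only at [t 0], ..., [t k], so the variance of a cell is known when the cell starts. And
    Xbar is interpolated linearly, so variance and clock agree at all times, not only on the grid.
    Fourth moments enter because the martingale identity for M^2 - Xbar passes to the limit only if
    M^2 - Xbar is bounded in L^2. The moment bound closes without a Gronwall argument. The limit
    lives on another probability space and is tied to the scheme only through laws. Each relation is
    therefore coded as smallness of E min(1, |F|) for a functional F of finitely many times. This
    gives almost sure statements at fixed times; path continuity extends them to all times through a
    countable set. *)

Section density.
Context d (T : measurableType d) (R : realType).
Variables (mu nu : {measure set T -> \bar R}) (p : T -> R).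
Hypotheses (p_ge0 : forall x, 0 <= p x) (mp : measurable_fun setT p).
Hypothesis nuE : forall A, measurable A ->
  nu A = (\int[mu]_(x in A) (p x)%:E)%E.
Import HBNNSimple.

(** Indicators, then simple functions, then monotone convergence. It turns integrals against
    [normal_prob] into Lebesgue integrals against [normal_pdf], where calculus is possible. *)
Lemma ge0_integral_density (f : T -> \bar R) :
  measurable_fun setT f -> (forall x, 0 <= f x)%E ->
  (\int[nu]_x f x = \int[mu]_x (f x * (p x)%:E))%E.
Proof.
move=> mf f0.
have mpE : measurable_fun setT (EFin \o p) by exact/measurable_EFinP.
have indicE_ E : measurable E ->
    (\int[nu]_x (\1_E x)%:E = \int[mu]_x ((\1_E x)%:E * (p x)%:E))%E.
  move=> mE; rewrite integral_indic// setIT nuE// integral_mkcond.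
  apply: eq_integral => x _; rewrite patchE indicE.
  by case: ifPn => _; rewrite ?mul1e ?mul0e.
pose f_ := nnsfun_approx measurableT mf.
have nnsE (g : {nnsfun T >-> R}) :
    (\int[nu]_x (g x)%:E = \int[mu]_x ((g x)%:E * (p x)%:E))%E.
  under [LHS]eq_integral do rewrite fimfunE -fsumEFin//.
  rewrite [LHS]ge0_integral_fsum//; last 2 first.
  - by move=> r; exact/measurable_EFinP/measurableT_comp.
  - by move=> n x _; rewrite EFinM nnfun_muleindic_ge0.
  under [RHS]eq_integral.
    move=> x xD; rewrite fimfunE -fsumEFin// ge0_mule_fsuml; last first.
      by move=> r; rewrite EFinM nnfun_muleindic_ge0.
    over.
  rewrite [RHS]ge0_integral_fsum//; last 2 first.
  - move=> r; apply: emeasurable_funM => //.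
    by apply/measurable_EFinP; do 2 apply/measurableT_comp => //.
  - move=> n x _; apply: mule_ge0; rewrite ?lee_fin//.
    by rewrite -lee_fin EFinM nnfun_muleindic_ge0.
  apply: eq_fsbigr => r _.
  under [LHS]eq_integral do rewrite EFinM.
  under [RHS]eq_integral do rewrite EFinM -muleA.
  have mI : measurable_fun setT (fun x => (\1_(g @^-1` [set r]) x : R)%:E).
    by apply/measurable_EFinP; exact: measurable_indic.
  have [r0|r0] := leP 0 r.
    rewrite !ge0_integralZl//.
    - by rewrite indicE_.
    - exact: emeasurable_funM.
    - by move=> x _; rewrite mule_ge0 ?lee_fin.
  rewrite preimage_nnfun0// indic0.
  by rewrite !integral0_eq// => x _; rewrite ?mul0e ?mule0.
transitivity (lim (\int[nu]_x (f_ n x)%:E @[n --> \oo])%E).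
  rewrite -monotone_convergence//=.
  - apply: eq_integral => ? /[!inE] xD; apply/esym/cvg_lim => //=.
    exact: cvg_nnsfun_approx.
  - by move=> n; exact/measurable_EFinP/measurable_funTS.
  - by move=> n ? _; rewrite lee_fin.
  - by move=> ? _ ? ? mn; rewrite lee_fin; exact/lefP/nd_nnsfun_approx.
under eq_fun do rewrite nnsE.
rewrite -monotone_convergence//=.
- apply: eq_integral => x _; apply/cvg_lim => //.
  apply: cvgeZr => //.
  exact: cvg_nnsfun_approx.
- move=> n; apply: emeasurable_funM => //.
  exact/measurable_EFinP/measurable_funTS.
- by move=> n x _; rewrite mule_ge0 ?lee_fin.
- move=> x _ ? ? mn; rewrite lee_pmul ?lee_fin//.
  exact/lefP/nd_nnsfun_approx.
Qed.

End density.

Section gauss_moments.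
Context {R : realType}.
Local Notation mu := (@lebesgue_measure R).
Variable v : R.
Hypothesis v_gt0 : 0 < v.

(** With [g], the unnormalised centred Gaussian density of variance [v]. Moments are computed on it,
    and the normalisation is restored by [pJ0]. *)
Let c : R := - (v *+ 2)^-1.
Let g (x : R) : R := expR (c * x ^+ 2).

Let g_ge0 x : 0 <= g x. Proof. exact: expR_ge0. Qed.

Let dg (x : R) : is_derive x 1 g (- (x / v) * g x).
Proof.
have := @is_derive1_comp R expR (c \*: (@GRing.exp R ^~ 2)) x _ _ _ _.
move=> /(_ _ _ (is_derive_expR _) (is_deriveZ _ _)) h.
have -> : g = expR \o c \*: (GRing.exp (R:=R))^~ 2 by [].
apply: (is_derive_eq h); rewrite /g /c !fctE /= /GRing.scale /= !mulr1 -mulr_natl.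
by field; rewrite gt_eqF.
Qed.

Let cg : continuous g.
Proof.
by move=> x; apply: differentiable_continuous; apply/derivable1_diffP; case: (dg x).
Qed.

(** Antiderivative for Gaussian integration by parts: as g' = -(x / v) g, its derivative compares
    the integrands of the moments of orders k + 2 and k. This is the source of the recursion
    [J_rec]. *)
Let F (k : nat) (x : R) : R := - v * (x ^+ k.+1 * g x).

Let dF k (x : R) : is_derive x 1 (F k) (x ^+ k.+2 * g x - k.+1%:R * v * (x ^+ k * g x)).
Proof.
have h := is_deriveZ (- v) (is_deriveM (is_deriveX k.+1 (is_derive_id x 1)) (dg x)).
have -> : F k = - v \*: (id ^+ k.+1 * g) by apply/funext => y; rewrite /F !fctE.
apply: (is_derive_eq h); rewrite !fctE /= /GRing.scale /= !mulr1 !exprS.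
by field; rewrite gt_eqF.
Qed.

Let cxg k : continuous (fun x : R => x ^+ k * g x).
Proof. by move=> x; apply: cvgM; [exact: exprn_continuous|exact: cg]. Qed.

Let itvxg k (a b : R) : mu.-integrable `[a, b] (EFin \o (fun x : R => x ^+ k * g x)).
Proof.
apply: continuous_compact_integrable; first exact: segment_compact.
exact/continuous_subspaceT/cxg.
Qed.

Let partial_rec k (a : R) : 0 < a ->
  (\int[mu]_(x in `[0%R, a]) (x ^+ k.+2 * g x)%:E =
   (k.+1%:R * v)%:E * \int[mu]_(x in `[0%R, a]) (x ^+ k * g x)%:E + (F k a)%:E)%E.
Proof.
move=> a0.
have := @continuous_FTC2 R (fun x => x ^+ k.+2 * g x - k.+1%:R * v * (x ^+ k * g x)) (F k) 0 a a0.
have F0 : F k 0 = 0 by rewrite /F expr0n /= mul0r mulr0.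
have cF : continuous (F k).
  by move=> x; apply: differentiable_continuous; apply/derivable1_diffP; case: (dF k x).
rewrite F0 sube0 => <-; last 3 first.
- apply: continuous_subspaceT => x; apply: cvgB; first exact: cxg.
  by apply: cvgM; [exact: cvg_cst|exact: cxg].
- split.
  + by move=> x _; case: (dF k x).
  + exact/cvg_at_right_filter/cF.
  + exact/cvg_at_left_filter/cF.
- by move=> x _; rewrite derive1E; apply: derive_val.
under [X in (_ + X)%E]eq_integral do rewrite EFinB (EFinM (k.+1%:R * v)).
rewrite integralB//; last 2 first.
- exact: itvxg.
- by apply: integrableZl => //; exact: itvxg.
rewrite integralZl//; last exact: itvxg.
have /integrable_fin_num : mu.-integrable `[0, a] (EFin \o (fun x : R => x ^+ k * g x)) by exact: itvxg.
have /integrable_fin_num : mu.-integrable `[0, a] (EFin \o (fun x : R => x ^+ k.+2 * g x)) by exact: itvxg.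
rewrite /=.
move=> /(_ _) /fineK <-// /(_ _) /fineK <-//.
by rewrite -!(EFinM, EFinB, EFinD); congr EFin; ring.
Qed.

(** The boundary term of the integration by parts vanishes at infinity. The inequality exp y >= y,
    raised to the power k + 1, bounds it by a constant over n + 1. *)
Let pow_exp_cvg0 k : (n.+1%:R ^+ k * g n.+1%:R) @[n --> \oo] --> (0 : R).
Proof.
have [K K0 KE] : exists2 K : R, 0 < K & K = k.+1%:R by exists k.+1%:R.
pose C : R := ((v *+ 2) * K) ^+ k.+1.
have C0 : 0 < C by rewrite exprn_gt0// mulr_gt0// mulrn_wgt0.
apply: (@squeeze_cvgr _ _ _ _ (fun=> 0) (fun n => C * harmonic n)).
- near=> n; apply/andP; split; first by rewrite mulr_ge0 ?exprn_ge0.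
  set N : R := n.+1%:R.
  have N1 : 1 <= N by rewrite /N ler1n.
  have N0 : 0 < N by rewrite (lt_le_trans _ N1).
  (* Chosen so that [g N] is the inverse of (exp y)^(k+1); [C] collects the factors (2 v
     (k+1))^(k+1) that come out of y^(k+1). *)
  pose y := N ^+ 2 / (v *+ 2) / K.
  have y0 : 0 < y by rewrite !divr_gt0 ?exprn_gt0// mulrn_wgt0.
  have -> : g N = (expR y ^+ k.+1)^-1.
    rewrite -expRM_natl -expRN /g /c /y -KE; congr expR.
    by field; rewrite !gt_eqF.
  have ey : y ^+ k.+1 <= expR y ^+ k.+1.
    rewrite lerXn2r ?nnegrE ?expR_ge0 ?(ltW y0)//.
    by apply: le_trans (expR_ge1Dx y); rewrite lerDr.
  have yk : 0 < y ^+ k.+1 by rewrite exprn_gt0.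
  apply: (@le_trans _ _ (N ^+ k * (y ^+ k.+1)^-1)).
    by rewrite ler_pM2l ?exprn_gt0// lef_pV2// posrE (lt_le_trans yk).
  have -> : (y ^+ k.+1)^-1 = C * (N ^+ k.+1)^-1 * (N ^+ k.+1)^-1.
    rewrite /y /C -!exprVn -!exprMn; congr (_ ^+ _).
    by field; rewrite !gt_eqF.
  rewrite /harmonic /= -/N mulrCA -!mulrA ler_pM2l//.
  have -> : N ^- k.+1 * (N ^+ k * N ^- k.+1) = N ^- k.+1 * N^-1.
    by congr (_ * _); rewrite exprS invfM mulrCA divff ?mulr1// expf_neq0// gt_eqF.
  rewrite ler_piMl ?invr_ge0 ?(ltW N0)// invf_le1 ?exprn_gt0//.
  by rewrite exprn_ege1.
- exact: cvg_cst.
- rewrite -[X in _ --> X](mulr0 C).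
  by apply: cvgM; [exact: cvg_cst|exact: cvg_harmonic].
Unshelve. all: by end_near. Qed.

Let J k := (\int[mu]_(x in `[0%R, +oo[) (x ^+ k * g x)%:E)%E.

Let cvgJ k :
  (\int[mu]_(x in `[0%R, n.+1%:R]) (x ^+ k * g x)%:E)%E @[n --> \oo] --> J k.
Proof.
(* [ge0_cvgn_integral] wants a function nonnegative on the whole line; the absolute value provides
   it and changes nothing on the half-line. *)
have habs (b : R) : (\int[mu]_(x in `[0%R, b]) (x ^+ k * g x)%:E =
    \int[mu]_(x in `[0%R, b]) (`|x| ^+ k * g x)%:E)%E.
  apply: eq_integral => x; rewrite inE/= in_itv/= => /andP[x0 _].
  by rewrite ger0_norm.
have -> : J k = (\int[mu]_(x in `[0%R, +oo[) (`|x| ^+ k * g x)%:E)%E.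
  apply: eq_integral => x; rewrite inE/= in_itv/= andbT => x0.
  by rewrite ger0_norm.
under eq_fun do rewrite habs.
have h := @ge0_cvgn_integral R mu (fun x => `|x| ^+ k * g x).
have h' : (forall x, 0 <= `|x| ^+ k * g x) by move=> x; rewrite mulr_ge0 ?exprn_ge0.
have := h h' _; rewrite -cvg_shiftS; apply.
apply: measurable_funM.
  by apply: measurable_funX; exact: normr_measurable.
exact: continuous_measurable_fun.
Qed.

Let J_rec k : (J k.+2 = (k.+1%:R * v)%:E * J k)%E.
Proof.
rewrite -(cvg_lim _ (@cvgJ k.+2))//; apply/cvg_lim => //.
have -> : (fun n => \int[mu]_(x in `[0%R, n.+1%:R]) (x ^+ k.+2 * g x)%:E)%E =
   (fun n => (k.+1%:R * v)%:E * (\int[mu]_(x in `[0%R, n.+1%:R]) (x ^+ k * g x)%:E) + (F k n.+1%:R)%:E)%E.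
  by apply/funext => n; rewrite partial_rec.
rewrite -[X in _ --> X]adde0.
have J0 : (0 <= J k)%E.
  apply: integral_ge0 => x; rewrite /= in_itv/= andbT => x0.
  by rewrite lee_fin mulr_ge0 ?exprn_ge0.
apply: cvgeD.
- by rewrite fin_num_adde_defl.
- by apply: cvgeZl => //; exact: (@cvgJ k).
- apply: cvg_EFin; first by near=> n.
  rewrite /F -[X in _ --> X](mulr0 (- v)) /comp /=.
  by apply: cvgM; [exact: cvg_cst|exact: pow_exp_cvg0].
Unshelve. all: by end_near. Qed.

Let gN x : g (- x) = g x. Proof. by rewrite /g sqrrN. Qed.

Let ge0_integralT_split (f : R -> R) : (forall x, 0 <= f x) -> continuous f ->
  (\int[mu]_x (f x)%:E = \int[mu]_(x in `[0%R, +oo[) (f (- x))%:E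
     + \int[mu]_(x in `[0%R, +oo[) (f x)%:E)%E.
Proof.
move=> f0 cf.
have mf : measurable_fun [set: R] f by exact: continuous_measurable_fun.
have m0 : measurable (`[0%R, +oo[%classic : set R) by [].
rewrite -(setUv (`[0%R, +oo[%classic : set R)) ge0_integral_setU//= ; last 4 first.
  exact: measurableC.
  by apply/measurable_EFinP; rewrite setUv.
  by move=> x _; rewrite lee_fin.
  exact/disj_setPCl.
rewrite addeC; congr +%E.
rewrite setCitvr.
rewrite integral_itv_bndo_bndc; last exact/measurable_EFinP/measurable_funTS.
rewrite -{1}oppr0 ge0_integration_by_substitutionNy//.
exact: continuous_subspaceT.
Qed.

Let s : R := Num.sqrt v.
Let s_neq0 : s != 0. Proof. by rewrite gt_eqF// sqrtr_gt0. Qed.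
Let p : R := normal_peak s.
Let p_ge0 : 0 <= p. Proof. exact: normal_peak_ge0. Qed.

Let pdfE x : normal_pdf 0 s x = p * g x.
Proof.
rewrite normal_pdfE// /normal_fun subr0 sqr_sqrtr ?(ltW v_gt0)//.
by congr (_ * expR _); rewrite /c mulNr mulNr mulrC.
Qed.

Let pg_even k : (forall x : R, 0 <= x ^+ k) -> (forall x : R, (- x) ^+ k = x ^+ k) ->
  (\int[mu]_x (x ^+ k * normal_pdf 0 s x)%:E = p%:E * (J k + J k))%E.
Proof.
move=> k0 kN.
rewrite (ge0_integralT_split (f := fun x => x ^+ k * normal_pdf 0 s x)); last 2 first.
- by move=> x; rewrite pdfE !mulr_ge0.
- by move=> x; apply: cvgM; [exact: exprn_continuous|exact: continuous_normal_pdf].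
have h : (p%:E * J k = \int[mu]_(x in `[0%R, +oo[) (x ^+ k * normal_pdf 0 s x)%:E)%E.
  rewrite -ge0_integralZl ?lee_fin//.
  - by apply: eq_integral => x _; rewrite pdfE -EFinM mulrCA.
  - apply/measurable_EFinP; apply: measurable_funTS.
    by apply: continuous_measurable_fun; exact: cxg.
  - by move=> x _; rewrite lee_fin mulr_ge0.
have J0 : (0 <= J k)%E.
  by apply: integral_ge0 => x _; rewrite lee_fin mulr_ge0.
transitivity (p%:E * J k + p%:E * J k)%E; last exact/esym/ge0_muleDr.
congr (_ + _)%E; last exact/esym/h.
transitivity (\int[mu]_(x in `[0%R, +oo[) (x ^+ k * normal_pdf 0 s x)%:E)%E.
  by apply: eq_integral => x _; rewrite kN !pdfE gN.
exact/esym/h.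
Qed.

(** Total mass one is all that is needed: combined with [J_rec] it yields the even moments, without
    the value of the Gaussian integral. *)
Let pJ0 : (p%:E * (J 0 + J 0) = 1)%E.
Proof.
rewrite -pg_even//.
under eq_integral do rewrite expr0 mul1r.
exact: integral_normal_pdf.
Qed.

Let gauss2 : (\int[mu]_x (x ^+ 2 * normal_pdf 0 s x)%:E = v%:E)%E.
Proof.
rewrite pg_even; [|by move=> x; exact: sqr_ge0|by move=> x; exact: sqrrN].
have J0 : (0 <= J 0)%E.
  by apply: integral_ge0 => x _; rewrite lee_fin mulr_ge0.
by rewrite J_rec mul1r -muleDr ?ge0_adde_def ?inE// muleCA pJ0 mule1.
Qed.

Let gauss4 : (\int[mu]_x (x ^+ 4 * normal_pdf 0 s x)%:E = (3 * v ^+ 2)%:E)%E.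
Proof.
rewrite pg_even; last 2 first.
- by move=> x; rewrite exprn_even_ge0.
- by move=> x; rewrite exprNn -signr_odd mul1r.
have J0 : (0 <= J 0)%E.
  by apply: integral_ge0 => x _; rewrite lee_fin mulr_ge0.
rewrite !J_rec mul1r !muleA -muleDr ?ge0_adde_def ?inE// muleCA pJ0 mule1 -EFinM.
by congr EFin; ring.
Qed.

Context d (T : measurableType d) (P : probability T R) (xi : T -> R).
Hypothesis mxi : measurable_fun setT xi.
Hypothesis xi_law : forall U : set R, measurable U ->
  P [set w | U (xi w)] = normal_prob 0 s U.

Let ge0_law (f : R -> R) : measurable_fun setT f -> (forall x, 0 <= f x) ->
  (\int[P]_w (f (xi w))%:E = \int[mu]_x (f x * normal_pdf 0 s x)%:E)%E.
Proof.
move=> mf f0.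
pose X : {RV P >-> measurableTypeR R} := HB.pack (xi : T -> measurableTypeR R)
  (isMeasurableFun.Build _ _ T (measurableTypeR R) xi mxi).
have mfE : measurable_fun setT ((EFin \o f) : measurableTypeR R -> \bar R).
  exact/measurable_EFinP.
have := @ge0_integral_distribution _ _ T (measurableTypeR R) R P X (EFin \o f) mfE.
move=> <-; last by move=> x; rewrite lee_fin.
transitivity (\int[normal_prob 0 s]_x (f x)%:E)%E.
  by apply: eq_measure_integral => A mA _; exact: xi_law.
rewrite (@ge0_integral_density _ _ _ mu _ (normal_pdf 0 s))//.
- by move=> x; exact: normal_pdf_ge0.
- exact: measurable_normal_pdf.
Qed.

Lemma gaussian_moment2 : (\int[P]_w (xi w ^+ 2)%:E = v%:E)%E.
Proof.
rewrite -gauss2 (ge0_law (f := fun x => x ^+ 2))//.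
by move=> x; exact: sqr_ge0.
Qed.

Lemma gaussian_moment4 : (\int[P]_w (xi w ^+ 4)%:E = (3 * v ^+ 2)%:E)%E.
Proof.
rewrite -gauss4 (ge0_law (f := fun x => x ^+ 4))//.
by move=> x; rewrite exprn_even_ge0.
Qed.

Lemma gaussian_integrable k : (k <= 4)%N -> P.-integrable setT (fun w => (xi w ^+ k)%:E).
Proof.
move=> k4.
apply: (@le_integrable _ _ _ _ _ _ _ (fun w => (1 + xi w ^+ 4)%:E)) => //.
- by apply/measurable_EFinP/measurable_funX.
- move=> w _ /=; rewrite lee_fin [leRHS]ger0_norm ?addr_ge0 ?exprn_even_ge0// normrX.
  have [x1|x1] := leP `|xi w| 1.
    by rewrite (@le_trans _ _ 1) ?exprn_ile1// lerDl exprn_even_ge0.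
  apply: (@le_trans _ _ (`|xi w| ^+ 4)); first by rewrite ler_eXn2l.
  by rewrite -normrX ger0_norm ?exprn_even_ge0// lerDr.
apply/integrableP; split.
  by apply/measurable_EFinP/measurable_funD => //; exact: measurable_funX.
under eq_integral => w _.
  rewrite /= ger0_norm ?addr_ge0 ?exprn_even_ge0// EFinD; over.
rewrite ge0_integralD//.
- by rewrite gaussian_moment4 integral_cst//= probability_setT mul1e -EFinD ltry.
- by move=> x _; rewrite lee_fin exprn_even_ge0.
- by apply/measurable_EFinP/measurable_funX.
Qed.

(** The positive and negative parts of the odd power are [f (xi w)] and [f (- xi w)]. The density is
    even, so they have the same integral, which is finite, and they cancel. *)
Lemma gaussian_moment_odd k : (k <= 4)%N -> odd k -> (\int[P]_w (xi w ^+ k)%:E = 0)%E.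
Proof.
move=> k4 ok.
pose f (x : R) := Num.max (x ^+ k) 0.
have cf : continuous f.
  by move=> x; apply: (@continuous_max R R (fun x => x ^+ k) (fun=> 0) x); [exact: exprn_continuous|exact: cvg_cst].
have mf : measurable_fun setT f by exact: continuous_measurable_fun.
have f0 x : 0 <= f x by rewrite /f le_max lexx orbT.
have fN x : f (- x) = Num.max (- x ^+ k) 0.
  by rewrite /f exprNn -signr_odd ok expr1 mulN1r.
have posE : ((fun w => (xi w ^+ k)%:E)^\+ = fun w => (f (xi w))%:E)%E.
  by apply/funext => w; rewrite funeposE /f EFin_max.
have fin : (\int[P]_w (f (xi w))%:E)%E \is a fin_num.
  apply: integrable_fin_num => //; rewrite -posE.
  by apply: integrable_funepos => //; exact: gaussian_integrable.
rewrite integralE posE.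
have -> : ((fun w => (xi w ^+ k)%:E)^\- = fun w => (f (- xi w))%:E)%E.
  by apply/funext => w; rewrite funenegE fN EFin_max.
have mfN : measurable_fun setT (fun x : R => f (- x)).
  by apply: measurableT_comp => //; exact: oppr_measurable.
have cfp : continuous (fun x : R => f x * normal_pdf 0 s x).
  by move=> x; apply: cvgM; [exact: cf|exact: continuous_normal_pdf].
have cfNp : continuous (fun x : R => f (- x) * normal_pdf 0 s x).
  move=> x; apply: cvgM; last exact: continuous_normal_pdf.
  by apply: (@continuous_comp _ _ _ (-%R) f); [exact: continuousN|exact: cf].
have pdfN x : normal_pdf 0 s (- x) = normal_pdf 0 s x by rewrite !pdfE gN.
suff -> : (\int[P]_w (f (- xi w))%:E = \int[P]_w (f (xi w))%:E)%E.
  by rewrite subee.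
rewrite (ge0_law mf f0) (ge0_law mfN)//.
rewrite (ge0_integralT_split _ cfp); last first.
  by move=> x; rewrite mulr_ge0// normal_pdf_ge0.
rewrite (ge0_integralT_split _ cfNp); last first.
  by move=> x; rewrite mulr_ge0// normal_pdf_ge0.
have h (f1 : R -> R) (f2 : R -> R) : f1 =1 f2 ->
    (\int[mu]_(x in `[0%R, +oo[) (f1 x)%:E = \int[mu]_(x in `[0%R, +oo[) (f2 x)%:E)%E.
  by move=> f12; apply: eq_integral => x _; rewrite f12.
rewrite (h _ (fun x => f x * normal_pdf 0 s x)); last by move=> x; rewrite opprK pdfN.
rewrite [in RHS](h _ (fun x => f (- x) * normal_pdf 0 s x)); last by move=> x; rewrite pdfN.
exact: addeC.
Qed.
End gauss_moments.

(** * Expectations and independence *)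

Section expectation_toolkit.
Context {d} {T : measurableType d} {R : realType} (P : probability T R).
Implicit Types f g X Y : T -> R.

Definition integrable_rv f := P.-integrable setT (EFin \o f).
Definition mean f : R := \int[P]_w f w.

Lemma integrable_rv_measurable f : integrable_rv f -> measurable_fun setT f.
Proof. by move=> /integrableP[/measurable_EFinP]. Qed.

Lemma meanE f : integrable_rv f -> (\int[P]_w (f w)%:E)%E = (mean f)%:E.
Proof. by move=> fi; rewrite /mean /Rintegral fineK//; exact: integrable_fin_num. Qed.

Lemma integrable_rv_cst c : integrable_rv (fun=> c).
Proof. exact: finite_measure_integrable_cst. Qed.

Lemma integrable_rvD f g : integrable_rv f -> integrable_rv g ->
  integrable_rv (fun w => f w + g w).
Proof. by move=> fi gi; have := integrableD measurableT fi gi. Qed.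

Lemma integrable_rvB f g : integrable_rv f -> integrable_rv g ->
  integrable_rv (fun w => f w - g w).
Proof. by move=> fi gi; have := integrableB measurableT fi gi. Qed.

Lemma integrable_rvZ c f : integrable_rv f -> integrable_rv (fun w => c * f w).
Proof. by move=> fi; have := integrableZl measurableT c fi. Qed.

Lemma integrable_rv_norm f : integrable_rv f -> integrable_rv (fun w => `|f w|).
Proof. by move=> fi; have := integrable_norm fi. Qed.

Lemma integrable_rv_sum (I : Type) (s : seq I) (F : I -> T -> R) :
  (forall i, integrable_rv (F i)) -> integrable_rv (fun w => \sum_(i <- s) F i w).
Proof.
move=> Fi; elim: s => [|i s IH].
  by under eq_fun do rewrite big_nil; exact: integrable_rv_cst.
by under eq_fun do rewrite big_cons; exact: integrable_rvD.
Qed.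

Lemma integrable_rv_dom f g : measurable_fun setT f -> integrable_rv g ->
  (forall w, `|f w| <= g w) -> integrable_rv f.
Proof.
move=> mf gi fg; apply: (le_integrable measurableT _ _ gi); first exact/measurable_EFinP.
by move=> w _; rewrite /= lee_fin (le_trans (fg w))// ler_norm.
Qed.

Lemma mean_cst c : mean (fun=> c) = c.
Proof. by rewrite /mean Rintegral_cst//= probability_setT mulr1. Qed.

Lemma meanD f g : integrable_rv f -> integrable_rv g ->
  mean (fun w => f w + g w) = mean f + mean g.
Proof. by move=> fi gi; rewrite /mean RintegralD. Qed.

Lemma meanB f g : integrable_rv f -> integrable_rv g ->
  mean (fun w => f w - g w) = mean f - mean g.
Proof. by move=> fi gi; rewrite /mean RintegralB. Qed.

Lemma meanZ c f : integrable_rv f -> mean (fun w => c * f w) = c * mean f.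
Proof. by move=> fi; rewrite /mean RintegralZl. Qed.

Lemma mean_sum (I : Type) (s : seq I) (F : I -> T -> R) :
  (forall i, integrable_rv (F i)) ->
  mean (fun w => \sum_(i <- s) F i w) = \sum_(i <- s) mean (F i).
Proof.
move=> Fi; elim: s => [|i s IH].
  by under eq_fun do rewrite big_nil; rewrite big_nil mean_cst.
under eq_fun do rewrite big_cons.
by rewrite meanD// ?big_cons ?IH//; exact: integrable_rv_sum.
Qed.

Lemma le_mean f g : integrable_rv f -> integrable_rv g ->
  (forall w, f w <= g w) -> mean f <= mean g.
Proof. by move=> fi gi fg; apply: le_Rintegral. Qed.

Lemma mean_ge0 f : (forall w, 0 <= f w) -> 0 <= mean f.
Proof. by move=> f0; apply: Rintegral_ge0. Qed.

Lemma le_norm_mean f : integrable_rv f -> `|mean f| <= mean (fun w => `|f w|).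
Proof. by move=> fi; apply: le_normr_Rintegral. Qed.

Lemma integrable_rv_mul_bounded f g c : integrable_rv f -> measurable_fun setT g ->
  (forall w, `|g w| <= c) -> integrable_rv (fun w => f w * g w).
Proof.
move=> fi mg gc.
apply: (@integrable_rv_dom _ (fun w => c * `|f w|)).
- by apply: measurable_funM => //; exact: integrable_rv_measurable.
- by apply: integrable_rvZ; exact: integrable_rv_norm.
- by move=> w; rewrite normrM mulrC ler_wpM2r.
Qed.

End expectation_toolkit.

Section independence.
Context {d} {T : measurableType d} {R : realType} (P : probability T R).
Local Notation TR := (measurableTypeR R).
Variables (X Y : T -> R).
Hypotheses (mX : measurable_fun setT X) (mY : measurable_fun setT Y).
Hypothesis XY : forall U V : set R, measurable U -> measurable V ->
  P (X @^-1` U `&` Y @^-1` V) = (P (X @^-1` U) * P (Y @^-1` V))%E.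

(** Factorisation on rectangles identifies the joint law with the product of the marginals, by
    uniqueness of the product measure; Tonelli then splits the integral. *)
Let ge0_mean_indep (f g : R -> R) :
  measurable_fun setT f -> measurable_fun setT g ->
  (forall x, 0 <= f x) -> (forall x, 0 <= g x) ->
  (\int[P]_w (f (X w) * g (Y w))%:E =
   \int[P]_w (f (X w))%:E * \int[P]_w (g (Y w))%:E)%E.
Proof.
move=> mf mg f0 g0.
pose X' : {RV P >-> TR} := HB.pack (X : T -> TR) (isMeasurableFun.Build _ _ T TR X mX).
pose Y' : {RV P >-> TR} := HB.pack (Y : T -> TR) (isMeasurableFun.Build _ _ T TR Y mY).
have mZ : measurable_fun setT (fun w => (X' w, Y' w)).
  by apply/measurable_fun_pairP; split.
pose Z : {RV P >-> (TR * TR)%type} := HB.pack (fun w => (X' w, Y' w))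
  (isMeasurableFun.Build _ _ T (TR * TR)%type _ mZ).
pose h (z : TR * TR) := (f z.1 * g z.2)%:E.
have mh : measurable_fun setT h.
  by apply/measurable_EFinP; apply: measurable_funM; apply: measurableT_comp.
have h0 z : (0 <= h z)%E by rewrite lee_fin mulr_ge0.
have := @ge0_integral_distribution _ _ T _ R P Z h mh h0.
move=> /esym; rewrite /h /comp /=; move=> ->.
transitivity (\int[(distribution P X' \x distribution P Y')%E]_z h z)%E.
  apply: eq_measure_integral => A mA _; apply/esym.
  apply: (@product_measure_unique _ _ TR TR R (distribution P X') (distribution P Y') (distribution P Z)) => //.
rewrite fubini_tonelli1//.
have mgE : measurable_fun setT (EFin \o g) by exact/measurable_EFinP.
have mfE : measurable_fun setT (EFin \o f) by exact/measurable_EFinP.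
have := @ge0_integral_distribution _ _ T TR R P Y' (EFin \o g) mgE.
move=> <-; last by move=> x; rewrite lee_fin.
have := @ge0_integral_distribution _ _ T TR R P X' (EFin \o f) mfE.
move=> <-; last by move=> x; rewrite lee_fin.
rewrite -ge0_integralZr//; last 2 first.
- by move=> x _; rewrite lee_fin.
- by apply: integral_ge0 => x _; rewrite lee_fin.
apply: eq_integral => x _; rewrite /fubini_F /h /=.
under eq_integral do rewrite EFinM.
by rewrite ge0_integralZl// ?lee_fin// => y _; rewrite lee_fin.
Qed.

Let pos (x : R) : R := Num.max x 0.
Let mpos : measurable_fun setT pos.
Proof. by apply: measurable_maxr => //; exact: measurable_cst. Qed.
Let neg (x : R) : R := Num.max (- x) 0.
Let mneg : measurable_fun setT neg.
Proof. by apply: measurable_maxr => //; exact: measurable_cst. Qed.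
Let pos_ge0 x : 0 <= pos x. Proof. by rewrite /pos le_max lexx orbT. Qed.
Let neg_ge0 x : 0 <= neg x. Proof. by rewrite /neg le_max lexx orbT. Qed.
Let posneg x : x = pos x - neg x.
Proof.
rewrite /pos /neg; have [x0|x0] := leP 0 x.
  by rewrite (@max_r _ _ (- x)) ?subr0// oppr_le0.
by rewrite max_l ?sub0r ?opprK// oppr_ge0 ltW.
Qed.
Let posnorm x : `|pos x| <= `|x|.
Proof. by rewrite /pos; have [x0|x0] := leP x 0; rewrite ?normr0// (ltW x0). Qed.
Let negnorm x : `|neg x| <= `|x|.
Proof. by rewrite /neg -[in leRHS]normrN; exact: posnorm. Qed.

(** Positive and negative parts reduce the claim to four products of nonnegative variables, for
    which finite means of the factors already give an integrable product. *)
Lemma mean_indep : integrable_rv P X -> integrable_rv P Y ->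
  integrable_rv P (fun w => X w * Y w) /\
  mean P (fun w => X w * Y w) = mean P X * mean P Y.
Proof.
move=> iX iY.
have tr (f : R -> R) (W : T -> R) : measurable_fun setT f -> (forall x, `|f x| <= `|x|) ->
    integrable_rv P W -> integrable_rv P (fun w => f (W w)).
  move=> mf fx iW; apply: (integrable_rv_dom _ (integrable_rv_norm iW)).
    by apply: measurableT_comp => //; exact: (integrable_rv_measurable iW).
  by move=> w; exact: fx.
have H (f g : R -> R) : measurable_fun setT f -> measurable_fun setT g ->
    (forall x, 0 <= f x) -> (forall x, 0 <= g x) ->
    (forall x, `|f x| <= `|x|) -> (forall x, `|g x| <= `|x|) ->
    integrable_rv P (fun w => f (X w) * g (Y w)) /\
    mean P (fun w => f (X w) * g (Y w)) = mean P (fun w => f (X w)) * mean P (fun w => g (Y w)).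
  move=> mf mg f0 g0 fx gx.
  have := ge0_mean_indep mf mg f0 g0.
  rewrite (meanE (tr _ _ mf fx iX)) (meanE (tr _ _ mg gx iY)) -EFinM => E.
  split.
    apply/integrableP; split.
      by apply/measurable_EFinP; apply: measurable_funM; apply: measurableT_comp.
    under eq_integral => w _.
      rewrite /= ger0_norm ?mulr_ge0//; over.
    by rewrite E ltry.
  by rewrite {1}/mean /Rintegral E.
have [pp epp] := H _ _ mpos mpos pos_ge0 pos_ge0 posnorm posnorm.
have [pn epn] := H _ _ mpos mneg pos_ge0 neg_ge0 posnorm negnorm.
have [np enp] := H _ _ mneg mpos neg_ge0 pos_ge0 negnorm posnorm.
have [nn enn] := H _ _ mneg mneg neg_ge0 neg_ge0 negnorm negnorm.
have e : (fun w => X w * Y w) = (fun w => (pos (X w) * pos (Y w) - pos (X w) * neg (Y w))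
    - (neg (X w) * pos (Y w) - neg (X w) * neg (Y w))).
  apply/funext => w; rewrite {1}(posneg (X w)) {1}(posneg (Y w)); ring.
have dec (W : T -> R) : integrable_rv P W ->
    mean P W = mean P (fun w => pos (W w)) - mean P (fun w => neg (W w)).
  move=> iW; rewrite -meanB//; [|exact: tr|exact: tr].
  by congr mean; apply/funext => w; exact: posneg.
have i1 := integrable_rvB pp pn; have i2 := integrable_rvB np nn.
split; rewrite e; first exact: integrable_rvB.
rewrite (meanB i1 i2) (meanB pp pn) (meanB np nn) epp epn enp enn (dec _ iX) (dec _ iY).
ring.
Qed.

End independence.

Section measurable_wrt.
Context {T : pointedType} {R : realType}.
Implicit Types (G : set (set T)) (Y : T -> R).

(** Changing the source type to [g_sigma_algebraType G] makes every closure property of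
    [measurable_fun] available for a sub-sigma-algebra. *)
Definition measurable_wrt G Y :=
  measurable_fun setT (Y : g_sigma_algebraType G -> R).

Lemma measurable_wrt_sub G G' Y : <<s G >> `<=` <<s G' >> ->
  measurable_wrt G Y -> measurable_wrt G' Y.
Proof. by move=> GG' mY mT U mU; apply: GG'; exact: (mY measurableT). Qed.

Lemma measurable_wrt_preimage G Y (U : set R) : measurable_wrt G Y ->
  measurable U -> <<s G >> (Y @^-1` U).
Proof. by move=> mY mU; rewrite -[X in _ X]setTI; exact: (mY measurableT). Qed.

Lemma measurable_wrt_preimage_system G Y :
  preimage_set_system setT Y measurable `<=` <<s G >> -> measurable_wrt G Y.
Proof. by move=> YG mT U mU; apply: YG; exists U. Qed.

End measurable_wrt.

Section independent_of_pi_system.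
Context {d} {T : measurableType d} {R : realType} (P : probability T R).
Variables (G : set (set T)) (xi : T -> R).
Hypotheses (GI : setI_closed G) (GT : G setT) (Gm : G `<=` measurable).
Hypothesis mxi : measurable_fun setT xi.
Hypothesis indep : forall A V, G A -> measurable V ->
  P (A `&` xi @^-1` V) = (P A * P (xi @^-1` V))%E.

Lemma measurable_wrt_measurable (Y : T -> R) : measurable_wrt G Y -> measurable_fun setT Y.
Proof.
move=> mY mT U mU; have := mY measurableT U mU.
by apply: smallest_sub; [exact: sigma_algebra_measurable|exact: Gm].
Qed.

(** For fixed [V], both sides are finite measures in [A] (a restriction and a multiple of [P]) that
    agree on a pi-system containing the whole space. *)
Lemma pi_system_indep A V : <<s G >> A -> measurable V ->
  P (A `&` xi @^-1` V) = (P A * P (xi @^-1` V))%E.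
Proof.
move=> GA mV.
have mxV : measurable (xi @^-1` V) by rewrite -[X in measurable X]setTI; exact: mxi.
have h0 : 0 <= fine (P (xi @^-1` V)) by apply: fine_ge0.
pose k : {nonneg R} := NngNum h0.
have kE : (P (xi @^-1` V) = k%:num%:E)%E by rewrite /= fineK// fin_num_measure.
pose m1 : {measure set T -> \bar R} := mrestr P mxV.
pose m2 : {measure set T -> \bar R} := mscale k P.
have := @g_sigma_algebra_measure_unique _ R T G Gm (fun=> setT) (fun=> GT) _ m1 m2 GI.
move=> /(_ _ _ _ A GA).
rewrite -/(P (A `&` xi @^-1` V)) [X in _ -> _ -> _ -> _ = X]/= /mscale /= muleC kE; apply.
- by apply/seteqP; split => // x _; exists 0%N.
- by move=> B GB; rewrite /m1 /m2 /mrestr /mscale /= indep// muleC kE.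
- by move=> _; rewrite /m1 /mrestr setTI (le_lt_trans (probability_le1 _ _))// ltry.
Qed.

Lemma mean_pi_system_indep (f : R -> R) (Y : T -> R) : measurable_fun setT f ->
  measurable_wrt G Y -> integrable_rv P Y -> integrable_rv P (fun w => f (xi w)) ->
  integrable_rv P (fun w => Y w * f (xi w)) /\
  mean P (fun w => Y w * f (xi w)) = mean P Y * mean P (fun w => f (xi w)).
Proof.
move=> mf mY iY ixi; apply: mean_indep => //.
- exact: measurable_wrt_measurable.
- exact: measurableT_comp.
move=> U V mU mV; apply: (@pi_system_indep _ (f @^-1` V)).
  exact: measurable_wrt_preimage.
by rewrite -[X in measurable X]setTI; exact: mf.
Qed.

End independent_of_pi_system.

Section brownian_increments.
Context {d} {Omega : measurableType d} {R : realType} (P : probability Omega R).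
Variables (T : R) (B B' : R -> Omega -> R).
Hypotheses (B_bm : brownian_motion P T B).
Hypothesis B'_measurable : forall t : R, t \in `[0, T] -> measurable_fun setT (B' t).
Hypothesis BB' : independent_systems P (sigma_generated `[0, T] B) (sigma_generated `[0, T] B').

Let preimage_measurable (X : R -> Omega -> R) (D : set R) :
  (forall t, D t -> measurable_fun setT (X t)) -> sigma_generated D X `<=` measurable.
Proof.
move=> mX; apply: smallest_sub; first exact: sigma_algebra_measurable.
by move=> A [t Dt [U mU <-]]; exact: mX.
Qed.

Let sigma_le (X : R -> Omega -> R) (D D' : set R) : D `<=` D' ->
  sigma_generated D X `<=` sigma_generated D' X.
Proof.
by move=> DD'; apply: sub_sigma_algebra2; exact: bigcup_subset.
Qed.

(** A pi-system, not a sigma-algebra: independence is checked on these intersections only. The whole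
    path of [B'] up to [T] is included, so that an increment of [B'] over a later cell can itself
    serve as a coefficient in front of an increment of [B]. *)
Definition enlarged_past (s : R) : set (set Omega) :=
  [set C | exists A A', [/\ sigma_generated `[0, s] B A,
     sigma_generated `[0, T] B' A' & C = A `&` A']].

Let sigma_algebraT (X : R -> Omega -> R) (D : set R) : sigma_generated D X setT.
Proof.
exact: (@measurableT _ (g_sigma_algebraType _)).
Qed.

Let sigma_algebraI (X : R -> Omega -> R) (D : set R) : setI_closed (sigma_generated D X).
Proof. by move=> A A' hA hA'; exact: (@measurableI _ (g_sigma_algebraType _) _ _ hA hA'). Qed.

Lemma enlarged_past_setI s : setI_closed (enlarged_past s).
Proof.
move=> _ _ [A1 [A1' [h1 h1' ->]]] [A2 [A2' [h2 h2' ->]]].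
exists (A1 `&` A2), (A1' `&` A2'); split; [exact: sigma_algebraI|exact: sigma_algebraI|].
by rewrite setIACA.
Qed.


Lemma enlarged_past_setT s : enlarged_past s setT.
Proof. by exists setT, setT; split; rewrite ?setTI//; exact: sigma_algebraT. Qed.

Lemma enlarged_past_measurable s : s \in `[0, T] -> enlarged_past s `<=` measurable.
Proof.
rewrite in_itv/= => /andP[s0 sT] _ [A [A' [hA hA' ->]]]; apply: measurableI.
- apply: (preimage_measurable _ hA) => t; rewrite /= in_itv/= => /andP[t0 ts].
  by apply: (bm_measurable B_bm); rewrite in_itv/= t0 (le_trans ts).
- apply: (preimage_measurable _ hA') => t /= tT; exact: B'_measurable.
Qed.

Lemma enlarged_past_l s u : u \in `[0, s] -> measurable_wrt (enlarged_past s) (B u).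
Proof.
move=> us; apply: measurable_wrt_preimage_system => A BA; apply: sub_gen_smallest.
exists A, setT; split; rewrite ?setIT//.
by apply: sub_gen_smallest; exists u.
Qed.

Lemma enlarged_past_r s u : u \in `[0, T] -> measurable_wrt (enlarged_past s) (B' u).
Proof.
move=> uT; apply: measurable_wrt_preimage_system => A BA; apply: sub_gen_smallest.
exists setT, A; split; rewrite ?setTI//.
by apply: sub_gen_smallest; exists u.
Qed.

Section increment.
Variables (s t : R).
Hypotheses (s_ge0 : 0 <= s) (st : s < t) (tT : t <= T).
Let xi w := B t w - B s w.

Let sT : s \in `[0, T]. Proof. by rewrite in_itv/= s_ge0 (le_trans (ltW st)). Qed.
Let tT' : t \in `[0, T]. Proof. by rewrite in_itv/= tT (le_trans s_ge0 (ltW st)). Qed.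

Let mxi : measurable_fun setT xi.
Proof. by apply: measurable_funB; apply: (bm_measurable B_bm). Qed.

Let xi_indep A V : enlarged_past s A -> measurable V ->
  P (A `&` xi @^-1` V) = (P A * P (xi @^-1` V))%E.
Proof.
move=> [A1 [A2 [h1 h2 ->]]] mV.
have hV : sigma_generated `[0, T] B (xi @^-1` V).
  have mB u : u \in `[0, T] -> measurable_wrt
      (\bigcup_(s in `[0, T]%classic) preimage_set_system setT (B s) measurable) (B u).
    move=> uT; apply: measurable_wrt_preimage_system => C BC; apply: sub_gen_smallest.
    by exists u.
  have : measurable_wrt _ xi := measurable_funB (mB _ tT') (mB _ sT).
  by move/measurable_wrt_preimage; exact.
have h1T : sigma_generated `[0, T] B A1.
  apply: (sigma_le _ h1) => u; rewrite /= !in_itv/= => /andP[-> us].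
  by move: sT; rewrite in_itv/= => /andP[_]; exact: le_trans.
(* The event on [B'] is split off from everything that depends on [B]; the increment is then
   separated from [A1] by independence of Brownian increments. *)
rewrite setIAC (BB' (sigma_algebraI h1T hV) h2) (BB' h1T h2).
rewrite (bm_independent B_bm s_ge0 st tT h1); last first.
  by exists V => //; rewrite setTI.
by rewrite muleAC.
Qed.

Lemma increment_moment k (Y : Omega -> R) : (k <= 4)%N ->
  measurable_wrt (enlarged_past s) Y -> integrable_rv P Y ->
  integrable_rv P (fun w => Y w * (B t w - B s w) ^+ k) /\
  mean P (fun w => Y w * (B t w - B s w) ^+ k) =
  mean P Y * mean P (fun w => (B t w - B s w) ^+ k).
Proof.
move=> k4 mY iY.
apply: (@mean_pi_system_indep _ _ _ P (enlarged_past s) xi _ _ _ _ _ (fun x => x ^+ k)) => //.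
- exact: enlarged_past_setI.
- exact: enlarged_past_setT.
- exact: enlarged_past_measurable.
- apply: (gaussian_integrable (v := t - s)) => //; first by rewrite subr_gt0.
  exact: (bm_normal B_bm).
Qed.

Let law := bm_normal B_bm s_ge0 st tT.
Let ts_gt0 : 0 < t - s. Proof. by rewrite subr_gt0. Qed.

Lemma increment_mean_odd k : (k <= 4)%N -> odd k -> mean P (fun w => (B t w - B s w) ^+ k) = 0.
Proof. by move=> k4 ok; rewrite /mean /Rintegral (gaussian_moment_odd ts_gt0 mxi law). Qed.

Lemma increment_mean2 : mean P (fun w => (B t w - B s w) ^+ 2) = t - s.
Proof. by rewrite /mean /Rintegral (gaussian_moment2 ts_gt0 mxi law). Qed.

Lemma increment_mean4 : mean P (fun w => (B t w - B s w) ^+ 4) = 3 * (t - s) ^+ 2.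
Proof. by rewrite /mean /Rintegral (gaussian_moment4 ts_gt0 mxi law). Qed.

End increment.

End brownian_increments.

(** * Sums of the kernel over a grid *)

(** The free weight [e] has two uses: balancing the two factors in the modulus of the kernel sums,
    and bounding first moments by second moments (with [y] = 1). *)
Lemma weighted_amgm (R : realFieldType) (e x y : R) : 0 < e ->
  `|x * y| <= (x ^+ 2 / e + e * y ^+ 2) / 2.
Proof.
move=> e0; have -> : (x ^+ 2 / e + e * y ^+ 2) / 2 =
    ((`|x| - e * `|y|) ^+ 2 / e) / 2 + `|x * y|.
  have x2 : `|x| ^+ 2 = x ^+ 2 by rewrite -normrX ger0_norm ?sqr_ge0.
  have y2 : `|y| ^+ 2 = y ^+ 2 by rewrite -normrX ger0_norm ?sqr_ge0.
  by rewrite normrM -x2 -y2; field; rewrite gt_eqF.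
by rewrite lerDr !divr_ge0 ?sqr_ge0 ?(ltW e0).
Qed.

Section grid.
Context {R : realType}.
Local Notation mu := (@lebesgue_measure R).
Variables (T : R) (n : nat) (t : nat -> R).
Hypothesis t_grid : is_grid T n t.

Lemma grid_le i j : (i <= j <= n)%N -> t i <= t j.
Proof.
have [_ _ ts] := t_grid.
move=> /andP[ij jn]; elim: j ij jn => [|j IH]; first by rewrite leqn0 => /eqP ->.
rewrite leq_eqVlt => /predU1P[-> //|ij jn].
by apply: le_trans (IH ij (ltnW jn)) _; exact/ltW/ts.
Qed.

Lemma grid_itv i : (i <= n)%N -> t i \in `[0, T].
Proof.
have [t0 tT _] := t_grid => ni.
rewrite in_itv/=; apply/andP; split.
  by rewrite -t0 grid_le.
by rewrite -[leRHS]tT grid_le// ni leqnn.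
Qed.

Lemma grid_gt0 : (0 < n)%N -> 0 < T.
Proof.
have [t0 tT ts] := t_grid => n0.
by rewrite -t0 (lt_le_trans (ts _ n0))// -[leRHS]tT grid_le// n0 leqnn.

Qed.

Lemma grid_cell (s : R) : 0 <= s < T -> exists2 k, (k < n)%N & s \in `[t k, t k.+1[.
Proof.
have [t0 tT ts] := t_grid.
move=> /andP[s0 sT].
have : exists k, (k <= n)%N && (s < t k) by exists n; rewrite leqnn tT.
move=> /ex_minnP[[|k]/andP[kn sk] kmin].
  by move: sk; rewrite t0 ltNge s0.
exists k => //; rewrite in_itv/= sk andbT leNgt; apply/negP => sk'.
by have := kmin k; rewrite sk' (ltnW kn) ltnn => /(_ isT).
Qed.

Lemma grid_cell_uniq s i j : (i < n)%N -> (j < n)%N ->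
  s \in `[t i, t i.+1[ -> s \in `[t j, t j.+1[ -> i = j.
Proof.
move=> ni nj; rewrite !in_itv/= => /andP[i1 i2] /andP[j1 j2].
have [ij|ji|//] := ltngtP i j.
- have h : t i.+1 <= t j by apply: grid_le; rewrite ij ltnW.
  by have := lt_le_trans i2 (le_trans h j1); rewrite ltxx.
- have h : t j.+1 <= t i by apply: grid_le; rewrite ji ltnW.
  by have := lt_le_trans j2 (le_trans h i1); rewrite ltxx.
Qed.

Lemma sum_cell (f : nat -> R) s k : (k < n)%N -> s \in `[t k, t k.+1[ ->
  \sum_(i < n) f i * \1_`[t i, t i.+1[ s = f k.
Proof.
move=> kn sk; rewrite (bigD1 (Ordinal kn))//= indicE mem_set//= mulr1 big1 ?addr0// => i ik.
rewrite indicE memNset ?mulr0// => si; case/eqP: ik; apply/val_inj => /=.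
exact: grid_cell_uniq si sk.
Qed.

Lemma eta_cell s k : (k < n)%N -> s \in `[t k, t k.+1[ -> eta T n t s = t k.
Proof.
move=> kn sk; rewrite /eta (sum_cell t kn sk) indicE memNset ?mulr0 ?addr0//= => sT.
move: sk; rewrite sT in_itv/= => /andP[_].
have [_ tT _] := t_grid.
by rewrite -tT ltNge grid_le// kn leqnn.
Qed.

Lemma eta_end : eta T n t T = T.
Proof.
have [_ tT _] := t_grid.
rewrite /eta indicE mem_set//= mulr1 big1 ?add0r// => i _.
rewrite indicE memNset ?mulr0//= in_itv/= => /andP[_].
by rewrite -[X in X < _]tT ltNge grid_le// leqnn ltn_ord.
Qed.

Lemma comp_etaE (f : R -> R) (s : R) : 0 <= s <= T ->
  f (eta T n t s) = \sum_(k < n) f (t k) * \1_`[t k, t k.+1[ s + f T * \1_[set T] s.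
Proof.
move=> /andP[s0]; rewrite le_eqVlt => /predU1P[->|sT].
  rewrite eta_end indicE mem_set//= mulr1 big1 ?add0r// => i _.
  have [_ tT _] := t_grid.
  rewrite indicE memNset ?mulr0//= in_itv/= => /andP[_].
  by rewrite -[X in X < _]tT ltNge grid_le// leqnn ltn_ord.
have [k kn sk] : exists2 k, (k < n)%N & s \in `[t k, t k.+1[ by apply: grid_cell; rewrite s0.
rewrite (eta_cell kn sk) (sum_cell (f \o t) kn sk)/=.
by rewrite indicE memNset ?mulr0 ?addr0//= => sTE; move: sT; rewrite sTE ltxx.
Qed.

Lemma eta_le (s : R) : 0 <= s <= T -> 0 <= eta T n t s <= s.
Proof.
move=> /andP[s0]; rewrite le_eqVlt => /predU1P[sE|sT].
  by rewrite sE eta_end lexx -sE s0.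
have [k kn sk] : exists2 k, (k < n)%N & s \in `[t k, t k.+1[ by apply: grid_cell; rewrite s0.
rewrite (eta_cell kn sk); move: sk; rewrite in_itv/= => /andP[-> _].
by have := grid_itv (ltnW kn); rewrite in_itv/= => /andP[->].
Qed.

Lemma mesh_ge k : (k < n)%N -> t k.+1 - t k <= mesh n t.
Proof.
by move=> kn; rewrite /mesh (le_bigmax _ (fun k : 'I_n => t k.+1 - t k) (Ordinal kn)).
Qed.

Lemma eta_mesh (s : R) : 0 <= s <= T -> s - eta T n t s <= mesh n t.
Proof.
move=> /andP[s0]; rewrite le_eqVlt => /predU1P[sE|sT].
  rewrite sE eta_end subrr /mesh.
  by elim/big_rec : _ => // i x _ x0; rewrite le_max x0 orbT.
have [k kn sk] : exists2 k, (k < n)%N & s \in `[t k, t k.+1[ by apply: grid_cell; rewrite s0.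
rewrite (eta_cell kn sk); apply: le_trans (mesh_ge kn).
by move: sk; rewrite in_itv/= => /andP[_ /ltW]; rewrite lerD2r.
Qed.

(** Length of the part of the cell [k] lying in [[a, b]]. The truncation at 0 covers the disjoint
    case, so integrals of step functions become finite sums over all cells. *)
Definition overlap (a b : R) (k : nat) : R :=
  Num.max 0 (Num.min b (t k.+1) - Num.max a (t k)).

Lemma overlap_ge0 a b k : 0 <= overlap a b k.
Proof. by rewrite /overlap le_max lexx. Qed.

Lemma cell_measure a b k :
  (mu (`[t k, t k.+1[ `&` `[a, b]) = (overlap a b k)%:E)%E.
Proof.
have -> : `[t k, t k.+1[ `&` `[a, b] = (if b < t k.+1 then `[Num.max a (t k), b]%classic
    else `[Num.max a (t k), t k.+1[%classic).
  case: ltP => bt; apply/seteqP; split => s; rewrite /= !in_itv/= ge_max.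
  - by move=> [/andP[-> _] /andP[-> ->]].
  - by move=> /andP[/andP[-> ->] sb]; rewrite sb (le_lt_trans sb).
  - by move=> [/andP[-> ->] /andP[-> _]].
  - by move=> /andP[/andP[-> ->] sb]; rewrite sb (le_trans (ltW sb)).
rewrite /overlap; case: ltP => bt; rewrite lebesgue_measure_itv/= lte_fin -EFinB;
  case: ltP => h; congr EFin; apply/esym.
- by rewrite (@max_r _ _ 0)// subr_ge0 ltW.
- by rewrite (@max_l _ _ 0)// subr_le0.
- by rewrite (@max_r _ _ 0)// subr_ge0 ltW.
- by rewrite (@max_l _ _ 0)// subr_le0.
Qed.

Lemma overlapD a b c k : a <= b -> b <= c ->
  overlap a c k = overlap a b k + overlap b c k.
Proof.
rewrite /overlap => ab bc.
by case: (ltP c (t k.+1)); case: (ltP b (t k.+1)); case: (ltP a (t k)); case: (ltP b (t k));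
  rewrite /Num.max /Num.min; do ?case: ifP; lra.
Qed.

Lemma overlap_full k : (k < n)%N -> overlap 0 T k = t k.+1 - t k.
Proof.
move=> kn; rewrite /overlap.
have := grid_itv kn; rewrite in_itv/= => /andP[_ kT].
have := grid_itv (ltnW kn); rewrite in_itv/= => /andP[k0 _].
rewrite min_r// (max_r k0) (@max_r _ _ 0)// subr_ge0.
by case: t_grid => _ _ /(_ _ kn) /ltW.
Qed.

Lemma overlap_le a b k : (k < n)%N -> 0 <= a -> a <= b -> b <= T ->
  overlap a b k <= t k.+1 - t k.
Proof.
move=> kn a0 ab bT; rewrite -overlap_full//.
rewrite (overlapD _ a0 (le_trans ab bT)) (overlapD _ ab bT).
by have := overlap_ge0 0 a k; have := overlap_ge0 b T k; lra.
Qed.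

Lemma overlap_past a b k : b <= t k -> overlap a b k = 0.
Proof.
move=> bt; rewrite /overlap (@max_l _ _ 0)// subr_le0.
by rewrite ge_min; apply/orP; left; rewrite le_max bt orbT.
Qed.

Let measurable_cell k : measurable_fun setT (\1_`[t k, t k.+1[ : R -> R).
Proof. exact: measurable_indic. Qed.

Let integrable_cell (a b : R) (D : set R) : measurable D ->
  mu.-integrable `[a, b] (fun s : R => (\1_D s)%:E).
Proof.
move=> mD; apply: (@le_integrable _ _ _ _ _ _ _ (cst 1%E)) => //.
- by apply/measurable_EFinP; apply: measurable_funTS; exact: measurable_indic.
- by move=> s _; rewrite /= indicE normr1 lee_fin; case: (_ \in _); rewrite ?normr1 ?normr0.
- apply/integrableP; split; first exact: measurable_cst.
  rewrite (eq_integral (cst 1%E)); last by move=> x _; rewrite /= normr1.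
  rewrite integral_cst//= mul1e lebesgue_measure_itv/=.
  by case: ifP => _; rewrite ?ltry// -EFinB ltry.
Qed.

Let stepE (f : R -> R) (s : R) : 0 <= s <= T -> (f (eta T n t s))%:E =
  (\sum_(k < n) (f (t k))%:E * (\1_`[t k, t k.+1[ s)%:E + (f T)%:E * (\1_[set T] s)%:E)%E.
Proof.
by move=> s0T; rewrite (comp_etaE f s0T) EFinD -sumEFin EFinM; under eq_bigr do rewrite EFinM.
Qed.

Lemma step_integrable (f : R -> R) (a b : R) : 0 <= a -> b <= T ->
  mu.-integrable `[a, b] (EFin \o (fun s => f (eta T n t s))).
Proof.
move=> a0 bT.
apply: (@eq_integrable _ _ _ mu `[a, b] _ (fun s : R => \sum_(k < n) (f (t k))%:E * (\1_`[t k, t k.+1[ s)%:E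
   + (f T)%:E * (\1_[set T] s)%:E)%E) => //.
  move=> s; rewrite inE/= in_itv/= => /andP[sa sb]; rewrite stepE//.
  by rewrite (le_trans a0 sa) (le_trans sb bT).
apply: integrableD => //.
  by apply: integrable_sum => // k _; apply: integrableZl => //; exact: integrable_cell.
by apply: integrableZl => //; exact: integrable_cell.
Qed.

Lemma step_integral (f : R -> R) (a b : R) : 0 <= a -> b <= T ->
  (\int[mu]_(s in `[a, b]) (f (eta T n t s))%:E =
   (\sum_(k < n) f (t k) * overlap a b k)%:E)%E.
Proof.
move=> a0 bT.
transitivity (\int[mu]_(s in `[a, b]) (\sum_(k < n) (f (t k))%:E * (\1_`[t k, t k.+1[ s)%:E
   + (f T)%:E * (\1_[set T] s)%:E))%E.
  apply: eq_integral => s; rewrite inE/= in_itv/= => /andP[sa sb]; rewrite stepE//.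
  by rewrite (le_trans a0 sa) (le_trans sb bT).
have i1 : mu.-integrable `[a, b] (fun s : R => (f T)%:E * (\1_[set T] s)%:E)%E.
  by apply: integrableZl => //; exact: integrable_cell.
have i2 k : mu.-integrable `[a, b] (fun s : R => (f (t k))%:E * (\1_`[t k, t k.+1[ s)%:E)%E.
  by apply: integrableZl => //; exact: integrable_cell.
rewrite integralD//; last by apply: integrable_sum.
rewrite integral_sum// integralZl//; last exact: integrable_cell.
(* The step function has its own value at the end point [T], but a single point has measure zero. *)
rewrite integral_indic// [X in (_ * X)%E](_ : _ = 0)%E ?mule0 ?adde0; last first.
  apply/eqP; rewrite -measure_le0 -(lebesgue_measure_set1 T).
  by apply: le_measure; rewrite ?inE//; exact: measurableI.
rewrite -sumEFin; apply: eq_bigr => k _.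
rewrite integralZl//; last exact: integrable_cell.
by rewrite integral_indic// EFinM; congr (_ * _)%E; exact: cell_measure.
Qed.

Lemma step_Rintegral (f : R -> R) (a b : R) : 0 <= a -> b <= T ->
  \int[mu]_(s in `[a, b]) f (eta T n t s) = \sum_(k < n) f (t k) * overlap a b k.
Proof. by move=> a0 bT; rewrite /Rintegral step_integral. Qed.



(** The integral over [[0, T]] of the square of [g] frozen on the grid. Applied to random paths, it
    is the random factor in all moduli of continuity below. *)
Definition weighted_sq (g : R -> R) : R :=
  \sum_(k < n) g (t k) ^+ 2 * (t k.+1 - t k).

Variable K : R -> R.

(* Integrals over a cell are taken in closed form, which makes measurability
   and adaptedness of the scheme immediate. *)
Definition kernel_weight (u : R) (k : nat) : R := K (u - t k) * overlap 0 u k.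

Definition kernel_sum (u : R) (g : R -> R) : R :=
  \sum_(k < n) kernel_weight u k * g (t k).

Lemma kernel_sumE u g : 0 <= u <= T ->
  \int[mu]_(s in `[0, u]) (K (u - eta T n t s) * g (eta T n t s)) = kernel_sum u g.
Proof.
move=> /andP[u0 uT].
rewrite (step_Rintegral (fun v => K (u - v) * g v) (lexx 0) uT).
by apply: eq_bigr => k _; rewrite /kernel_weight mulrAC.
Qed.

(** Cells that start after [u] have empty overlap with [[0, u]]. This makes the scheme explicit, and
    it silences [K] at arguments that are zero or negative. *)
Lemma kernel_weight_past u k : u <= t k -> kernel_weight u k = 0.
Proof. by move=> ut; rewrite /kernel_weight overlap_past// mulr0. Qed.

Lemma kernel_weight_ge0 u k : (forall s, s \in `]0, T] -> 0 <= K s) ->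
  (k < n)%N -> u <= T -> 0 <= kernel_weight u k.
Proof.
move=> K0 kn uT; have [ut|tu] := leP u (t k); first by rewrite kernel_weight_past.
rewrite mulr_ge0 ?overlap_ge0// K0// in_itv/= subr_gt0 tu/=.
have := grid_itv (ltnW kn); rewrite in_itv/= => /andP[t0 _].
by lra.
Qed.

Section holder.
Variables (C H : R).
Hypotheses (C0 : 0 < C) (H0 : 0 < H).
Hypothesis moduli : forall (u : R) (delta : R), u \in `[0, T] -> delta \in `]0, T - u] ->
  let e := eta T n t in
  (\int[mu]_(s in `[u, (u + delta)%R])
      (`|K (u + delta - e s)| ^+ 2)%:E <= (C * delta `^ (2 * H))%:E)%E /\
  (\int[mu]_(s in `[0%R, u])
      (`|K (u + delta - e s) - K (u - e s)| ^+ 2)%:E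
    <= (C * delta `^ (2 * H))%:E)%E.

(** The increment splits into the new piece over [[u, v]] and the change of the kernel over
    [[0, u]]. The bound is affine in [weighted_sq g] rather than its square root, which is
    convenient because only the mean of [weighted_sq] is controlled later. *)
Lemma kernel_sum_holder (u v : R) g : 0 <= u -> u <= v -> v <= T ->
  `|kernel_sum v g - kernel_sum u g| <= (v - u) `^ H * (C + weighted_sq g).
Proof.
move=> u0; rewrite le_eqVlt => /predU1P[<- _|uv vT].
  rewrite !subrr normr0 mulr_ge0 ?powR_ge0// addr_ge0 ?(ltW C0)//.
  apply: sumr_ge0 => k _; rewrite mulr_ge0 ?sqr_ge0// subr_ge0.
  by case: t_grid => _ _ /(_ _ (ltn_ord k)) /ltW.
set delta := v - u.
have d0 : 0 < delta by rewrite subr_gt0.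
have vE : u + delta = v by rewrite /delta addrC subrK.
have uT : u <= T by lra.
have uI : u \in `[0, T] by rewrite in_itv/= u0 uT.
have dI : delta \in `]0, T - u] by rewrite in_itv/= d0 lerD2r vT.
have [] := moduli uI dI; rewrite /= vE.
rewrite (step_integral (fun x => `|K (v - x)| ^+ 2) u0 vT) lee_fin => m1.
rewrite (step_integral (fun x => `|K (v - x) - K (u - x)| ^+ 2) (lexx 0) uT) lee_fin => m2.
(* The weight for [weighted_amgm]: both kernel integrals are at most [C] e^2, so after division by 2
   e they add up to [C] e, the same order as the terms in [g]. *)
set e := delta `^ H.
have e0 : 0 < e by rewrite powR_gt0.
have e2 : delta `^ (2 * H) = e ^+ 2 by rewrite mulrC powRrM -powR_mulrn// powR_ge0.
have -> : kernel_sum v g - kernel_sum u g = \sum_(k < n)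
    (K (v - t k) * g (t k) * overlap u v k
     + (K (v - t k) - K (u - t k)) * g (t k) * overlap 0 u k).
  rewrite /kernel_sum -sumrB; apply: eq_bigr => k _.
  rewrite /kernel_weight (overlapD _ u0 (ltW uv)); ring.
apply: (le_trans (ler_norm_sum _ _ _)).
apply: (@le_trans _ _ (\sum_(k < n)
  (((2 * e)^-1 * (`|K (v - t k)| ^+ 2 * overlap u v k)
  + (2 * e)^-1 * (`|K (v - t k) - K (u - t k)| ^+ 2 * overlap 0 u k))
  + e * (g (t k) ^+ 2 * (t k.+1 - t k))))).
  apply: ler_sum => k _; apply: (le_trans (ler_normD _ _)).
  rewrite 2![`|_ * overlap _ _ _|]normrM !(ger0_norm (overlap_ge0 _ _ _)).
  have kn := ltn_ord k.
  have h1 := weighted_amgm (K (v - t k)) (g (t k)) e0.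
  have h2 := weighted_amgm (K (v - t k) - K (u - t k)) (g (t k)) e0.
  have o1 := overlap_ge0 u v k.
  have o2 := overlap_ge0 0 u k.
  have o3 := overlap_le kn u0 (ltW uv) vT.
  have o4 := overlap_le kn (lexx 0) u0 uT.
  have g2 : 0 <= e * g (t k) ^+ 2 by rewrite mulr_ge0 ?sqr_ge0 ?ltW.
  have a1 := ler_wpM2r o1 h1; have a2 := ler_wpM2r o2 h2.
  have b1 := ler_wpM2l g2 o3; have b2 := ler_wpM2l g2 o4.
  have n1 (x : R) : `|x| ^+ 2 = x ^+ 2 by rewrite -normrX ger0_norm ?sqr_ge0.
  rewrite !n1.
  have -> : (2 * e)^-1 = e^-1 / 2 by rewrite invfM mulrC.
  lra.
rewrite !big_split/= -!mulr_sumr -/(weighted_sq g).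
have i0 : 0 <= (2 * e)^-1 by rewrite invr_ge0 mulr_ge0 ?ltW.
have a1 := ler_wpM2l i0 m1; have a2 := ler_wpM2l i0 m2.
have -> : e * (C + weighted_sq g) =
    (2 * e)^-1 * (C * e ^+ 2) + (2 * e)^-1 * (C * e ^+ 2) + e * weighted_sq g.
  by field; rewrite gt_eqF.
by rewrite -!e2; lra.
Qed.

(** Homogeneity improves the affine bound: dividing [g] by the square root [r] makes its
    [weighted_sq] at most one. Square-root growth is what later makes the square of Xbar affine, not
    quadratic, in the time integral of M^2. *)
Lemma kernel_sum_le_sqrt (u : R) g : 0 <= u <= T ->
  `|kernel_sum u g| <= T `^ H * (C + 1) * Num.sqrt (1 + weighted_sq g).
Proof.
move=> /andP[u0 uT].
have Q0 : 0 <= weighted_sq g.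
  apply: sumr_ge0 => k _; rewrite mulr_ge0 ?sqr_ge0// subr_ge0.
  by case: t_grid => _ _ /(_ _ (ltn_ord k)) /ltW.
set r := Num.sqrt (1 + weighted_sq g).
have r0 : 0 < r by rewrite sqrtr_gt0 ltr_pwDl.
have r2 : r ^+ 2 = 1 + weighted_sq g by rewrite sqr_sqrtr// addr_ge0.
pose h x := r^-1 * g x.
have hE : kernel_sum u g = r * kernel_sum u h.
  rewrite /kernel_sum mulr_sumr; apply: eq_bigr => k _; rewrite /h.
  by field; rewrite gt_eqF.
have qE : weighted_sq h = r ^- 2 * weighted_sq g.
  rewrite /weighted_sq mulr_sumr; apply: eq_bigr => k _; rewrite /h exprMn exprVn; ring.
have z : kernel_sum 0 h = 0.
  rewrite /kernel_sum big1// => k _; rewrite kernel_weight_past ?mul0r//.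
  by have := grid_itv (ltnW (ltn_ord k)); rewrite in_itv/= => /andP[].
have := kernel_sum_holder h (lexx 0) u0 uT; rewrite z !subr0 => b.
rewrite hE normrM (gtr0_norm r0) mulrC ler_pM2r//.
apply: (le_trans b); apply: ler_pM; rewrite ?powR_ge0//.
- by rewrite addr_ge0 ?(ltW C0)// qE mulr_ge0// invr_ge0 exprn_ge0// ltW.
- by rewrite ge0_ler_powR// ?nnegrE ?(ltW H0)// (le_trans u0).
- rewrite lerD2l qE mulrC ler_pdivrMr ?exprn_gt0// mul1r r2; lra.
Qed.

End holder.

End grid.

(** * Convergence of the kernel sums *)

Lemma within_cvg_seq (R : realType) (A : set R) (f : R -> R) (x : R) (y : nat -> R) :
  {within A, continuous f} -> A x -> (forall n, A (y n)) ->
  y n @[n --> \oo] --> x -> f (y n) @[n --> \oo] --> f x.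
Proof.
move=> /subspace_continuousP cf Ax Ay yx.
apply: (@cvg_comp _ _ _ y f _ (within A (nbhs x))); last exact: cf.
move=> U hU; have h : \forall n \near \oo, A (y n) -> U (y n) by exact: (yx _ hU).
by apply: filterS h => n; apply; exact: Ay.
Qed.

Lemma limn_einf_le (R : realType) (u : (\bar R)^nat) (c : \bar R) :
  (forall n, (u n <= c)%E) -> (limn_einf u <= c)%E.
Proof.
move=> uc; rewrite limn_einf_lim; apply: lime_le; first exact: is_cvg_einfs.
near=> n; apply: le_trans (uc n); apply: ereal_inf_lbound.
by exists n => /=.
Unshelve. all: by end_near. Qed.

Section kernel_limit.
Context {R : realType}.
Local Notation mu := (@lebesgue_measure R).
Variables (T : R) (t_ : nat -> nat -> R) (K : R -> R).
Hypothesis T_gt0 : 0 < T.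
Hypothesis t_grid : forall n, (0 < n)%N -> is_grid T n (t_ n).
Hypothesis t_mesh : mesh n (t_ n) @[n --> \oo] --> (0 : R).
Hypothesis K_ok : kernel_assumption T t_ K.

(** The index is shifted by one because grids are given for positive [n] only. *)
Let e n := eta T n.+1 (t_ n.+1).
Let gr n : is_grid T n.+1 (t_ n.+1). Proof. exact: t_grid. Qed.

Let e_cvg (s : R) : 0 <= s <= T -> e n s @[n --> \oo] --> s.
Proof.
move=> sT.
have m0 : mesh n.+1 (t_ n.+1) @[n --> \oo] --> (0 : R).
  by have := t_mesh; rewrite -(cvg_shiftS (fun n => mesh n (t_ n))).
apply: (@squeeze_cvgr _ _ _ _ (fun n => s - mesh n.+1 (t_ n.+1)) (fun=> s)).
- near=> n; have := eta_mesh (gr n) sT; have /andP[_ h] := eta_le (gr n) sT.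
  by rewrite h andbT /e; lra.
- rewrite -[X in _ --> X]subr0; apply: cvgB => //; exact: cvg_cst.
- exact: cvg_cst.
Unshelve. all: by end_near. Qed.

Let shift_in (u s : R) : u <= T -> s \in `[0, u[ -> u - s \in `]0, T].
Proof. by move=> uT; rewrite !in_itv/= => /andP[s0 su]; apply/andP; split; lra. Qed.

Let e_shift_in (u s : R) n : u <= T -> s \in `[0, u[ -> u - e n s \in `]0, T].
Proof.
move=> uT; rewrite !in_itv/= => /andP[s0 su].
have sT : 0 <= s <= T by apply/andP; split; lra.
have /andP[e0 es] := eta_le (gr n) sT.
by rewrite /e; apply/andP; split; lra.
Qed.

Let K_cvg (u s : R) : u <= T -> s \in `[0, u[ ->
  K (u - e n s) @[n --> \oo] --> K (u - s).
Proof.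
move=> uT su.
apply: (within_cvg_seq (kernel_continuous K_ok)).
- exact: shift_in.
- by move=> n; exact: e_shift_in.
- apply: cvgB; first exact: cvg_cst.
  by apply: e_cvg; move: su; rewrite in_itv/= => /andP[s0 su]; apply/andP; split; lra.
Qed.

(* Since eta s <= s and K is non-increasing, K (u - s) is the dominating function. *)
Let K_dom (u s : R) n : u <= T -> s \in `[0, u[ -> 0 <= K (u - e n s) <= K (u - s).
Proof.
move=> uT su; rewrite (kernel_ge0 K_ok) ?e_shift_in//=.
apply: (kernel_nonincreasing K_ok); [exact: e_shift_in|exact: shift_in|].
move: su; rewrite in_itv/= => /andP[s0 su].
have sT : 0 <= s <= T by apply/andP; split; lra.
by have /andP[_ h] := eta_le (gr n) sT; rewrite lerD2l lerN2.
Qed.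

Let mKu (u : R) : u <= T -> measurable_fun `[0, u[ (fun s => K (u - s)).
Proof.
move=> uT.
apply: (measurable_comp (F := `[0, T]%classic)  (f := K)  (g := fun s : R => u - s)) => //.
- move=> _ [s /= su <-].
  by have := shift_in uT su; rewrite !in_itv/= => /andP[/ltW -> ->].
- exact: (kernel_measurable K_ok).
- by apply: measurable_funB.
Qed.

Let mstep (f : R -> R) (u : R) n : u <= T ->
  measurable_fun `[0, u[ (fun s => f (e n s)).
Proof.
move=> uT; have /integrableP[/measurable_EFinP mf _] := step_integrable (gr n) f (lexx 0) uT.
by apply: measurable_funS mf => //; move=> s /=; rewrite !in_itv/= => /andP[-> /ltW ->].
Qed.

(** Fatou's lemma applied to the first modulus bound, at time 0 with increment [u], controls the
    square of the kernel; then |x| <= 1 + x^2. The interval is open at [u], where K (u - s) would be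
    the arbitrary value [K 0]. *)
Lemma kernel_integrable (u : R) : 0 <= u <= T ->
  mu.-integrable `[0, u[ (EFin \o (fun s => K (u - s))).
Proof.
move=> /andP[]; rewrite le_eqVlt => /predU1P[<- _|u0 uT].
  by rewrite set_itv_ge ?bnd_simp//; exact: integrable_set0.
have [C [H [C0 H0 mod]]] := kernel_moduli K_ok.
have mK2 : measurable_fun `[0, u[ (fun s => K (u - s) ^+ 2).
  by apply: measurable_funX; exact: mKu.
have bnd : (\int[mu]_(s in `[0%R, u[) (K (u - s) ^+ 2)%:E <= (C * u `^ (2 * H))%:E)%E.
  have mf n : measurable_fun `[0%R, u[ (fun s => (K (u - e n s) ^+ 2)%:E).
    by apply/measurable_EFinP; exact: (mstep (fun x => K (u - x) ^+ 2)).
  have f0 : forall n (x : R), `[0, u[%classic x -> (0 <= (K (u - e n x) ^+ 2)%:E)%E.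
    by move=> n x _; rewrite lee_fin sqr_ge0.
  apply: le_trans (limn_einf_le (u := fun n => (\int[mu]_(s in `[0%R, u[) (K (u - e n s) ^+ 2)%:E)%E) _).
    apply: le_trans (fatou mu (measurable_itv _) mf f0).
    rewrite le_eqVlt; apply/orP; left; apply/eqP; apply: eq_integral => s; rewrite inE => su.
    apply/esym; apply: (cvg_limn_einf_sup _).1.
    apply: cvg_EFin; first by near=> n.
    by apply: (@cvg_comp _ _ _ _ (fun x : R => x ^+ 2) _ (nbhs (K (u - s)))); [exact: K_cvg|exact: exprn_continuous].
  move=> n.
  have u1 : (0 : R) \in `[0, T] by rewrite in_itv/= lexx ltW.
  have u2 : u \in `]0, T - 0] by rewrite in_itv/= u0 subr0.
  have [] := mod 0 n.+1 u u1 isT u2; rewrite /= add0r => h _.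
  apply: le_trans h.
  have -> : (\int[mu]_(s in `[0%R, u]) (`|K (u - eta T n.+1 (t_ n.+1) s)| ^+ 2)%:E =
      \int[mu]_(s in `[0%R, u]) (K (u - e n s) ^+ 2)%:E)%E.
    by apply: eq_integral => s _; rewrite -normrX ger0_norm ?sqr_ge0.
  apply: ge0_subset_integral => //.
  - have /integrableP[mf' _] := step_integrable (gr n) (fun x => K (u - x) ^+ 2) (lexx 0) uT.
    exact: mf'.
  - by move=> s _; rewrite lee_fin sqr_ge0.
  - by move=> s /=; rewrite !in_itv/= => /andP[-> /ltW ->].
apply: (@le_integrable _ _ _ mu `[0, u[%classic _ (EFin \o (fun s : R => K (u - s)))
  (fun s : R => (1 + K (u - s) ^+ 2)%:E)) => //.
- by apply/measurable_EFinP; exact: mKu.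
- move=> s _; rewrite /= lee_fin [leRHS]ger0_norm ?addr_ge0 ?sqr_ge0//.
  have := weighted_amgm 1 (K (u - s)) ltr01; rewrite mul1r expr1n divr1 mul1r => h.
  by have := sqr_ge0 (K (u - s)); lra.
apply/integrableP; split.
  by apply/measurable_EFinP; apply: measurable_funD.
under eq_integral => s _.
  rewrite /= ger0_norm ?addr_ge0 ?sqr_ge0// EFinD; over.
rewrite ge0_integralD//.
- rewrite integral_cst//= mul1e lebesgue_measure_itv/= lte_fin u0 -EFinB.
  by rewrite lte_add_pinfty// ?ltry// (le_lt_trans bnd)// ltry.
- by move=> x _; rewrite lee_fin sqr_ge0.
- exact/measurable_EFinP.
Unshelve. all: by end_near. Qed.

Lemma kernel_step_cvg (u : R) : 0 <= u <= T ->
  \int[mu]_(s in `[0, u[) `|K (u - e n s) - K (u - s)| @[n --> \oo] --> (0 : R).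
Proof.
move=> /[dup] uI /andP[u0 uT].
have mf n : measurable_fun `[0%R, u[ (fun s => (K (u - e n s))%:E).
  by apply/measurable_EFinP; exact: (mstep (fun x => K (u - x))).
have [] := @dominated_convergence _ _ _ mu `[0%R, u[%classic (measurable_itv _)
    (fun n s => (K (u - e n s))%:E) (fun s => (K (u - s))%:E) (fun s => (K (u - s))%:E) mf.
- by apply/measurable_EFinP; exact: mKu.
- apply: aeW => s su; apply: cvg_EFin; first by near=> n.
  exact: (K_cvg uT su).
- exact: kernel_integrable.
- apply: aeW => s n su; have /andP[k0 k1] := K_dom n uT su.
  by rewrite gee0_abs ?lee_fin.
by move=> _ h _; exact: (fine_cvg h).
Unshelve. all: by end_near. Qed.

Lemma weighted_sq_le n (g : R -> R) (G : R) : (forall s : R, s \in `[0, T] -> `|g s| <= G) ->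
  weighted_sq n.+1 (t_ n.+1) g <= G ^+ 2 * T.
Proof.
move=> gG.
have [t0 tT ts] := gr n.
have -> : G ^+ 2 * T = \sum_(k < n.+1) G ^+ 2 * (t_ n.+1 k.+1 - t_ n.+1 k).
  rewrite -mulr_sumr -(big_mkord xpredT (fun k => t_ n.+1 k.+1 - t_ n.+1 k)).
  by rewrite telescope_sumr// tT t0 subr0.
apply: ler_sum => k _; apply: ler_wpM2r; first by rewrite subr_ge0 ltW ?ts.
have := gG _ (grid_itv (gr n) (ltnW (ltn_ord k))) => h.
by rewrite -[leLHS]ger0_norm ?sqr_ge0// normrX lerXn2r ?nnegrE ?(le_trans _ h).
Qed.

Definition kernel_conv (u : R) (g : R -> R) : R := \int[mu]_(s in `[0, u]) (K (u - s) * g s).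

Section bounded_path.
Variables (g : R -> R) (G : R).
Hypothesis cg : {within `[0, T], continuous g}.
Hypothesis gG : forall s, s \in `[0, T] -> `|g s| <= G.

Let mg u : u <= T -> measurable_fun `[0, u[ g.
Proof.
move=> uT; apply: measurable_funS (subspace_continuous_measurable_fun _ cg) => //.
by move=> s /=; rewrite !in_itv/= => /andP[-> /ltW /le_trans ->].
Qed.

Lemma kernel_sum_cvg (u : R) : 0 <= u <= T ->
  kernel_sum n.+1 (t_ n.+1) K u g @[n --> \oo] --> kernel_conv u g.
Proof.
move=> /[dup] uI /andP[u0 uT].
have hE n : kernel_sum n.+1 (t_ n.+1) K u g =
    fine (\int[mu]_(s in `[0%R, u[) (K (u - e n s) * g (e n s))%:E)%E.
  rewrite -(kernel_sumE (gr n))// /Rintegral integral_itv_bndo_bndc//.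
  apply/measurable_EFinP.
  exact: (mstep (fun x => K (u - x) * g x)).
under eq_cvg do rewrite hE.
have mf n : measurable_fun `[0%R, u[ (fun s => (K (u - e n s) * g (e n s))%:E).
  by apply/measurable_EFinP; exact: (mstep (fun x => K (u - x) * g x)).
have mKg : measurable_fun `[0%R, u[ (fun s => (K (u - s) * g s)%:E).
  by apply/measurable_EFinP; apply: measurable_funM; [exact: mKu|exact: mg].
have -> : kernel_conv u g = fine (\int[mu]_(s in `[0%R, u[) (K (u - s) * g s)%:E)%E.
  by rewrite /kernel_conv /Rintegral integral_itv_bndo_bndc.
have sI s : `[0, u[%classic s -> 0 <= s <= T.
  by rewrite /= in_itv/= => /andP[-> /ltW /le_trans ->].
have iG : mu.-integrable `[0, u[ (fun s => (G * K (u - s))%:E).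
  have m0u : measurable (`[0, u[%classic : set (measurableTypeR R)) by [].
  by have := integrableZl m0u G (kernel_integrable uI).
have [] := @dominated_convergence _ _ _ mu `[0%R, u[%classic (measurable_itv _)
    (fun n s => (K (u - e n s) * g (e n s))%:E) (fun s => (K (u - s) * g s)%:E)
    (fun s => (G * K (u - s))%:E) mf mKg _ iG.
- apply: aeW => s su; apply: cvg_EFin; first by near=> n.
  apply: cvgM; first exact: (K_cvg uT su).
  have := e_cvg (sI _ su); apply: within_cvg_seq cg _ _.
    by rewrite /= in_itv/= sI.
  move=> n; rewrite /= in_itv/=.
  have /andP[-> h] := eta_le (gr n) (sI _ su).
  by have /andP[_ h'] := sI _ su; rewrite (le_trans h h').
- apply: aeW => s n su; have /andP[k0 k1] := K_dom n uT su.
  rewrite lee_fin normrM (ger0_norm k0) mulrC ler_pM//; apply: gG; rewrite in_itv/=.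
  have /andP[-> h] := eta_le (gr n) (sI _ su).
  by have /andP[_ h'] := sI _ su; rewrite (le_trans h h').
move=> i _ h; apply: fine_cvg; rewrite fineK//.
exact: integrable_fin_num.
Unshelve. all: by end_near. Qed.

(** [kernel_sum_holder] is uniform in the grid once [g] is bounded, so it passes to the limit. It
    makes the convolution continuous in time, which carries the Volterra equation from countably
    many times to all. *)
Lemma kernel_conv_holder : exists C H : R, [/\ 0 < C, 0 < H & forall u v : R,
  0 <= u -> u <= v -> v <= T ->
  `|kernel_conv v g - kernel_conv u g| <= (v - u) `^ H * C].
Proof.
have [C [H [C0 H0 mod]]] := kernel_moduli K_ok.
exists (C + G ^+ 2 * T), H; split=> //.
  by rewrite ltr_pwDl// mulr_ge0 ?sqr_ge0 ?ltW.
move=> u v u0 uv vT.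
have cu : kernel_sum n.+1 (t_ n.+1) K u g @[n --> \oo] --> kernel_conv u g.
  by apply: kernel_sum_cvg; rewrite u0 (le_trans uv).
have cv : kernel_sum n.+1 (t_ n.+1) K v g @[n --> \oo] --> kernel_conv v g.
  by apply: kernel_sum_cvg; rewrite vT (le_trans u0).
have c : `|kernel_sum n.+1 (t_ n.+1) K v g - kernel_sum n.+1 (t_ n.+1) K u g| @[n --> \oo]
    --> `|kernel_conv v g - kernel_conv u g|.
  by apply: cvg_norm; exact: cvgB.
rewrite -(cvg_lim _ c)//; apply: limr_le; first by apply/cvg_ex; eexists; exact: c.
near=> n.
apply: le_trans (kernel_sum_holder (gr n) C0 _ g u0 uv vT) _.
  by move=> x delta xI dI; exact: mod.
by rewrite ler_wpM2l ?powR_ge0// lerD2l weighted_sq_le.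
Unshelve. all: by end_near. Qed.

End bounded_path.
End kernel_limit.

(** * One cell of the scheme *)

Section fourth_moments.
Context {d} {Omega : measurableType d} {R : realType} (P : probability Omega R).
Implicit Types f g : Omega -> R.

(** The working class for the scheme. It is stable under sums, maxima and square roots, the
    operations that build the scheme, and four factors in it have an integrable product, enough for
    polynomials of degree four. *)
Definition L4 (G : set (set Omega)) f :=
  measurable_wrt G f /\ integrable_rv P (fun w => f w ^+ 4).

Variable G : set (set Omega).
Hypothesis Gm : G `<=` measurable.

Let wm f : measurable_wrt G f -> measurable_fun setT f.
Proof. exact: measurable_wrt_measurable. Qed.

Let four (x : R) : 0 <= x ^+ 4. Proof. by rewrite exprn_even_ge0. Qed.

Let sq_le (x : R) : x ^+ 2 <= 1 + x ^+ 4.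
Proof. by have := sqr_ge0 (x ^+ 2 - 1); nra. Qed.

Lemma L4_dom f g : measurable_wrt G f -> integrable_rv P g ->
  (forall w, f w ^+ 4 <= g w) -> L4 G f.
Proof.
move=> mf gi fg; split => //; apply: (integrable_rv_dom _ gi).
  by apply: measurable_funX; exact: wm.
by move=> w; rewrite ger0_norm.
Qed.

Lemma L4_cst c : L4 G (fun=> c).
Proof. by split; [exact: measurable_cst|exact: integrable_rv_cst]. Qed.

Lemma L4D f g : L4 G f -> L4 G g -> L4 G (fun w => f w + g w).
Proof.
move=> [mf f4] [mg g4]; apply: (L4_dom _ (integrable_rvZ 8 (integrable_rvD f4 g4))).
  exact: measurable_funD.
move=> w.
set a := f w; set b := g w.
have h1 : (a + b) ^+ 2 <= 2 * (a ^+ 2 + b ^+ 2) by have := sqr_ge0 (a - b); nra.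
have h2 : (a ^+ 2 + b ^+ 2) ^+ 2 <= 2 * (a ^+ 4 + b ^+ 4).
  by have := sqr_ge0 (a ^+ 2 - b ^+ 2); nra.
have h3 : 0 <= (a + b) ^+ 2 by exact: sqr_ge0.
have -> : (a + b) ^+ 4 = ((a + b) ^+ 2) ^+ 2 by rewrite -exprM.
have h4 : ((a + b) ^+ 2) ^+ 2 <= (2 * (a ^+ 2 + b ^+ 2)) ^+ 2.
  by rewrite lerXn2r// nnegrE// (le_trans h3).
by move: h4; rewrite exprMn; nra.
Qed.

Lemma L4Z c f : L4 G f -> L4 G (fun w => c * f w).
Proof.
move=> [mf f4]; apply: (L4_dom _ (integrable_rvZ (c ^+ 4) f4)).
  by apply: measurable_funM => //; exact: measurable_cst.
by move=> w; rewrite exprMn.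
Qed.

Lemma L4B f g : L4 G f -> L4 G g -> L4 G (fun w => f w - g w).
Proof.
move=> f4 g4; have := L4D f4 (L4Z (-1) g4).
by under eq_fun do rewrite mulN1r.
Qed.

Lemma L4_sum (I : Type) (r : seq I) (F : I -> Omega -> R) :
  (forall i, L4 G (F i)) -> L4 G (fun w => \sum_(i <- r) F i w).
Proof.
move=> F4; elim: r => [|i r IH].
  by under eq_fun do rewrite big_nil; exact: L4_cst.
by under eq_fun do rewrite big_cons; exact: L4D.
Qed.

Lemma L4_max f g : L4 G f -> L4 G g -> L4 G (fun w => Num.max (f w) (g w)).
Proof.
move=> [mf f4] [mg g4]; apply: (L4_dom _ (integrable_rvD f4 g4)).
  exact: measurable_maxr.
by move=> w; have [] := leP (f w) (g w) => _; rewrite ?lerDl ?lerDr four.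
Qed.

Lemma L4_bigmax (f0 : Omega -> R) (k : nat) (F : nat -> Omega -> R) : L4 G f0 ->
  (forall i, (i < k)%N -> L4 G (F i)) -> L4 G (fun w => \big[Num.max/f0 w]_(i < k) F i w).
Proof.
move=> h0; elim: k F => [|k IH] F hF; first by under eq_fun do rewrite big_ord0.
under eq_fun do rewrite big_ord_recl/=.
apply: L4_max; first exact: hF.
by apply: (IH (fun i => F i.+1)) => i ik; exact: hF.
Qed.

Lemma L4_sqrt f : L4 G f -> L4 G (fun w => Num.sqrt (f w)).
Proof.
move=> [mf f4]; apply: (L4_dom _ (integrable_rvD (integrable_rv_cst P 1) f4)).
  have ms : measurable_fun setT (Num.sqrt : R -> R).
    by apply: continuous_measurable_fun; exact: sqrt_continuous.
  exact: (measurableT_comp ms mf).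
move=> w; have -> : Num.sqrt (f w) ^+ 4 = (Num.sqrt (f w) ^+ 2) ^+ 2 by rewrite -exprM.
have [f0|f0] := leP 0 (f w); first by rewrite sqr_sqrtr.
by rewrite ler0_sqrtr ?ltW// !expr0n/=; have := four (f w); lra.
Qed.

Lemma L4_integrable_mul f1 f2 f3 f4 : L4 G f1 -> L4 G f2 -> L4 G f3 -> L4 G f4 ->
  integrable_rv P (fun w => f1 w * f2 w * f3 w * f4 w).
Proof.
move=> [m1 i1] [m2 i2] [m3 i3] [m4 i4].
apply: (integrable_rv_dom _ (integrable_rvD (integrable_rvD i1 i2) (integrable_rvD i3 i4))).
  by apply: measurable_funM; [apply: measurable_funM; [apply: measurable_funM|]|]; exact: wm.
move=> w; set a := f1 w; set b := f2 w; set c := f3 w; set e := f4 w.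
have h (x y : R) : `|x * y| <= (x ^+ 2 + y ^+ 2) / 2.
  by have := weighted_amgm x y ltr01; rewrite divr1 mul1r.
rewrite -mulrA normrM.
have ab := h a b; have ce := h c e.
apply: (le_trans (ler_pM (normr_ge0 _) (normr_ge0 _) ab ce)).
have := sqr_ge0 (a ^+ 2 + b ^+ 2 - (c ^+ 2 + e ^+ 2)).
have := sqr_ge0 (a ^+ 2 - b ^+ 2); have := sqr_ge0 (c ^+ 2 - e ^+ 2).
nra.
Qed.

Lemma L4_sq f : L4 G f -> integrable_rv P (fun w => f w ^+ 2).
Proof.
move=> f4; have := L4_integrable_mul f4 f4 (L4_cst 1) (L4_cst 1).
by under eq_fun do rewrite !mulr1 -expr2.
Qed.

Lemma L4_integrable f : L4 G f -> integrable_rv P f.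
Proof.
move=> f4; have := L4_integrable_mul f4 (L4_cst 1) (L4_cst 1) (L4_cst 1).
by under eq_fun do rewrite !mulr1.
Qed.

End fourth_moments.

Section hermite_increment.
Context {d} {Omega : measurableType d} {R : realType} (P : probability Omega R).
Variables (T : R) (B B' : R -> Omega -> R).
Hypotheses (B_bm : brownian_motion P T B).
Hypothesis B'_measurable : forall t : R, t \in `[0, T] -> measurable_fun setT (B' t).
Hypothesis BB' : independent_systems P (sigma_generated `[0, T] B) (sigma_generated `[0, T] B').
Variables (s t : R).
Hypotheses (s_ge0 : 0 <= s) (st : s < t) (tT : t <= T).

Let xi w := B t w - B s w.
Let tau := t - s.
Variable Y : Omega -> R.
Hypotheses (mY : measurable_wrt (enlarged_past T B B' s) Y) (iY : integrable_rv P Y).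

Let mom k (k4 : (k <= 4)%N) : integrable_rv P (fun w => Y w * xi w ^+ k) /\
  mean P (fun w => Y w * xi w ^+ k) = mean P Y * mean P (fun w => xi w ^+ k).
Proof. exact: (increment_moment B_bm B'_measurable BB' s_ge0 st tT k4 mY iY). Qed.

(** [hermite1] to [hermite4] concern the Hermite polynomials of a centred Gaussian of variance
    [tau]. Each has mean zero, and keeps it when multiplied by an integrable factor measurable with
    respect to the enlarged past. *)
Lemma hermite1 : integrable_rv P (fun w => Y w * xi w) /\ mean P (fun w => Y w * xi w) = 0.
Proof.
have [i e] := mom (k := 1) isT; split => //.
rewrite [LHS]e; have := increment_mean_odd B_bm s_ge0 st tT (k := 1) isT isT.
by move=> ->; rewrite mulr0.
Qed.

Lemma hermite2 : integrable_rv P (fun w => Y w * (xi w ^+ 2 - tau)) /\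
  mean P (fun w => Y w * (xi w ^+ 2 - tau)) = 0.
Proof.
have [i e] := mom (k := 2) isT.
have i' := integrable_rvZ tau iY.
have E : (fun w => Y w * (xi w ^+ 2 - tau)) = fun w => Y w * xi w ^+ 2 - tau * Y w.
  by apply/funext => w; ring.
rewrite E; split; first exact: integrable_rvB.
by rewrite meanB// e (meanZ _ iY) (increment_mean2 B_bm s_ge0 st tT) mulrC subrr.
Qed.

Lemma hermite3 : integrable_rv P (fun w => Y w * (xi w ^+ 3 - 3 * tau * xi w)) /\
  mean P (fun w => Y w * (xi w ^+ 3 - 3 * tau * xi w)) = 0.
Proof.
have [i e] := mom (k := 3) isT; have [i1 e1] := hermite1.
have i' := integrable_rvZ (3 * tau) i1.
have E : (fun w => Y w * (xi w ^+ 3 - 3 * tau * xi w)) =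
    fun w => Y w * xi w ^+ 3 - 3 * tau * (Y w * xi w) by apply/funext => w; ring.
rewrite E; split; first exact: integrable_rvB.
rewrite meanB// e (meanZ _ i1) e1 mulr0 subr0.
by rewrite (increment_mean_odd B_bm s_ge0 st tT (k := 3) isT isT) mulr0.
Qed.

Lemma hermite4 :
  integrable_rv P (fun w => Y w * (xi w ^+ 4 - 6 * tau * xi w ^+ 2 + 3 * tau ^+ 2)) /\
  mean P (fun w => Y w * (xi w ^+ 4 - 6 * tau * xi w ^+ 2 + 3 * tau ^+ 2)) = 0.
Proof.
have [i4 e4] := mom (k := 4) isT; have [i2 e2] := mom (k := 2) isT.
have i2' := integrable_rvZ (6 * tau) i2.
have i' := integrable_rvZ (3 * tau ^+ 2) iY.
have E : (fun w => Y w * (xi w ^+ 4 - 6 * tau * xi w ^+ 2 + 3 * tau ^+ 2)) =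
    fun w => (Y w * xi w ^+ 4 - 6 * tau * (Y w * xi w ^+ 2)) + 3 * tau ^+ 2 * Y w.
  by apply/funext => w; ring.
have i42 := integrable_rvB i4 i2'.
rewrite E; split; first exact: integrable_rvD.
rewrite (meanD i42 i') (meanB i4 i2') e4 (meanZ _ i2) (meanZ _ iY) e2.
rewrite (increment_mean2 B_bm s_ge0 st tT) (increment_mean4 B_bm s_ge0 st tT).
by rewrite /tau; ring.
Qed.

End hermite_increment.

Section past.
Context {d} {Omega : measurableType d} {R : realType} (P : probability Omega R).
Variables (T : R) (B B' : R -> Omega -> R).

(** The symmetric past, to which the whole scheme is adapted. It is contained in [enlarged_past]
    with either Brownian motion in the leading role, so one adaptedness statement serves the
    increments of both. *)
Definition past (s : R) : set (set Omega) :=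
  \bigcup_(u in `[0, s]) (preimage_set_system setT (B u) measurable
                         `|` preimage_set_system setT (B' u) measurable).

Lemma past_le s s' : s <= s' -> <<s past s >> `<=` <<s past s' >>.
Proof.
move=> ss'; apply: sub_sigma_algebra2; apply: bigcup_subset => u /=.
by rewrite !in_itv/= => /andP[-> us]; exact: le_trans ss'.
Qed.

Lemma past_l s u : u \in `[0, s] -> measurable_wrt (past s) (B u).
Proof.
move=> us; apply: measurable_wrt_preimage_system => A BA; apply: sub_gen_smallest.
by exists u => //; left.
Qed.

Lemma past_r s u : u \in `[0, s] -> measurable_wrt (past s) (B' u).
Proof.
move=> us; apply: measurable_wrt_preimage_system => A BA; apply: sub_gen_smallest.
by exists u => //; right.
Qed.

Hypothesis mB : forall t : R, t \in `[0, T] -> measurable_fun setT (B t).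
Hypothesis mB' : forall t : R, t \in `[0, T] -> measurable_fun setT (B' t).

Lemma past_measurable s : s <= T -> past s `<=` measurable.
Proof.
move=> sT A [u]; rewrite /= in_itv/= => /andP[u0 us].
have uT : u \in `[0, T] by rewrite in_itv/= u0 (le_trans us).
by move=> [] [U mU <-]; [exact: mB|exact: mB'].
Qed.

Lemma past_enlarged_l s : s <= T -> <<s past s >> `<=` <<s enlarged_past T B B' s >>.
Proof.
move=> sT; apply: smallest_sub; first exact: smallest_sigma_algebra.
move=> A [u us [] hA].
- by have := @enlarged_past_l _ _ R T B B' s u us => /(_ measurableT); case: hA => U mU <-; exact.
- have uT : u \in `[0, T].
    by move: us; rewrite /= !in_itv/= => /andP[-> us]; exact: le_trans sT.
  by have := @enlarged_past_r _ _ R T B B' s u uT => /(_ measurableT); case: hA => U mU <-; exact.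
Qed.

Lemma past_enlarged_r s : s <= T -> <<s past s >> `<=` <<s enlarged_past T B' B s >>.
Proof.
move=> sT; apply: smallest_sub; first exact: smallest_sigma_algebra.
move=> A [u us [] hA].
- have uT : u \in `[0, T].
    by move: us; rewrite /= !in_itv/= => /andP[-> us]; exact: le_trans sT.
  by have := @enlarged_past_r _ _ R T B' B s u uT => /(_ measurableT); case: hA => U mU <-; exact.
- by have := @enlarged_past_l _ _ R T B' B s u us => /(_ measurableT); case: hA => U mU <-; exact.
Qed.

End past.

Section cell.
Context {d} {Omega : measurableType d} {R : realType} (P : probability Omega R).
Variables (T : R) (W W' : R -> Omega -> R).
Hypotheses (W_bm : brownian_motion P T W).
Hypothesis W'_measurable : forall t : R, t \in `[0, T] -> measurable_fun setT (W' t).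
Hypothesis WW' : independent_systems P (sigma_generated `[0, T] W) (sigma_generated `[0, T] W').
Variables (s t : R).
Hypotheses (s_ge0 : 0 <= s) (st : s < t) (tT : t <= T).
Let xi w := W t w - W s w.
Let tau := t - s.
Variable F : set (set Omega).
Hypothesis Fm : F `<=` measurable.
Hypothesis FH : <<s F >> `<=` <<s enlarged_past T W W' s >>.
Variables (N sig A h : Omega -> R) (c : R).
Hypotheses (N4 : L4 P F N) (sig4 : L4 P F sig) (A4 : L4 P F A).
Hypotheses (mh : measurable_wrt F h) (hc : forall w, `|h w| <= c).

Let mF (f : Omega -> R) : measurable_wrt F f -> measurable_wrt (enlarged_past T W W' s) f.
Proof. exact: measurable_wrt_sub. Qed.

Let one : L4 P F (fun=> 1). Proof. exact: L4_cst. Qed.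

(* The coefficients of the Hermite polynomials of the increment are products of
   at most four functions with fourth moments. *)
Let coef f1 f2 f3 f4 : L4 P F f1 -> L4 P F f2 -> L4 P F f3 -> L4 P F f4 ->
  measurable_wrt (enlarged_past T W W' s) (fun w => f1 w * f2 w * f3 w * f4 w * h w) /\
  integrable_rv P (fun w => f1 w * f2 w * f3 w * f4 w * h w).
Proof.
move=> h1 h2 h3 h4; split.
  apply: mF; case: h1 h2 h3 h4 => [m1 _] [m2 _] [m3 _] [m4 _].
  by apply: measurable_funM => //; apply: measurable_funM => //; apply: measurable_funM => //;
    exact: measurable_funM.
apply: (@integrable_rv_mul_bounded _ _ _ _ _ _ c) => //.
  exact: (L4_integrable_mul Fm).
exact: measurable_wrt_measurable mh.
Qed.

Lemma cell_martingale :
  mean P (fun w => (N w + sig w * xi w - N w) * h w) = 0.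
Proof.
have [m1 i1] := coef sig4 one one one.
have [_ <-] := hermite1 W_bm W'_measurable WW' s_ge0 st tT m1 i1.
by congr mean; apply/funext => w; rewrite /xi; ring.
Qed.

(** With xi the increment, the difference is 2 N sig xi + sig^2 (xi^2 - tau): Hermite polynomials
    with coefficients known at the start of the increment. *)
Lemma cell_bracket :
  mean P (fun w => (((N w + sig w * xi w) ^+ 2 - (A w + sig w ^+ 2 * tau))
    - (N w ^+ 2 - A w)) * h w) = 0.
Proof.
have [m1 i1] := coef N4 sig4 one one.
have [j1 e1] := hermite1 W_bm W'_measurable WW' s_ge0 st tT m1 i1.
have [m2 i2] := coef sig4 sig4 one one.
have [j2 e2] := hermite2 W_bm W'_measurable WW' s_ge0 st tT m2 i2.
transitivity (2 * 0 + 0 : R); last by ring.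
rewrite -{1}e1 -e2 -(meanZ _ j1) -(meanD (integrable_rvZ _ j1) j2).
by congr mean; apply/funext => w; rewrite /xi /tau; ring.
Qed.

Let H4 (x a : R) := x ^+ 4 - 6 * (x ^+ 2 * a) + 3 * a ^+ 2.

(** Expanding along the increment leaves only Hermite polynomials of xi: degree one with coefficient
    4 N^3 sig - 12 N A sig, degree two with 6 N^2 sig^2 - 6 A sig^2, degree three with 4 N sig^3,
    degree four with sig^4. Each term has mean zero against [h]. *)
Lemma cell_hermite4 :
  mean P (fun w => (H4 (N w + sig w * xi w) (A w + sig w ^+ 2 * tau) - H4 (N w) (A w)) * h w) = 0.
Proof.
have [m1 i1] := coef N4 N4 N4 sig4.
have [j1 e1] := hermite1 W_bm W'_measurable WW' s_ge0 st tT m1 i1.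
have [m2 i2] := coef N4 A4 sig4 one.
have [j2 e2] := hermite1 W_bm W'_measurable WW' s_ge0 st tT m2 i2.
have [m3 i3] := coef N4 N4 sig4 sig4.
have [j3 e3] := hermite2 W_bm W'_measurable WW' s_ge0 st tT m3 i3.
have [m4 i4] := coef A4 sig4 sig4 one.
have [j4 e4] := hermite2 W_bm W'_measurable WW' s_ge0 st tT m4 i4.
have [m5 i5] := coef N4 sig4 sig4 sig4.
have [j5 e5] := hermite3 W_bm W'_measurable WW' s_ge0 st tT m5 i5.
have [m6 i6] := coef sig4 sig4 sig4 sig4.
have [j6 e6] := hermite4 W_bm W'_measurable WW' s_ge0 st tT m6 i6.
have k1 := integrable_rvZ 4 j1; have k2 := integrable_rvZ 12 j2.
have k3 := integrable_rvZ 6 j3; have k4 := integrable_rvZ 6 j4.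
have k5 := integrable_rvZ 4 j5.
have k12 := integrable_rvB k1 k2; have k34 := integrable_rvB k3 k4.
have k56 := integrable_rvD k5 j6.
have k3456 := integrable_rvD k34 k56.
transitivity ((4 * 0 - 12 * 0) + ((6 * 0 - 6 * 0) + (4 * 0 + 0)) : R); last by ring.
rewrite -{1}e1 -{1}e2 -{1}e3 -{1}e4 -{1}e5 -e6.
rewrite -(meanZ _ j1) -(meanZ _ j2) -(meanZ _ j3) -(meanZ _ j4) -(meanZ _ j5).
rewrite -(meanB k1 k2) -(meanB k3 k4) -(meanD k5 j6) -(meanD k34 k56) -(meanD k12 k3456).
by congr mean; apply/funext => w; rewrite /xi /tau /H4; ring.
Qed.

Lemma cell_L4_integrable : integrable_rv P (fun w => (sig w * xi w) ^+ 4).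
Proof.
case: sig4 => ms is4.
have [] := increment_moment W_bm W'_measurable WW' s_ge0 st tT (k := 4)
  (Y := fun w => sig w ^+ 4) isT _ is4.
  by apply: mF; exact: measurable_funX.
move=> + _; congr (integrable_rv P _).
by apply/funext => w; rewrite exprMn.
Qed.

End cell.

(** * The scheme: martingales and uniform moment bounds *)

Lemma sqrD_le (R : realFieldType) (x y : R) : (x + y) ^+ 2 <= 2 * x ^+ 2 + 2 * y ^+ 2.
Proof. by have := sqr_ge0 (x - y); lra. Qed.

Lemma sqrD3_le (R : realFieldType) (x y z : R) :
  (x - y + z) ^+ 2 <= 3 * x ^+ 2 + 3 * y ^+ 2 + 3 * z ^+ 2.
Proof.
by have := sqr_ge0 (x + y); have := sqr_ge0 (x - z); have := sqr_ge0 (y + z); lra.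
Qed.

Section scheme.
Context {d} {Omega : measurableType d} {R : realType} (P : probability Omega R).
Variables (T V0 theta lambda nu : R) (n : nat) (t : nat -> R) (K : R -> R).
Variables (B B' X Xb M M' : R -> Omega -> R).
Hypotheses (n_gt0 : (0 < n)%N) (t_grid : is_grid T n t).
Hypotheses (B_bm : brownian_motion P T B) (B'_bm : brownian_motion P T B').
Hypothesis BB' : independent_systems P (sigma_generated `[0, T] B) (sigma_generated `[0, T] B').
Hypothesis scheme : is_scheme T V0 theta lambda nu n t K B B' X Xb M M'.

Local Notation past s := (past B B' s).
Local Notation adapted4 s := (L4 P (past s)).

Let mB : forall u : R, u \in `[0, T] -> measurable_fun setT (B u).
Proof. exact: bm_measurable B_bm. Qed.
Let mB' : forall u : R, u \in `[0, T] -> measurable_fun setT (B' u).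
Proof. exact: bm_measurable B'_bm. Qed.

Let B'B : independent_systems P (sigma_generated `[0, T] B') (sigma_generated `[0, T] B).
Proof. by move=> A A' hA hA'; rewrite setIC muleC; exact: BB'. Qed.

Let past_m (s : R) : s <= T -> past s `<=` measurable.
Proof. exact: past_measurable. Qed.

Let T_ge0 : 0 <= T. Proof. exact/ltW/(grid_gt0 t_grid). Qed.
Let tT k : (k <= n)%N -> t k <= T.
Proof. by move=> kn; have := grid_itv t_grid kn; rewrite in_itv/= => /andP[]. Qed.
Let t_ge0 k : (k <= n)%N -> 0 <= t k.
Proof. by move=> kn; have := grid_itv t_grid kn; rewrite in_itv/= => /andP[]. Qed.
Let t_lt k : (k < n)%N -> t k < t k.+1.
Proof. by case: t_grid => _ _; exact. Qed.
Let t0 : t 0 = 0. Proof. by case: t_grid. Qed.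
Let tn : t n = T. Proof. by case: t_grid. Qed.

Lemma adapted4_le s s' (f : Omega -> R) : s <= s' -> adapted4 s f -> adapted4 s' f.
Proof. by move=> ss' [mf i]; split => //; exact: measurable_wrt_sub (past_le ss') mf. Qed.

Definition drift (w : Omega) (v : R) : R := theta * v - lambda * Xb v w + nu * M v w.

Lemma scheme_XE u w : 0 <= u <= T -> X u w = V0 * u + kernel_sum n t K u (drift w).
Proof.
by move=> uT; rewrite (scheme_X scheme)// -?(kernel_sumE t_grid K (drift w) uT) ?in_itv.
Qed.

Lemma scheme_X0 w : X 0 w = 0.
Proof.
rewrite scheme_XE ?lexx//= mulr0 add0r /kernel_sum big1// => k _.
by rewrite kernel_weight_past ?mul0r// t_ge0// ltnW.
Qed.

Lemma scheme_Xbar_le k w : (k < n)%N -> Xb (t k) w <= Xb (t k.+1) w.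
Proof.
move=> kn; rewrite !(scheme_Xbar_grid scheme)// ?(ltnW kn)//.
apply: bigmax_le; first exact: bigmax_ge_id.
move=> i _; exact: (le_bigmax _ (fun j : 'I_k.+2 => X (t j) w) (widen_ord (leqnSn _) i)).
Qed.

Lemma scheme_Xbar0 w : Xb 0 w = 0.
Proof.
rewrite -[in LHS]t0 (scheme_Xbar_grid scheme)// big_ord_recl big_ord0/= t0 scheme_X0.
exact: maxxx.
Qed.

(** The volatility on a cell: there M moves by [cell_vol] times the Brownian increment and Xbar
    grows at the constant rate [cell_vol] squared, so the bracket identity holds between grid times
    too. *)
Definition cell_vol k w : R :=
  Num.sqrt (Xb (t k.+1) w - Xb (t k) w) / Num.sqrt (t k.+1 - t k).

Lemma cell_vol_sq k w : (k < n)%N ->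
  cell_vol k w ^+ 2 = (Xb (t k.+1) w - Xb (t k) w) / (t k.+1 - t k).
Proof.
move=> kn; rewrite exprMn exprVn !sqr_sqrtr// subr_ge0 ?scheme_Xbar_le//.
exact/ltW/t_lt.
Qed.

Lemma scheme_Xbar_cell k (s u : R) w : (k < n)%N -> t k <= s -> s <= u -> u <= t k.+1 ->
  Xb u w = Xb s w + cell_vol k w ^+ 2 * (u - s).
Proof.
move=> kn ks su uk.
have E v (hv : v \in `[t k, t k.+1]) := scheme_Xbar scheme w kn hv.
have uI : u \in `[t k, t k.+1] by rewrite in_itv/= uk (le_trans ks).
have sI : s \in `[t k, t k.+1] by rewrite in_itv/= ks (le_trans su).
rewrite (E _ uI) (E _ sI).
rewrite cell_vol_sq//; field.
by rewrite gt_eqF// subr_gt0 t_lt.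
Qed.

Lemma scheme_M_cell k (s u : R) w : (k < n)%N -> t k <= s -> s <= u -> u <= t k.+1 ->
  M u w = M s w + cell_vol k w * (B u w - B s w).
Proof.
move=> kn ks su uk.
have E v (hv : v \in `[t k, t k.+1]) := scheme_M scheme w kn hv.
have uI : u \in `[t k, t k.+1] by rewrite in_itv/= uk (le_trans ks).
have sI : s \in `[t k, t k.+1] by rewrite in_itv/= ks (le_trans su).
rewrite (E _ uI) (E _ sI).
by rewrite /cell_vol; ring.
Qed.

Lemma scheme_Mperp_cell k (s u : R) w : (k < n)%N -> t k <= s -> s <= u -> u <= t k.+1 ->
  M' u w = M' s w + cell_vol k w * (B' u w - B' s w).
Proof.
move=> kn ks su uk.
have E v (hv : v \in `[t k, t k.+1]) := scheme_Mperp scheme w kn hv.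
have uI : u \in `[t k, t k.+1] by rewrite in_itv/= uk (le_trans ks).
have sI : s \in `[t k, t k.+1] by rewrite in_itv/= ks (le_trans su).
rewrite (E _ uI) (E _ sI).
by rewrite /cell_vol; ring.
Qed.

(** The weights of the cells after [k] vanish up to time [t k.+1], so X there is a finite
    combination of values at grid times already reached at [t k]. *)
Let X_predictable k (u : R) : (k < n)%N ->
  (forall j, (j <= k)%N -> adapted4 (t j) (Xb (t j)) /\ adapted4 (t j) (M (t j))) ->
  0 <= u -> u <= t k.+1 -> adapted4 (t k) (X u).
Proof.
move=> kn hk u0 uk.
have Fm := past_m (tT (ltnW kn)).
have -> : X u = fun w => V0 * u + \sum_(j < n) kernel_weight t K u j *
    (theta * t j - lambda * Xb (t j) w + nu * M (t j) w).
  by apply/funext => w; rewrite scheme_XE// u0 (le_trans uk)// tT.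
apply: L4D => //; first exact: L4_cst.
apply: L4_sum => // j; have [jk|kj] := leqP j k.
  have tjk : t j <= t k by apply: (grid_le t_grid); rewrite jk ltnW.
  have [hX hM] := hk j jk.
  apply: L4Z => //; apply: L4D => //; last by apply: L4Z => //; exact: adapted4_le hM.
  apply: L4B => //; first exact: L4_cst.
  by apply: L4Z => //; exact: adapted4_le hX.
rewrite kernel_weight_past; last first.
  by apply: (le_trans uk); apply: (grid_le t_grid); rewrite kj ltnW.
under eq_fun do rewrite mul0r.
exact: L4_cst.
Qed.

(** The new maximum involves X up to [t k.+1] only, hence is known one step ahead. This is why the
    square root of the increment of Xbar may be treated as a coefficient, independent of the
    Brownian increment that it multiplies. *)
Let Xb_predictable k : (k < n)%N ->
  (forall j, (j <= k)%N -> adapted4 (t j) (Xb (t j)) /\ adapted4 (t j) (M (t j))) ->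
  adapted4 (t k) (Xb (t k.+1)).
Proof.
move=> kn hk.
have -> : Xb (t k.+1) = fun w => \big[Num.max/X (t 0) w]_(j < k.+2) X (t j) w.
  by apply/funext => w; rewrite (scheme_Xbar_grid scheme).
apply: (@L4_bigmax _ _ _ P (past (t k)) (past_m (tT (ltnW kn))) (X (t 0)) k.+2 (fun j => X (t j))).
  by rewrite t0; apply: X_predictable => //; exact: t_ge0.
move=> i ik; apply: X_predictable => //; first by rewrite t_ge0// (leq_trans _ kn).
by apply: (grid_le t_grid); rewrite kn andbT.
Qed.

Let cell_vol_L4 k : (k < n)%N -> adapted4 (t k) (Xb (t k)) -> adapted4 (t k) (Xb (t k.+1)) ->
  adapted4 (t k) (cell_vol k).
Proof.
move=> kn h1 h2; rewrite /cell_vol.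
under eq_fun do rewrite mulrC.
by have Fm := past_m (tT (ltnW kn)); apply: L4Z => //; apply: L4_sqrt => //; exact: L4B.
Qed.

(** Stated for a generic pair of Brownian motions, so that it covers M driven by [B] and M' driven
    by [B']. The fourth moment of the new term factorises by independence. *)
Let step_L4 (W W' N : R -> Omega -> R) k (s u : R) : brownian_motion P T W ->
  (forall u : R, u \in `[0, T] -> measurable_fun setT (W' u)) ->
  independent_systems P (sigma_generated `[0, T] W) (sigma_generated `[0, T] W') ->
  (forall s, s <= T -> <<s past s >> `<=` <<s enlarged_past T W W' s >>) ->
  (forall s u : R, u \in `[0, s] -> measurable_wrt (past s) (W u)) ->
  (k < n)%N -> t k <= s -> s <= u -> u <= t k.+1 ->
  (forall w, N u w = N s w + cell_vol k w * (W u w - W s w)) ->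
  adapted4 s (N s) -> adapted4 s (cell_vol k) -> adapted4 u (N u).
Proof.
move=> W_bm mW' WW' FH mW kn ks; rewrite le_eqVlt => /predU1P[<-//|su] uk NE N4 sig4.
have uT : u <= T := le_trans uk (tT kn).
have s0 : 0 <= s := le_trans (t_ge0 (ltnW kn)) ks.
have -> : N u = fun w => N s w + cell_vol k w * (W u w - W s w) by apply/funext.
have Fm := past_m uT.
apply: L4D => //; first exact: adapted4_le (ltW su) N4.
have sT : s <= T := le_trans (ltW su) uT.
split.
  apply: measurable_funM; first by case: (adapted4_le (ltW su) sig4).
  by apply: measurable_funB; apply: mW; rewrite in_itv/= ?lexx ?s0 ?(le_trans s0) ?(ltW su).
exact: (cell_L4_integrable W_bm mW' WW' s0 su uT (FH _ sT) sig4).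
Qed.

Let FHl s : s <= T -> <<s past s >> `<=` <<s enlarged_past T B B' s >>.
Proof. exact: past_enlarged_l. Qed.
Let FHr s : s <= T -> <<s past s >> `<=` <<s enlarged_past T B' B s >>.
Proof. exact: past_enlarged_r. Qed.

(** The four processes go through the induction together, with all earlier grid times in the
    hypothesis, because X has memory: its next value uses the whole discrete history of Xbar and
    M. *)
Let grid_L4 k : (k <= n)%N -> forall j, (j <= k)%N ->
  [/\ adapted4 (t j) (X (t j)), adapted4 (t j) (Xb (t j)),
      adapted4 (t j) (M (t j)) & adapted4 (t j) (M' (t j))].
Proof.
elim: k => [_ j|k IH kn j].
  rewrite leqn0 => /eqP ->; rewrite t0.
  have -> : X 0 = fun=> 0 by apply/funext => w; exact: scheme_X0.
  have -> : Xb 0 = fun=> 0 by apply/funext => w; exact: scheme_Xbar0.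
  have -> : M 0 = fun=> 0 by apply/funext => w; exact: scheme_M0 scheme w.
  have -> : M' 0 = fun=> 0 by apply/funext => w; exact: scheme_Mperp0 scheme w.
  by split; exact: L4_cst.
rewrite leq_eqVlt => /predU1P[->{j}|]; last exact: IH (ltnW kn) j.
have {}IH := IH (ltnW kn).
have hk i : (i <= k)%N -> adapted4 (t i) (Xb (t i)) /\ adapted4 (t i) (M (t i)) by move=> /IH[].
have tk := ltW (t_lt kn).
have hXb := Xb_predictable kn hk.
have [_ hXbk hM hM'] := IH k (leqnn _).
have hs := cell_vol_L4 kn hXbk hXb.
split.
- by apply: (adapted4_le tk); apply: X_predictable => //; exact: t_ge0.
- exact: (adapted4_le tk).
- apply: (step_L4 B_bm mB' BB' FHl _ kn (lexx _) tk (lexx _) _ hM hs) => //.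
  + by move=> s u us; exact: past_l.
  + by move=> w; apply: scheme_M_cell.
- apply: (step_L4 B'_bm mB B'B FHr _ kn (lexx _) tk (lexx _) _ hM' hs) => //.
  + by move=> s u us; exact: past_r.
  + by move=> w; apply: scheme_Mperp_cell.
Qed.

Lemma cell_of (u : R) : 0 <= u <= T -> exists2 k, (k < n)%N & t k <= u <= t k.+1.
Proof.
move=> /andP[u0]; rewrite le_eqVlt => /predU1P[->|uT].
  (* At the horizon the last cell, taken closed, is used. *)
  exists n.-1; first by rewrite prednK.
  by rewrite prednK// tT ?leq_pred// tn lexx.
have [|k kn uk] := @grid_cell _ _ _ _ t_grid u; first by rewrite u0.
by exists k => //; move: uk; rewrite in_itv/= => /andP[-> /ltW ->].
Qed.

Lemma cell_vol_adapted k (s : R) : (k < n)%N -> t k <= s -> adapted4 s (cell_vol k).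
Proof.
move=> kn ks; have [_ h1 _ _] := grid_L4 kn (ltnW (ltnSn k)).
apply: (adapted4_le ks); apply: cell_vol_L4 => //.
by apply: Xb_predictable => // j jk; have [] := grid_L4 (ltnW kn) jk.
Qed.

Lemma scheme_adapted4 (u : R) : 0 <= u <= T ->
  [/\ adapted4 u (X u), adapted4 u (Xb u), adapted4 u (M u) & adapted4 u (M' u)].
Proof.
move=> /[dup] uT /cell_of [k kn /andP[ku uk]].
have [_ hXb hM hM'] := grid_L4 (ltnW kn) (leqnn k).
have hs := cell_vol_adapted kn (lexx (t k)).
have Fm : past u `<=` measurable by apply: past_m; case/andP: uT.
split.
- apply: (adapted4_le ku); apply: X_predictable => //; last by case/andP: uT.
  by move=> j jk; have [] := grid_L4 (ltnW kn) jk.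
- have -> : Xb u = fun w => Xb (t k) w + (u - t k) * cell_vol k w ^+ 2.
    by apply/funext => w; rewrite (scheme_Xbar_cell w kn (lexx _) ku uk) mulrC.
  have -> : (fun w => Xb (t k) w + (u - t k) * cell_vol k w ^+ 2) =
    fun w => Xb (t k) w + (u - t k) / (t k.+1 - t k) * (Xb (t k.+1) w - Xb (t k) w).
    by apply/funext => w; rewrite cell_vol_sq//; ring.
  apply: L4D => //; first exact: adapted4_le hXb.
  apply: L4Z => //; apply: L4B => //; last exact: adapted4_le hXb.
  apply: (adapted4_le ku).
  by apply: Xb_predictable => // j jk; have [] := grid_L4 (ltnW kn) jk.
- apply: (step_L4 B_bm mB' BB' FHl _ kn (lexx _) ku uk _ hM hs) => //.
  + by move=> s v us; exact: past_l.
  + by move=> w; apply: scheme_M_cell.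
- apply: (step_L4 B'_bm mB B'B FHr _ kn (lexx _) ku uk _ hM' hs) => //.
  + by move=> s v us; exact: past_r.
  + by move=> w; apply: scheme_Mperp_cell.
Qed.

(** The martingale property in a form suited to limits in law: no conditional expectation, only
    means against bounded functions of the past. *)
Definition fair (N : R -> Omega -> R) : Prop := forall (s u : R) (h : Omega -> R) (c : R),
  0 <= s -> s <= u -> u <= T -> measurable_wrt (past s) h -> (forall w, `|h w| <= c) ->
  mean P (fun w => (N u w - N s w) * h w) = 0.

(** Induction on the last cell: an increment that crosses [t k] is cut there, and a function of the
    past at [s] is also one of the later past at [t k]. Only increments inside one cell remain to be
    checked. *)
Lemma fair_of_cells (N : R -> Omega -> R) :
  (forall u : R, 0 <= u <= T -> integrable_rv P (N u)) ->
  (forall k (s u : R) (h : Omega -> R) (c : R), (k < n)%N -> t k <= s -> s < u -> u <= t k.+1 ->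
    measurable_wrt (past s) h -> (forall w, `|h w| <= c) ->
    mean P (fun w => (N u w - N s w) * h w) = 0) -> fair N.
Proof.
move=> iN cellN.
suff H k : (k <= n)%N -> forall (s u : R) (h : Omega -> R) (c : R), 0 <= s -> s <= u -> u <= t k ->
    measurable_wrt (past s) h -> (forall w, `|h w| <= c) ->
    mean P (fun w => (N u w - N s w) * h w) = 0.
  by move=> s u h c s0 su uT; apply: (H n (leqnn n)) => //; rewrite tn.
have diag (h : Omega -> R) v : mean P (fun w => (N v w - N v w) * h w) = 0.
  by under eq_fun do rewrite subrr mul0r; rewrite mean_cst.
elim: k => [_|k IH kn] s u h c s0 su uT mh hc.
  have u0 : u = 0 by apply/eqP; rewrite eq_le -{1}t0 uT (le_trans s0 su).
  have -> : s = u by apply/eqP; rewrite eq_le su u0 s0.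
  exact: diag.
have [utk|tku] := leP u (t k); first exact: IH (ltnW kn) _ _ _ _ s0 su utk mh hc.
have [tks|stk] := leP (t k) s.
  move: su; rewrite le_eqVlt => /predU1P[->|su]; first exact: diag.
  exact: cellN kn tks su uT mh hc.
have mh' : measurable_wrt (past (t k)) h.
  by apply: measurable_wrt_sub mh; apply: past_le; exact: ltW.
have e1 := cellN k _ _ _ _ kn (lexx _) tku uT mh' hc.
have e2 := IH (ltnW kn) _ _ _ _ s0 (ltW stk) (lexx _) mh hc.
have tkT := tT (ltnW kn).
have mhT : measurable_fun setT h.
  by apply: measurable_wrt_measurable mh'; exact: past_m.
have iNh v : 0 <= v <= T -> integrable_rv P (fun w => N v w * h w).
  by move=> vT; apply: (integrable_rv_mul_bounded (iN _ vT) mhT hc).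
have iu := iNh u; have ik := iNh (t k); have is_ := iNh s.
rewrite (le_trans s0 su) (le_trans uT (tT kn)) in iu.
rewrite t_ge0 ?tT ?(ltnW kn)// in ik.
rewrite s0 (le_trans (ltW stk) tkT) in is_.
have -> : (fun w => (N u w - N s w) * h w) =
   fun w => (N u w - N (t k) w) * h w + (N (t k) w - N s w) * h w.
  by apply/funext => w; ring.
have id v v' : integrable_rv P (fun w => N v w * h w) -> integrable_rv P (fun w => N v' w * h w) ->
    integrable_rv P (fun w => (N v w - N v' w) * h w).
  move=> i i'; have := integrable_rvB i i'.
  by congr (integrable_rv P _); apply/funext => w; ring.
by rewrite meanD ?e1 ?e2 ?addr0//; apply: id; [exact: iu|exact: ik|exact: ik|exact: is_].
Qed.

Let one s : s <= T -> adapted4 s (fun=> 1).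
Proof. by move=> sT; exact: L4_cst. Qed.

Lemma scheme_integrable (u : R) : 0 <= u <= T ->
  [/\ integrable_rv P (Xb u), integrable_rv P (M u), integrable_rv P (M' u) &
   [/\ integrable_rv P (fun w => Xb u w ^+ 2), integrable_rv P (fun w => M u w ^+ 2),
     integrable_rv P (fun w => M' u w ^+ 2) & integrable_rv P (fun w => M u w * M' u w)]].
Proof.
move=> uT; have [hX hXb hM hM'] := scheme_adapted4 uT.
have uT' : u <= T by case/andP: uT.
have Fm := past_m uT'.
split; [exact: (L4_integrable Fm)|exact: (L4_integrable Fm)|exact: (L4_integrable Fm)|].
split; [exact: (L4_sq Fm)|exact: (L4_sq Fm)|exact: (L4_sq Fm)|].
have := L4_integrable_mul Fm hM hM' (one uT') (one uT').
by under eq_fun do rewrite !mulr1.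
Qed.

(* The fourth Hermite polynomial with variance a, a martingale along x = N, a = Xbar. *)
Let H4 (x a : R) := x ^+ 4 - 6 * (x ^+ 2 * a) + 3 * a ^+ 2.

Let H4_integrable (N : R -> Omega -> R) (u : R) : 0 <= u <= T -> adapted4 u (N u) ->
  [/\ integrable_rv P (fun w => N u w ^+ 4), integrable_rv P (fun w => N u w ^+ 2 * Xb u w) &
   integrable_rv P (fun w => H4 (N u w) (Xb u w))].
Proof.
move=> uT hN; have [_ hXb _ _] := scheme_adapted4 uT.
have uT' : u <= T by case/andP: uT.
have Fm := past_m uT'.
have i4 : integrable_rv P (fun w => N u w ^+ 4) by case: hN.
have i2 : integrable_rv P (fun w => N u w ^+ 2 * Xb u w).
  have := L4_integrable_mul Fm hN hN hXb (one uT').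
  by under eq_fun do rewrite !mulr1 -expr2.
split => //.
apply: integrable_rvD; last by apply: integrable_rvZ; exact: (L4_sq Fm hXb).
by apply: integrable_rvB => //; exact: integrable_rvZ.
Qed.

Section one_direction.
Variables (W W' N : R -> Omega -> R).
Hypothesis W_bm : brownian_motion P T W.
Hypothesis mW' : forall u : R, u \in `[0, T] -> measurable_fun setT (W' u).
Hypothesis WW' : independent_systems P (sigma_generated `[0, T] W) (sigma_generated `[0, T] W').
Hypothesis FH : forall s, s <= T -> <<s past s >> `<=` <<s enlarged_past T W W' s >>.
Hypothesis NE : forall k (s u : R) w, (k < n)%N -> t k <= s -> s <= u -> u <= t k.+1 ->
  N u w = N s w + cell_vol k w * (W u w - W s w).
Hypothesis hN : forall u, 0 <= u <= T -> adapted4 u (N u).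
Hypothesis N0 : forall w, N 0 w = 0.

Let sI k (s u : R) : (k < n)%N -> t k <= s -> s < u -> u <= t k.+1 ->
  [/\ 0 <= s, u <= T & 0 <= s <= T].
Proof.
move=> kn ks su uk; have s0 : 0 <= s := le_trans (t_ge0 (ltnW kn)) ks.
have uT : u <= T := le_trans uk (tT kn).
by rewrite s0 uT (le_trans (ltW su) uT).
Qed.

Lemma fair_direction : fair N.
Proof.
apply: fair_of_cells => [u uT|k s u h c kn ks su uk mh hc].
  by apply: (L4_integrable _ (hN uT)); apply: past_m; case/andP: uT.
have [s0 uT sT] := sI kn ks su uk.
have sT' : s <= T by case/andP: sT.
under eq_fun do rewrite (NE _ kn ks (ltW su) uk).
exact: (cell_martingale W_bm mW' WW' s0 su uT (past_m sT') (FH sT') _ (cell_vol_adapted kn ks) mh hc).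
Qed.

Lemma fair_square : fair (fun u w => N u w ^+ 2 - Xb u w).
Proof.
apply: fair_of_cells => [u uT|k s u h c kn ks su uk mh hc].
  have [i1 _ _ _] := scheme_integrable uT.
  apply: integrable_rvB => //.
  by apply: (L4_sq _ (hN uT)); apply: past_m; case/andP: uT.
have [s0 uT sT] := sI kn ks su uk.
have sT' : s <= T by case/andP: sT.
have [_ hXb _ _] := scheme_adapted4 sT.
under eq_fun do rewrite (NE _ kn ks (ltW su) uk) (scheme_Xbar_cell _ kn ks (ltW su) uk).
exact: (cell_bracket W_bm mW' WW' s0 su uT (past_m sT') (FH sT') _ (hN sT) (cell_vol_adapted kn ks) mh hc).
Qed.

Let fair_H4 : fair (fun u w => H4 (N u w) (Xb u w)).
Proof.
apply: fair_of_cells => [u uT|k s u h c kn ks su uk mh hc].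
  by have [] := H4_integrable uT (hN uT).
have [s0 uT sT] := sI kn ks su uk.
have sT' : s <= T by case/andP: sT.
have [_ hXb _ _] := scheme_adapted4 sT.
under eq_fun do rewrite (NE _ kn ks (ltW su) uk) (scheme_Xbar_cell _ kn ks (ltW su) uk).
exact: (cell_hermite4 W_bm mW' WW' s0 su uT (past_m sT') (FH sT') (hN sT) (cell_vol_adapted kn ks) hXb mh hc).
Qed.

Lemma mean_square u : 0 <= u <= T -> mean P (fun w => N u w ^+ 2) = mean P (Xb u).
Proof.
move=> /[dup] uI /andP[u0 uT].
have := @fair_square 0 u (fun=> 1) 1 (lexx _) u0 uT (measurable_cst _).
have n1 (w : Omega) : `|1 : R| <= 1 by rewrite normr1.
move=> /(_ n1) {n1}.
under eq_fun do rewrite mulr1 N0 scheme_Xbar0 expr0n/= !subr0.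
have [i1 _ _ _] := scheme_integrable uI.
rewrite meanB//; last by apply: (L4_sq _ (hN uI)); exact: past_m.
by move=> /eqP; rewrite subr_eq0 => /eqP.
Qed.

(** The Hermite martingale gives E N^4 = 6 E (N^2 Xb) - 3 E Xb^2. With 6 N^2 Xb <= N^4 / 2 + 18
    Xb^2, half of the fourth moment is absorbed on the left; 36 is twice 18, the negative term being
    discarded. *)
Lemma mean_fourth u : 0 <= u <= T ->
  mean P (fun w => N u w ^+ 4) <= 36 * mean P (fun w => Xb u w ^+ 2).
Proof.
move=> /[dup] uI /andP[u0 uT].
have := @fair_H4 0 u (fun=> 1) 1 (lexx _) u0 uT (measurable_cst _).
have n1 (w : Omega) : `|1 : R| <= 1 by rewrite normr1.
move=> /(_ n1) {n1}.
under eq_fun do rewrite mulr1 N0 scheme_Xbar0 /H4 !expr0n/= !mulr0 subrr add0r subr0.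
have [i4 i2 _] := H4_integrable uI (hN uI).
have [_ _ _ [iX _ _ _]] := scheme_integrable uI.
have i6 := integrable_rvZ 6 i2; have i3 := integrable_rvZ 3 iX.
rewrite (meanD (integrable_rvB i4 i6) i3) (meanB i4 i6) (meanZ _ i2) (meanZ _ iX) => e.
have i12 := integrable_rvZ (2^-1) i4; have i18 := integrable_rvZ 18 iX.
have : mean P (fun w => 6 * (N u w ^+ 2 * Xb u w)) <=
    mean P (fun w => 2^-1 * N u w ^+ 4 + 18 * Xb u w ^+ 2).
  apply: le_mean => //; first exact: integrable_rvD.
  by move=> w; have := sqr_ge0 (N u w ^+ 2 - 6 * Xb u w); lra.
rewrite (meanD i12 i18) (meanZ _ i2) (meanZ _ i4) (meanZ _ iX).
have : 0 <= mean P (fun w => Xb u w ^+ 2) by apply: mean_ge0 => w; exact: sqr_ge0.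
by lra.
Qed.

End one_direction.

Lemma fair_M : fair M.
Proof.
apply: (fair_direction B_bm mB' BB' FHl scheme_M_cell) => u uT.
by have [] := scheme_adapted4 uT.
Qed.

Lemma fair_Mperp : fair M'.
Proof.
apply: (fair_direction B'_bm mB B'B FHr scheme_Mperp_cell) => u uT.
by have [] := scheme_adapted4 uT.
Qed.

Lemma fair_M_square : fair (fun u w => M u w ^+ 2 - Xb u w).
Proof.
apply: (fair_square B_bm mB' BB' FHl scheme_M_cell) => u uT.
by have [] := scheme_adapted4 uT.
Qed.

Lemma fair_Mperp_square : fair (fun u w => M' u w ^+ 2 - Xb u w).
Proof.
apply: (fair_square B'_bm mB B'B FHr scheme_Mperp_cell) => u uT.
by have [] := scheme_adapted4 uT.
Qed.

Lemma fair_product : fair (fun u w => M u w * M' u w).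
Proof.
apply: fair_of_cells => [u uT|k s u h c kn ks su uk mh hc].
  by have [_ _ _ []] := scheme_integrable uT.
have s0 : 0 <= s := le_trans (t_ge0 (ltnW kn)) ks.
have uT : u <= T := le_trans uk (tT kn).
have sT : s <= T := le_trans (ltW su) uT.
have sI : 0 <= s <= T by rewrite s0.
have [_ _ hM hM'] := scheme_adapted4 sI.
have hs := cell_vol_adapted kn ks.
have coef f1 f2 : adapted4 s f1 -> adapted4 s f2 ->
    measurable_wrt (past s) (fun w => f1 w * f2 w * h w) /\
    integrable_rv P (fun w => f1 w * f2 w * h w).
  move=> h1 h2; split.
    case: h1 h2 => [m1 _] [m2 _]; apply: measurable_funM => //; exact: measurable_funM.
  apply: (@integrable_rv_mul_bounded _ _ _ _ _ _ c) => //.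
    have := L4_integrable_mul (past_m sT) h1 h2 (one sT) (one sT).
    by under eq_fun do rewrite !mulr1.
  by apply: measurable_wrt_measurable mh; exact: past_m.
have [m1 i1] := coef _ _ hM hs; have [m2 i2] := coef _ _ hM' hs; have [m3 i3] := coef _ _ hs hs.
have [j1 e1] := hermite1 B'_bm mB B'B s0 su uT (measurable_wrt_sub (FHr sT) m1) i1.
have [j2 e2] := hermite1 B_bm mB' BB' s0 su uT (measurable_wrt_sub (FHl sT) m2) i2.
have [j3 _] := hermite1 B'_bm mB B'B s0 su uT (measurable_wrt_sub (FHr sT) m3) i3.
(* The cross term contains both increments over the same cell. The increment of [B'] is treated as
   part of the coefficient, which is legitimate because [enlarged_past] contains the future of
   [B']. *)
have m4 : measurable_wrt (enlarged_past T B B' s)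
    (fun w => cell_vol k w * cell_vol k w * h w * (B' u w - B' s w)).
  apply: measurable_funM; first exact: (measurable_wrt_sub (FHl sT) m3).
  apply: measurable_funB; apply: enlarged_past_r; rewrite in_itv/=.
    by rewrite (le_trans s0 (ltW su)).
  by rewrite s0.
have [j4 e4] := hermite1 B_bm mB' BB' s0 su uT m4 j3.
transitivity (0 + 0 + 0 : R); last by ring.
rewrite -{1}e1 -{1}e2 -e4 -(meanD j1 j2) -(meanD (integrable_rvD j1 j2) j4).
congr mean; apply/funext => w.
by rewrite (scheme_M_cell _ kn ks (ltW su) uk) (scheme_Mperp_cell _ kn ks (ltW su) uk); ring.
Qed.

Let L4M u : 0 <= u <= T -> adapted4 u (M u). Proof. by case/scheme_adapted4. Qed.
Let L4M' u : 0 <= u <= T -> adapted4 u (M' u). Proof. by case/scheme_adapted4. Qed.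

Lemma mean_M_square u : 0 <= u <= T -> mean P (fun w => M u w ^+ 2) = mean P (Xb u).
Proof.
exact: (mean_square B_bm mB' BB' FHl scheme_M_cell L4M (scheme_M0 scheme)).
Qed.

Lemma mean_M_fourth u : 0 <= u <= T ->
  mean P (fun w => M u w ^+ 4) <= 36 * mean P (fun w => Xb u w ^+ 2).
Proof.
exact: (mean_fourth B_bm mB' BB' FHl scheme_M_cell L4M (scheme_M0 scheme)).
Qed.

Lemma mean_Mperp_fourth u : 0 <= u <= T ->
  mean P (fun w => M' u w ^+ 4) <= 36 * mean P (fun w => Xb u w ^+ 2).
Proof.
exact: (mean_fourth B'_bm mB B'B FHr scheme_Mperp_cell L4M' (scheme_Mperp0 scheme)).
Qed.

(** Orthogonality of increments, obtained by running the bracket argument for the process restarted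
    at [r]. *)
Lemma mean_M_increment (r v : R) : 0 <= r -> r <= v -> v <= T ->
  mean P (fun w => (M v w - M r w) ^+ 2) = mean P (fun w => Xb v w - Xb r w).
Proof.
move=> r0 rv vT.
have rI : 0 <= r <= T by rewrite r0 (le_trans rv).
have rT : r <= T := le_trans rv vT.
(* The maximum freezes the process at 0 before [r], so that it is defined from time 0 on and
   [fair_of_cells] applies; a cell containing [r] is cut there. *)
pose Z u w := (M (Num.max u r) w - M r w) ^+ 2 - (Xb (Num.max u r) w - Xb r w).
have hZ u : r <= u -> u <= T -> adapted4 u (fun w => M u w - M r w) /\
    adapted4 u (fun w => Xb u w - Xb r w).
  move=> ru uT; have uI : 0 <= u <= T by rewrite uT (le_trans r0).
  have [_ hXu hMu _] := scheme_adapted4 uI; have [_ hXr hMr _] := scheme_adapted4 rI.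
  have Fm := past_m uT.
  by split; apply: (L4B Fm) => //; exact: (adapted4_le ru).
have iZ u : 0 <= u <= T -> integrable_rv P (Z u).
  move=> /andP[u0 uT].
  have mT : Num.max u r <= T by rewrite ge_max uT rT.
  have mr : r <= Num.max u r by rewrite le_max lexx orbT.
  have [h1 h2] := hZ _ mr mT.
  apply: integrable_rvB; first exact: (L4_sq (past_m mT) h1).
  exact: (L4_integrable (past_m mT) h2).
have fZ : fair Z.
  apply: fair_of_cells => // k s u h c kn ks su uk mh hc.
  have s0 : 0 <= s := le_trans (t_ge0 (ltnW kn)) ks.
  have uT : u <= T := le_trans uk (tT kn).
  have [ur|ru] := leP u r.
    have -> : (fun w => (Z u w - Z s w) * h w) = fun=> 0.
      apply/funext => w; rewrite /Z (max_r ur) (max_r (le_trans (ltW su) ur)).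
      by ring.
    exact: mean_cst.
  set s' := Num.max s r.
  have rs' : r <= s' by rewrite le_max lexx orbT.
  have ss' : s <= s' by rewrite le_max lexx.
  have s'u : s' < u by rewrite gt_max su ru.
  have s'T : s' <= T := le_trans (ltW s'u) uT.
  have s'0 : 0 <= s' := le_trans s0 ss'.
  have ks' : t k <= s' := le_trans ks ss'.
  have [h1 h2] := hZ s' rs' s'T.
  have mh' := measurable_wrt_sub (past_le ss') mh.
  have := cell_bracket B_bm mB' BB' s'0 s'u uT (past_m s'T) (FHl s'T)
    (fun w => Xb s' w - Xb r w) h1 (cell_vol_adapted kn ks') mh' hc.
  move=> <-; congr mean; apply/funext => w.
  rewrite /Z -/s' (max_l (ltW ru)).
  rewrite (scheme_M_cell w kn ks' (ltW s'u) uk) (scheme_Xbar_cell w kn ks' (ltW s'u) uk).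
  by ring.
have := @fZ r v (fun=> 1) 1 r0 rv vT (measurable_cst _).
have n1 (w : Omega) : `|1 : R| <= 1 by rewrite normr1.
move=> /(_ n1) {n1}.
under eq_fun do rewrite mulr1 /Z maxxx !subrr expr0n/= !subr0 (max_l rv).
have [h1 h2] := hZ v rv vT.
rewrite (meanB (L4_sq (past_m vT) h1) (L4_integrable (past_m vT) h2)).
by move=> /eqP; rewrite subr_eq0 => /eqP.
Qed.

Lemma scheme_Xbar_mono (u v : R) w : 0 <= u -> u <= v -> v <= T -> Xb u w <= Xb v w.
Proof.
have mono k (s u' : R) : (k < n)%N -> t k <= s -> s <= u' -> u' <= t k.+1 -> Xb s w <= Xb u' w.
  move=> kn ks su uk; rewrite (scheme_Xbar_cell w kn ks su uk) lerDl.
  by rewrite mulr_ge0 ?sqr_ge0// subr_ge0.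
have gmono j k : (j <= k <= n)%N -> Xb (t j) w <= Xb (t k) w.
  move=> /andP[jk kn]; elim: k jk kn => [|k IH]; first by rewrite leqn0 => /eqP ->.
  rewrite leq_eqVlt => /predU1P[-> //|jk kn].
  exact: le_trans (IH jk (ltnW kn)) (scheme_Xbar_le w kn).
move=> u0 uv vT.
have [k kn /andP[ku uk]] : exists2 k, (k < n)%N & t k <= u <= t k.+1.
  by apply: cell_of; rewrite u0 (le_trans uv).
have [l ln /andP[lv vl]] : exists2 k, (k < n)%N & t k <= v <= t k.+1.
  by apply: cell_of; rewrite vT (le_trans u0).
have [kl|lk] := ltnP k l.
  apply: le_trans (mono _ _ _ ln (lexx _) lv vl).
  apply: le_trans (mono _ _ _ kn ku uk (lexx _)) _.
  by apply: gmono; rewrite kl ltnW.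
move: lk; rewrite leq_eqVlt => /predU1P[lk|lk].
  by apply: (mono k) => //; rewrite -lk.
have tlk : t l.+1 <= t k by apply: (grid_le t_grid); rewrite lk ltnW.
have -> : u = v by apply/eqP; rewrite eq_le uv (le_trans vl)// (le_trans tlk).
by [].
Qed.

Lemma scheme_Xbar_ge0 (u : R) w : 0 <= u <= T -> 0 <= Xb u w.
Proof. by move=> /andP[u0 uT]; rewrite -(scheme_Xbar0 w); exact: scheme_Xbar_mono. Qed.

(** * Moment bounds uniform in the grid, and a pathwise modulus of continuity *)

Section moment_bounds.
Variables (C H : R).
Hypotheses (C0 : 0 < C) (H0 : 0 < H).
Hypothesis moduli : forall (u : R) (delta : R), u \in `[0, T] -> delta \in `]0, T - u] ->
  let e := eta T n t in
  (\int[@lebesgue_measure R]_(s in `[u, (u + delta)%R])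
      (`|K (u + delta - e s)| ^+ 2)%:E <= (C * delta `^ (2 * H))%:E)%E /\
  (\int[@lebesgue_measure R]_(s in `[0%R, u])
      (`|K (u + delta - e s) - K (u - e s)| ^+ 2)%:E
    <= (C * delta `^ (2 * H))%:E)%E.
Hypothesis K_ge0 : forall s, s \in `]0, T] -> 0 <= K s.
Hypotheses (V0_gt0 : 0 < V0) (theta_gt0 : 0 < theta) (lambda_gt0 : 0 < lambda) (nu_gt0 : 0 < nu).

Let kappa := T `^ H * (C + 1).
Let Q w := weighted_sq n t (fun v => M v w).

Let sum_dt : \sum_(k < n) (t k.+1 - t k) = T.
Proof.
by rewrite -(big_mkord xpredT (fun k => t k.+1 - t k)) telescope_sumr// tn t0 subr0.
Qed.

Let dt_ge0 (k : 'I_n) : 0 <= t k.+1 - t k.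
Proof. by rewrite subr_ge0 ltW ?t_lt. Qed.

Let tsq (k : 'I_n) : t k ^+ 2 <= T ^+ 2.
Proof.
have tk0 := t_ge0 (ltnW (ltn_ord k)); have tkT := tT (ltnW (ltn_ord k)).
by rewrite lerXn2r.
Qed.

Let tI (k : 'I_n) : 0 <= t k <= T.
Proof. by rewrite t_ge0 ?tT// ltnW. Qed.

Let weighted_le (f : R -> R) (a : R) (b : nat -> R) :
  (forall k : 'I_n, f (t k) ^+ 2 <= a + b k) ->
  weighted_sq n t f <= a * T + \sum_(k < n) b k * (t k.+1 - t k).
Proof.
move=> h; rewrite -sum_dt mulr_sumr -big_split/=.
by apply: ler_sum => k _; rewrite -mulrDl ler_wpM2r.
Qed.

Let Q_ge0 w : 0 <= Q w.
Proof. by apply: sumr_ge0 => k _; rewrite mulr_ge0 ?sqr_ge0. Qed.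

(** Only an upper bound is sought, so nonnegativity of the kernel weights and of Xbar lets -lambda
    Xbar be dropped and M be replaced by its absolute value. The argument of the square root comes
    from (theta t + nu |M|)^2 <= 2 theta^2 T^2 + 2 nu^2 M^2 summed over the grid. *)
Let X_le k w : (k <= n)%N -> X (t k) w <=
  V0 * T + kappa * Num.sqrt (1 + (2 * theta ^+ 2 * T ^+ 3 + 2 * nu ^+ 2 * Q w)).
Proof.
move=> kn; have kI : 0 <= t k <= T by rewrite t_ge0 ?tT.
rewrite scheme_XE// lerD//; first by rewrite ler_wpM2l ?(ltW V0_gt0) ?tT.
pose g v := theta * v + nu * `|M v w|.
apply: (@le_trans _ _ (kernel_sum n t K (t k) g)).
  apply: ler_sum => j _; apply: ler_wpM2l.
    by apply: (kernel_weight_ge0 t_grid K_ge0) => //; exact: tT.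
  rewrite /drift /g.
  have Xb0 : 0 <= Xb (t j) w by exact: scheme_Xbar_ge0 (tI j).
  have := mulr_ge0 (ltW lambda_gt0) Xb0.
  by have := ler_wpM2l (ltW nu_gt0) (ler_norm (M (t j) w)); lra.
apply: (le_trans (ler_norm _)).
apply: (le_trans (kernel_sum_le_sqrt t_grid C0 H0 moduli g kI)).
rewrite -/kappa ler_wpM2l//; first by rewrite mulr_ge0 ?powR_ge0// addr_ge0 ?(ltW C0).
apply: ler_wsqrtr; rewrite lerD2l.
apply: (le_trans (weighted_le (a := 2 * theta ^+ 2 * T ^+ 2) (b := fun k => 2 * nu ^+ 2 * M (t k) w ^+ 2) _)).
  move=> j; rewrite /g.
  have n2 : `|M (t j) w| ^+ 2 = M (t j) w ^+ 2 by rewrite -normrX ger0_norm ?sqr_ge0.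
  have h1 := ler_wpM2l (sqr_ge0 theta) (tsq j).
  rewrite -n2; have := sqr_ge0 (theta * t j - nu * `|M (t j) w|).
  by nra.
rewrite /Q /weighted_sq mulr_sumr le_eqVlt; apply/orP; left; apply/eqP.
congr (_ + _); first by ring.
by apply: eq_bigr => j _; ring.
Qed.

(** With [Xbar_sq_coef], what results from squaring the bound [X_le] by (x + y)^2 <= 2 x^2 + 2 y^2
    and separating the part proportional to [Q]. *)
Definition Xbar_sq_cst : R := 2 * V0 ^+ 2 * T ^+ 2 + 2 * kappa ^+ 2 * (1 + 2 * theta ^+ 2 * T ^+ 3).
Definition Xbar_sq_coef : R := 4 * kappa ^+ 2 * nu ^+ 2.

Let Xbar_sq_le w : Xb T w ^+ 2 <= Xbar_sq_cst + Xbar_sq_coef * Q w.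
Proof.
set W := 1 + (2 * theta ^+ 2 * T ^+ 3 + 2 * nu ^+ 2 * Q w).
have W0 : 0 <= W.
  have p1 : 0 <= 2 * theta ^+ 2 * T ^+ 3 by rewrite mulr_ge0 ?exprn_ge0// mulr_ge0 ?sqr_ge0.
  have p2 : 0 <= 2 * nu ^+ 2 * Q w by rewrite mulr_ge0// mulr_ge0 ?sqr_ge0.
  by rewrite addr_ge0// addr_ge0.
have b : Xb T w <= V0 * T + kappa * Num.sqrt W.
  rewrite -[in Xb T w]tn (scheme_Xbar_grid scheme)//; apply: bigmax_le => [|j _].
    by apply: X_le.
  by apply: X_le; rewrite -ltnS.
have X0 : 0 <= Xb T w by rewrite scheme_Xbar_ge0 ?T_ge0 ?lexx.
have r2 : Num.sqrt W ^+ 2 = W by rewrite sqr_sqrtr.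
have : Xb T w ^+ 2 <= (V0 * T + kappa * Num.sqrt W) ^+ 2.
  by rewrite lerXn2r// nnegrE (le_trans X0).
move=> h2.
apply: (le_trans h2).
have -> : Xbar_sq_cst + Xbar_sq_coef * Q w = 2 * (V0 * T) ^+ 2 + 2 * (kappa ^+ 2 * W).
  by rewrite /Xbar_sq_cst /Xbar_sq_coef /W; ring.
have -> : kappa ^+ 2 * W = (kappa * Num.sqrt W) ^+ 2 by rewrite [RHS]exprMn r2.
exact: sqrD_le.
Qed.

Let TI : 0 <= T <= T. Proof. by rewrite T_ge0 lexx. Qed.

Let iQ : integrable_rv P Q.
Proof.
apply: integrable_rv_sum => k; under eq_fun do rewrite mulrC.
by apply: integrable_rvZ; have [_ _ _ []] := scheme_integrable (tI k).
Qed.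

(** Second moments of M are first moments of Xbar, each at most the one at [T] by monotonicity. This
    lowers the degree and closes the estimate. *)
Let mean_Q : mean P Q <= T * mean P (Xb T).
Proof.
rewrite /Q /weighted_sq mean_sum; last first.
  move=> k; under eq_fun do rewrite mulrC.
  by apply: integrable_rvZ; have [_ _ _ []] := scheme_integrable (tI k).
rewrite -[X in _ <= X * _]sum_dt mulr_suml; apply: ler_sum => k _.
under eq_fun do rewrite mulrC.
rewrite meanZ; last by have [_ _ _ []] := scheme_integrable (tI k).
apply: ler_wpM2l; first exact: dt_ge0.
rewrite mean_M_square//; apply: le_mean.
- by have [] := scheme_integrable (tI k).
- by have [] := scheme_integrable TI.
- by move=> w; apply: scheme_Xbar_mono => //; case/andP: (tI k).
Qed.

(** Writing a for [Xbar_sq_cst] and e for [Xbar_sq_coef] T + 1, this is a + e: what remains once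
    half of the mean has been absorbed in [mean_Xbar_le]. *)
Definition Xbar_mean_bound : R := Xbar_sq_cst + Xbar_sq_coef * T + 1.
Definition Xbar_sq_bound : R := Xbar_sq_cst + Xbar_sq_coef * T * Xbar_mean_bound.

Let Xbar_sq_cst_ge0 : 0 <= Xbar_sq_cst.
Proof.
have p1 : 0 <= 2 * theta ^+ 2 * T ^+ 3 by rewrite mulr_ge0 ?exprn_ge0// mulr_ge0 ?sqr_ge0.
have p2 : 0 <= 2 * kappa ^+ 2 by rewrite mulr_ge0 ?sqr_ge0.
have p3 : 0 <= 2 * V0 ^+ 2 * T ^+ 2 by rewrite mulr_ge0 ?sqr_ge0// mulr_ge0 ?sqr_ge0.
by rewrite /Xbar_sq_cst addr_ge0// mulr_ge0// addr_ge0.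
Qed.
Let Xbar_sq_coef_ge0 : 0 <= Xbar_sq_coef.
Proof. by rewrite /Xbar_sq_coef mulr_ge0 ?sqr_ge0// mulr_ge0 ?sqr_ge0. Qed.

Let mean_Xbar_sq_le : mean P (fun w => Xb T w ^+ 2) <= Xbar_sq_cst + Xbar_sq_coef * T * mean P (Xb T).
Proof.
have [_ _ _ [i2 _ _ _]] := scheme_integrable TI.
have iab := integrable_rvD (integrable_rv_cst P Xbar_sq_cst) (integrable_rvZ Xbar_sq_coef iQ).
apply: (le_trans (le_mean i2 iab Xbar_sq_le)).
rewrite (meanD (integrable_rv_cst P Xbar_sq_cst) (integrable_rvZ Xbar_sq_coef iQ)) mean_cst (meanZ _ iQ).
by rewrite lerD2l -mulrA ler_wpM2l.
Qed.

(* E Xbar^2 <= a + b E Xbar and 2 x <= x^2 / e + e with e > b give a bound on E Xbar. *)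
Lemma mean_Xbar_le u : 0 <= u <= T -> mean P (Xb u) <= Xbar_mean_bound.
Proof.
move=> /[dup] uI /andP[u0 uT].
have [i1 _ _ _] := scheme_integrable uI.
have [iT _ _ [i2 _ _ _]] := scheme_integrable TI.
apply: (@le_trans _ _ (mean P (Xb T))).
  by apply: le_mean => // w; exact: scheme_Xbar_mono.
set x := mean P (Xb T).
set e := Xbar_sq_coef * T + 1.
have e1 : 1 <= e by rewrite /e lerDr mulr_ge0.
have e0 : 0 < e := lt_le_trans ltr01 e1.
have i3 := integrable_rvD (integrable_rvZ (2 * e)^-1 i2) (integrable_rv_cst P (e / 2)).
have : x <= mean P (fun w => (2 * e)^-1 * Xb T w ^+ 2 + e / 2).
  apply: le_mean => // w.
  have := weighted_amgm (Xb T w) 1 e0; rewrite mulr1 expr1n mulr1 => /(le_trans (ler_norm _)) h.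
  apply: (le_trans h); rewrite le_eqVlt; apply/orP; left; apply/eqP.
  by field; rewrite gt_eqF.
rewrite (meanD (integrable_rvZ _ i2) (integrable_rv_cst P _)) mean_cst (meanZ _ i2).
have h : (2 * e)^-1 * mean P (fun w => Xb T w ^+ 2) <=
    (2 * e)^-1 * (Xbar_sq_cst + Xbar_sq_coef * T * x).
  by rewrite ler_wpM2l// invr_ge0 mulr_ge0 ?(ltW e0).
have be : Xbar_sq_coef * T = e - 1 by rewrite /e addrK.
have hE : (2 * e)^-1 * (Xbar_sq_cst + Xbar_sq_coef * T * x) =
    Xbar_sq_cst / (2 * e) + x / 2 - x / (2 * e).
  by rewrite be; field; rewrite gt_eqF.
rewrite hE in h.
have x0 : 0 <= x by apply: mean_ge0 => w; rewrite scheme_Xbar_ge0.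
have h2 : Xbar_sq_cst / (2 * e) <= Xbar_sq_cst / 2.
  rewrite ler_wpM2l// lef_pV2// ?posrE ?mulr_gt0//.
  by rewrite ler_pMr.
have h3 : 0 <= x / (2 * e) by rewrite divr_ge0// mulr_ge0 ?(ltW e0).
move=> h4; rewrite /Xbar_mean_bound be; lra.
Qed.

Lemma mean_Xbar_sq u : 0 <= u <= T -> mean P (fun w => Xb u w ^+ 2) <= Xbar_sq_bound.
Proof.
move=> /[dup] uI /andP[u0 uT].
have [_ _ _ [i1 _ _ _]] := scheme_integrable uI.
have [_ _ _ [i2 _ _ _]] := scheme_integrable TI.
apply: (@le_trans _ _ (mean P (fun w => Xb T w ^+ 2))).
  apply: le_mean => // w; rewrite lerXn2r// ?nnegrE ?scheme_Xbar_ge0//.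
  exact: scheme_Xbar_mono.
apply: (le_trans mean_Xbar_sq_le).
rewrite /Xbar_sq_bound lerD2l; apply: ler_wpM2l; first by rewrite mulr_ge0.
exact: mean_Xbar_le.
Qed.

(** The random factor of the modulus of X: [C] plus the time integral of the squared drift. The
    extra 1 lets it also dominate the deterministic part [V0] delta of [modulus]. *)
Definition holder_const w : R := 1 + C + weighted_sq n t (drift w).
Definition modulus (delta : R) : R := V0 * delta + delta `^ H.

Lemma holder_const_ge1 w : 1 <= holder_const w.
Proof.
rewrite /holder_const -addrA lerDl addr_ge0 ?(ltW C0)//.
by apply: sumr_ge0 => k _; rewrite mulr_ge0 ?sqr_ge0.
Qed.

Lemma modulus_ge0 (x : R) : 0 <= x -> 0 <= modulus x.
Proof. by move=> x0; rewrite addr_ge0 ?powR_ge0// mulr_ge0 ?(ltW V0_gt0). Qed.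

Lemma modulus_le (x y : R) : 0 <= x -> x <= y -> modulus x <= modulus y.
Proof.
move=> x0 xy; rewrite lerD//; first by rewrite ler_wpM2l ?(ltW V0_gt0).
by rewrite ge0_ler_powR ?nnegrE ?(ltW H0)// (le_trans x0).
Qed.

Let holder_integrable : integrable_rv P holder_const.
Proof.
apply: integrable_rvD; first exact: integrable_rv_cst.
apply: integrable_rv_sum => k; under eq_fun do rewrite mulrC.
apply: integrable_rvZ.
have [_ hX hM _] := scheme_adapted4 (tI k).
have Fm := past_m (tT (ltnW (ltn_ord k))).
apply: (L4_sq Fm); apply: (L4D Fm); last exact: L4Z.
by apply: (L4B Fm); [exact: L4_cst|exact: L4Z].
Qed.

Definition holder_mean_bound : R := 1 + C + (3 * theta ^+ 2 * T ^+ 3 + 3 * lambda ^+ 2 * T * Xbar_sq_bound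
   + 3 * nu ^+ 2 * T * Xbar_mean_bound).

Lemma holder_const_mean : integrable_rv P holder_const /\ mean P holder_const <= holder_mean_bound.
Proof.
split; first exact: holder_integrable.
have [iT _ _ [i2 _ _ _]] := scheme_integrable TI.
have j1 := integrable_rvZ (3 * lambda ^+ 2 * T) i2.
have j2 := integrable_rvZ (3 * nu ^+ 2) iQ.
have j0 := integrable_rv_cst P (1 + C + 3 * theta ^+ 2 * T ^+ 3).
apply: (@le_trans _ _ (mean P (fun w => (1 + C + 3 * theta ^+ 2 * T ^+ 3) +
    (3 * lambda ^+ 2 * T * Xb T w ^+ 2 + 3 * nu ^+ 2 * Q w)))).
  apply: le_mean; first exact: holder_integrable.
    by apply: integrable_rvD => //; exact: integrable_rvD.
  move=> w; rewrite /holder_const -[leRHS]addrA lerD2l.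
  apply: (le_trans (weighted_le (a := 3 * theta ^+ 2 * T ^+ 2 + 3 * lambda ^+ 2 * Xb T w ^+ 2)
     (b := fun k => 3 * nu ^+ 2 * M (t k) w ^+ 2) _)).
    move=> k; rewrite /drift.
    have h1 := ler_wpM2l (sqr_ge0 theta) (tsq k).
    have h2 : lambda ^+ 2 * Xb (t k) w ^+ 2 <= lambda ^+ 2 * Xb T w ^+ 2.
      rewrite ler_wpM2l ?sqr_ge0// lerXn2r// ?nnegrE ?scheme_Xbar_ge0//.
      by apply: scheme_Xbar_mono => //; case/andP: (tI k).
    apply: (le_trans (sqrD3_le _ _ _)); rewrite !exprMn.
    by lra.
  rewrite /Q /weighted_sq mulr_sumr mulrDl -addrA le_eqVlt; apply/orP; left; apply/eqP.
  congr (_ + (_ + _)); [by ring|by ring|].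
  by apply: eq_bigr => k _; ring.
rewrite (meanD j0 (integrable_rvD j1 j2)) (meanD j1 j2) mean_cst (meanZ _ i2) (meanZ _ iQ).
rewrite /holder_mean_bound -[leRHS]addrA -!addrA !lerD2l lerD//.
  by rewrite ler_wpM2l ?mean_Xbar_sq// mulr_ge0// mulr_ge0// sqr_ge0.
rewrite -[leRHS]mulrA; apply: ler_wpM2l; first by rewrite mulr_ge0 ?sqr_ge0.
by apply: (le_trans mean_Q); rewrite ler_wpM2l// mean_Xbar_le.
Qed.

Lemma X_holder (u v : R) w : 0 <= u -> u <= v -> v <= T ->
  `|X v w - X u w| <= modulus (v - u) * holder_const w.
Proof.
move=> u0 uv vT; rewrite !scheme_XE ?vT ?u0 ?(le_trans uv) ?(le_trans u0)//.
have -> : V0 * v + kernel_sum n t K v (drift w) - (V0 * u + kernel_sum n t K u (drift w)) =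
   V0 * (v - u) + (kernel_sum n t K v (drift w) - kernel_sum n t K u (drift w)) by ring.
apply: (le_trans (ler_normD _ _)); rewrite /modulus mulrDl lerD//.
  rewrite ger0_norm; last by rewrite mulr_ge0 ?subr_ge0 ?(ltW V0_gt0).
  by rewrite ler_peMr ?holder_const_ge1// mulr_ge0 ?subr_ge0 ?(ltW V0_gt0).
apply: (le_trans (kernel_sum_holder t_grid C0 moduli (drift w) u0 uv vT)).
by rewrite ler_wpM2l ?powR_ge0// /holder_const lerD2r lerDr.
Qed.

Let mesh_ge0 : 0 <= mesh n t.
Proof. by rewrite /mesh; elim/big_rec : _ => // i x _ x0; rewrite le_max x0 orbT. Qed.

(** At the grid time to the left of [s] domination holds by construction; the rest is the modulus of
    X over at most one mesh. *)
Lemma X_le_Xbar (s u : R) w : 0 <= s -> s <= u -> u <= T ->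
  X s w <= Xb u w + modulus (mesh n t) * holder_const w.
Proof.
move=> s0 su uT.
have sI : 0 <= s <= T by rewrite s0 (le_trans su).
have [k kn /andP[ks sk]] := cell_of sI.
have h1 : X s w <= X (t k) w + modulus (s - t k) * holder_const w.
  rewrite -lerBlDl; apply: le_trans (ler_norm _) (X_holder w _ ks _).
    exact: t_ge0 (ltnW kn).
  by case/andP: sI.
have h2 : X (t k) w <= Xb (t k) w.
  rewrite (scheme_Xbar_grid scheme) ?(ltnW kn)//.
  exact: (le_bigmax _ (fun j : 'I_k.+1 => X (t j) w) ord_max).
have h3 : Xb (t k) w <= Xb u w.
  by apply: scheme_Xbar_mono => //; [exact: t_ge0 (ltnW kn)|exact: le_trans su].
have h4 : modulus (s - t k) * holder_const w <= modulus (mesh n t) * holder_const w.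
  rewrite ler_wpM2r ?(le_trans ler01 (holder_const_ge1 w))//.
  apply: modulus_le; first by rewrite subr_ge0.
  by apply: le_trans (mesh_ge t kn); rewrite lerD2r.
by lra.
Qed.

(** Rounding [u] down and [v] up to the grid costs two meshes. A grid maximum exceeding the one at
    the rounded [u] is attained later, and X cannot have moved there by more than its modulus. *)
Lemma Xbar_increment (u v : R) w : 0 <= u -> u <= v -> v <= T ->
  Xb v w - Xb u w <= modulus (v - u + 2 * mesh n t) * holder_const w.
Proof.
move=> u0 uv vT.
have [k kn /andP[ku uk]] : exists2 k, (k < n)%N & t k <= u <= t k.+1.
  by apply: cell_of; rewrite u0 (le_trans uv).
have [l ln /andP[lv vl]] : exists2 k, (k < n)%N & t k <= v <= t k.+1.
  by apply: cell_of; rewrite vT (le_trans u0).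
have h1 : Xb v w <= Xb (t l.+1) w.
  by apply: scheme_Xbar_mono => //; [exact: le_trans uv|exact: tT].
have h2 : Xb (t k) w <= Xb u w.
  by apply: scheme_Xbar_mono => //; [exact: t_ge0 (ltnW kn)|exact: le_trans vT].
have hc0 := le_trans ler01 (holder_const_ge1 w).
have d0 : 0 <= v - u + 2 * mesh n t by rewrite addr_ge0 ?subr_ge0// mulr_ge0.
have m0 : 0 <= modulus (v - u + 2 * mesh n t) * holder_const w.
  by rewrite mulr_ge0// modulus_ge0.
suff : Xb (t l.+1) w <= Xb (t k) w + modulus (v - u + 2 * mesh n t) * holder_const w by lra.
have XXb j : (j <= k)%N -> X (t j) w <= Xb (t k) w.
  move=> jk; rewrite (scheme_Xbar_grid scheme) ?(ltnW kn)//.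
  exact: (le_bigmax _ (fun j : 'I_k.+1 => X (t j) w) (Ordinal (jk : (j < k.+1)%N))).
rewrite [leLHS](scheme_Xbar_grid scheme) //; apply: bigmax_le => [|j _].
  by have := XXb 0%N isT; lra.
have [jk|kj] := leqP j k; first by have := XXb _ jk; lra.
have jn : (j <= n)%N by rewrite (leq_trans _ ln)// -ltnS.
have tkj : t k <= t j by apply: (grid_le t_grid); rewrite jn (ltnW kj).
have h : X (t j) w <= X (t k) w + modulus (t j - t k) * holder_const w.
  rewrite -lerBlDl; apply: le_trans (ler_norm _) (X_holder w _ tkj _).
    exact: t_ge0 (ltnW kn).
  exact: tT.
have h' : modulus (t j - t k) * holder_const w <=
    modulus (v - u + 2 * mesh n t) * holder_const w.
  rewrite ler_wpM2r//; apply: modulus_le; first by rewrite subr_ge0.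
  have m1 := mesh_ge t kn; have m2 := mesh_ge t ln.
  have tjl : t j <= t l.+1 by apply: (grid_le t_grid); rewrite -ltnS ltn_ord ln.
  by lra.
by have := XXb _ (leqnn k); lra.
Qed.

(** The comparison times depend on [m] and [u] but not on the grid, so the right-hand maximum is the
    same functional of finitely many times for every [n]. Each grid time that matters is within u /
    (m + 1) plus a mesh of one of them. *)
Lemma Xbar_le_max (u : R) (m : nat) w : 0 <= u <= T ->
  Xb u w <= \big[Num.max/X 0 w]_(i < m.+2) X (u * (i%:R / m.+1%:R)) w
    + modulus (u / m.+1%:R + mesh n t) * holder_const w.
Proof.
move=> /[dup] uI /andP[u0 uT].
have [l ln /andP[lu ul]] := cell_of uI.
set mx := \big[Num.max/_]_(i < m.+2) _.
have hc0 := le_trans ler01 (holder_const_ge1 w).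
have m1 : 0 < m.+1%:R :> R by rewrite ltr0n.
have um0 : 0 <= u / m.+1%:R by rewrite divr_ge0 ?(ltW m1).
apply: (@le_trans _ _ (Xb (t l.+1) w)).
  by apply: scheme_Xbar_mono => //; exact: tT.
have pt i : (i < m.+2)%N -> 0 <= u * (i%:R / m.+1%:R) <= u.
  move=> im; rewrite mulr_ge0 ?divr_ge0 ?ler0n ?(ltW m1)//=.
  by rewrite ler_piMr// ler_pdivrMr// mul1r ler_nat.
have cmp (x : R) i : (i < m.+2)%N -> 0 <= x <= T ->
    `|x - u * (i%:R / m.+1%:R)| <= u / m.+1%:R + mesh n t ->
    X x w <= mx + modulus (u / m.+1%:R + mesh n t) * holder_const w.
  move=> im /andP[x0 xT] xi.
  set y := u * (i%:R / m.+1%:R) in xi *.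
  have /andP[y0 yu] := pt _ im; rewrite -/y in y0 yu.
  have ymx : X y w <= mx.
    exact: (le_bigmax _ (fun i : 'I_m.+2 => X (u * (i%:R / m.+1%:R)) w) (Ordinal im)).
  suff : X x w - X y w <= modulus (u / m.+1%:R + mesh n t) * holder_const w by lra.
  apply: (le_trans (ler_norm _)).
  have [xy|yx] := leP x y.
    rewrite distrC; apply: (le_trans (X_holder w x0 xy (le_trans yu uT))).
    rewrite ler_wpM2r//; apply: modulus_le; first by rewrite subr_ge0.
    by apply: le_trans xi; rewrite distrC ler_norm.
  apply: (le_trans (X_holder w y0 (ltW yx) xT)).
  rewrite ler_wpM2r//; apply: modulus_le; first by rewrite subr_ge0 ltW.
  exact: le_trans (ler_norm _) xi.
have ev j : (j <= l.+1)%N -> X (t j) w <=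
    mx + modulus (u / m.+1%:R + mesh n t) * holder_const w.
  move=> jl; have jn : (j <= n)%N := leq_trans jl ln.
  have tjl : t j <= t l.+1 by apply: (grid_le t_grid); rewrite jl ln.
  have ml := mesh_ge t ln.
  have [uj|ju] := leP u (t j).
    (* The cell containing [u] may end after [u]: its end point is compared with [u] itself, the
       last of the [m.+2] times. *)
    apply: (cmp _ m.+1) => //; first by rewrite t_ge0 ?tT.
    rewrite divff ?gt_eqF// mulr1 ger0_norm ?subr_ge0//.
    apply: (@le_trans _ _ (mesh n t)); last by rewrite lerDr.
    by apply: le_trans ml; exact: lerB.
  have tj0 := t_ge0 jn.
  have up : 0 < u := le_lt_trans tj0 ju.
  pose i := Num.trunc (t j / u * m.+1%:R).
  have q0 : 0 <= t j / u * m.+1%:R by rewrite mulr_ge0 ?divr_ge0 ?(ltW m1)// ltW.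
  have /andP[i1 i2] := truncn_itv q0.
  have q1 : t j / u * m.+1%:R <= m.+1%:R.
    by rewrite ler_piMl ?(ltW m1)// ler_pdivrMr// mul1r ltW.
  have im : (i < m.+2)%N by rewrite ltnS -(ler_nat R); exact: le_trans i1 q1.
  apply: (cmp _ i) => //; first by rewrite tj0 tT.
  have e : t j = u * (t j / u * m.+1%:R / m.+1%:R) by field; rewrite !gt_eqF.
  rewrite e -mulrBr -mulrBl normrM (gtr0_norm up) normrM [X in _ * (_ * X)]ger0_norm ?invr_ge0 ?(ltW m1)//.
  apply: (@le_trans _ _ (u * (1 / m.+1%:R))); last by rewrite div1r lerDl.
  rewrite ler_pM2l// ler_pM2r ?invr_gt0//.
  rewrite ger0_norm; last by rewrite subr_ge0.
  by rewrite lerBlDl natr1; exact: ltW.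
rewrite (scheme_Xbar_grid scheme)//; apply: bigmax_le => [|j _].
  exact: (ev 0%N isT).
by apply: ev; rewrite -ltnS.
Qed.

(** From |M| <= 1 + M^2 and E M^2 = E Xbar. *)
Definition drift_bound : R := theta * T + lambda * Xbar_mean_bound + nu * (1 + Xbar_mean_bound).

Lemma drift_integrable u : 0 <= u <= T -> integrable_rv P (fun w => drift w u).
Proof.
move=> uT; have [iX iM _ _] := scheme_integrable uT.
apply: integrable_rvD; last exact: integrable_rvZ.
by apply: integrable_rvB; [exact: integrable_rv_cst|exact: integrable_rvZ].
Qed.

Lemma mean_drift_le u : 0 <= u <= T -> mean P (fun w => `|drift w u|) <= drift_bound.
Proof.
move=> /[dup] uI /andP[u0 uT]; have [iX iM _ [_ iM2 _ _]] := scheme_integrable uI.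
have j1 := integrable_rvZ lambda iX.
have j2 := integrable_rvZ nu (integrable_rvD (integrable_rv_cst P 1) iM2).
have j3 := integrable_rvD (integrable_rv_cst P (theta * T)) (integrable_rvD j1 j2).
apply: (@le_trans _ _ (mean P (fun w => theta * T + (lambda * Xb u w + nu * (1 + M u w ^+ 2))))).
  apply: le_mean => //; first exact: integrable_rv_norm (drift_integrable uI).
  move=> w; rewrite /drift addrA; apply: (le_trans (ler_normD _ _)); rewrite lerD//.
    apply: (le_trans (ler_normB _ _)); rewrite lerD//.
      by rewrite normrM !ger0_norm ?(ltW theta_gt0)// ler_wpM2l ?(ltW theta_gt0).
    by rewrite normrM !ger0_norm ?(ltW lambda_gt0)// scheme_Xbar_ge0.
  rewrite normrM (gtr0_norm nu_gt0) ler_wpM2l ?(ltW nu_gt0)//.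
  have := weighted_amgm (M u w) 1 ltr01; rewrite mulr1 divr1 expr1n mulr1 => /le_trans; apply.
  by have := sqr_ge0 (M u w); lra.
rewrite (meanD (integrable_rv_cst P _) (integrable_rvD j1 j2)) mean_cst (meanD j1 j2).
rewrite (meanZ _ iX) (meanZ _ (integrable_rvD (integrable_rv_cst P 1) iM2)).
rewrite (meanD (integrable_rv_cst P 1) iM2) mean_cst mean_M_square//.
have b := mean_Xbar_le uI.
rewrite /drift_bound -addrA lerD2l lerD//; first by rewrite ler_wpM2l// ltW.
by rewrite ler_wpM2l ?lerD2l// ltW.
Qed.

(* E |M_v - M_u| is at most e + E |M_v - M_u|^2 / e for every e > 0, and the second
   moment is E (Xbar_v - Xbar_u). *)
Definition drift_modulus (delta e : R) : R :=
  theta * delta + lambda * (modulus delta * holder_mean_bound) + nu * (e + modulus delta * holder_mean_bound / e).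

Lemma holder_mean_bound_ge0 : 0 <= holder_mean_bound.
Proof.
have [i le3] := holder_const_mean; apply: le_trans le3; apply: mean_ge0 => w.
exact: le_trans ler01 (holder_const_ge1 w).
Qed.

Lemma drift_modulus_le (delta delta' e : R) : 0 <= delta -> delta <= delta' -> 0 < e ->
  drift_modulus delta e <= drift_modulus delta' e.
Proof.
move=> d0 dd e0; have m := modulus_le d0 dd; have b3 := holder_mean_bound_ge0.
rewrite /drift_modulus lerD//; first rewrite lerD//.
- by rewrite ler_wpM2l// ltW.
- by rewrite ler_wpM2l ?(ltW lambda_gt0)// ler_wpM2r.
- by rewrite ler_wpM2l ?(ltW nu_gt0)// lerD2l ler_wpM2r ?invr_ge0 ?(ltW e0)// ler_wpM2r.
Qed.

Let mean_drift_increment0 (u v e : R) : 0 <= u -> u <= v -> v <= T -> 0 < e ->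
  mean P (fun w => `|drift w v - drift w u|) <= drift_modulus (v - u + 2 * mesh n t) e.
Proof.
move=> u0 uv vT e0.
have uI : 0 <= u <= T by rewrite u0 (le_trans uv).
have vI : 0 <= v <= T by rewrite vT (le_trans u0).
set dl := v - u + 2 * mesh n t.
have dl0 : v - u <= dl by rewrite lerDl mulr_ge0.
have [iXu iMu _ [_ iMu2 _ _]] := scheme_integrable uI.
have [iXv iMv _ [_ iMv2 _ _]] := scheme_integrable vI.
have iX := integrable_rvB iXv iXu.
have iM2 : integrable_rv P (fun w => (M v w - M u w) ^+ 2).
  have [_ _ hv _] := scheme_adapted4 vI.
  have [_ _ hu _] := scheme_adapted4 uI.
  by apply: (L4_sq (past_m vT)); apply: (L4B (past_m vT)) => //; exact: adapted4_le hu.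
have Xle : mean P (fun w => Xb v w - Xb u w) <= modulus dl * holder_mean_bound.
  have [ih lh] := holder_const_mean.
  apply: (@le_trans _ _ (mean P (fun w => modulus dl * holder_const w))).
    apply: le_mean => //; first exact: integrable_rvZ.
    by move=> w; exact: Xbar_increment.
  rewrite (meanZ _ ih) ler_wpM2l// modulus_ge0//.
  by rewrite addr_ge0 ?subr_ge0// mulr_ge0.
have j1 := integrable_rvZ lambda iX.
have j2 := integrable_rvD (integrable_rv_cst P e) (integrable_rvZ e^-1 iM2).
have j3 := integrable_rvD (integrable_rv_cst P (theta * dl)) (integrable_rvD j1 (integrable_rvZ nu j2)).
apply: (@le_trans _ _ (mean P (fun w => theta * dl +
    (lambda * (Xb v w - Xb u w) + nu * (e + e^-1 * (M v w - M u w) ^+ 2))))).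
  apply: le_mean => //.
    by apply: integrable_rv_norm; apply: integrable_rvB; exact: drift_integrable.
  move=> w; have -> : drift w v - drift w u = theta * (v - u) - lambda * (Xb v w - Xb u w)
      + nu * (M v w - M u w) by rewrite /drift; ring.
  rewrite addrA; apply: (le_trans (ler_normD _ _)); rewrite lerD//.
    apply: (le_trans (ler_normB _ _)); rewrite lerD//.
      rewrite normrM (gtr0_norm theta_gt0) ler_wpM2l ?(ltW theta_gt0)//.
      by rewrite ger0_norm ?subr_ge0.
    by rewrite normrM (gtr0_norm lambda_gt0) ger0_norm ?subr_ge0 ?scheme_Xbar_mono.
  rewrite normrM (gtr0_norm nu_gt0) ler_wpM2l ?(ltW nu_gt0)//.
  have := weighted_amgm (M v w - M u w) 1 e0; rewrite mulr1 expr1n mulr1 => /le_trans; apply.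
  have : 0 <= (M v w - M u w) ^+ 2 / e by rewrite divr_ge0 ?sqr_ge0 ?ltW.
  by rewrite [_ / e]mulrC; lra.
rewrite (meanD (integrable_rv_cst P _) (integrable_rvD j1 (integrable_rvZ nu j2))) mean_cst.
rewrite (meanD j1 (integrable_rvZ nu j2)) (meanZ _ iX) (meanZ _ j2).
rewrite (meanD (integrable_rv_cst P e) (integrable_rvZ _ iM2)) mean_cst (meanZ _ iM2).
rewrite mean_M_increment// /drift_modulus -/dl -addrA lerD2l lerD//.
  by rewrite ler_wpM2l// ltW.
rewrite ler_wpM2l ?(ltW nu_gt0)// lerD2l mulrC ler_wpM2r ?invr_ge0 ?(ltW e0)//.
Qed.

Lemma mean_drift_increment (u v delta e : R) : 0 <= u <= T -> 0 <= v <= T -> 0 < e ->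
  `|v - u| <= delta ->
  mean P (fun w => `|drift w v - drift w u|) <= drift_modulus (delta + 2 * mesh n t) e.
Proof.
move=> uI vI e0.
wlog uv : u v uI vI / u <= v.
  move=> H1; have [|vu] := leP u v; first exact: H1.
  by rewrite distrC; under eq_fun do rewrite distrC; apply: H1 => //; exact: ltW.
rewrite ger0_norm ?subr_ge0// => uvd.
have [u0 _] := andP uI; have [_ vT] := andP vI.
apply: (le_trans (mean_drift_increment0 u0 uv vT e0)).
apply: drift_modulus_le => //; last by rewrite lerD2r.
by rewrite addr_ge0 ?subr_ge0// mulr_ge0.
Qed.

End moment_bounds.

End scheme.

(** * Limits in law of cylinder functionals *)

Section cylinder.
Context {R : realType}.
Local Notation state := (R * R * R * R * R)%type.

(* A state is (X, Xbar, S, M, Mperp). *)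
Definition component (i : nat) (e : state) : R :=
  match i with
  | 0 => e.1.1.1.1 | 1 => e.1.1.1.2 | 2 => e.1.1.2 | 3 => e.1.2 | _ => e.2
  end.

Lemma component_continuous i : continuous (component i).
Proof.
have fstc (U V : topologicalType) (x : U * V) : fst y @[y --> x] --> x.1 by exact: cvg_fst.
have sndc (U V : topologicalType) (x : U * V) : snd y @[y --> x] --> x.2 by exact: cvg_snd.
case: i => [|[|[|[|i]]]] x /=.
- apply: (cvg_comp (fun e : state => e.1.1.1) fst); last exact: fstc.
  apply: (cvg_comp (fun e : state => e.1.1) fst); last exact: fstc.
  by apply: (cvg_comp (fun e : state => e.1) fst); exact: fstc.
- apply: (cvg_comp (fun e : state => e.1.1.1) snd); last exact: sndc.
  apply: (cvg_comp (fun e : state => e.1.1) fst); last exact: fstc.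
  by apply: (cvg_comp (fun e : state => e.1) fst); exact: fstc.
- apply: (cvg_comp (fun e : state => e.1.1) snd); last exact: sndc.
  by apply: (cvg_comp (fun e : state => e.1) fst); exact: fstc.
- by apply: (cvg_comp (fun e : state => e.1) snd); [exact: fstc|exact: sndc].
- exact: sndc.
Qed.

(** An inductive class, so that continuity for the uniform topology, measurability and adaptedness
    at [s] all follow by induction. Its members are defined on all functions, with no continuity
    required of the path. *)
Inductive cylinder (s : R) : ((R -> state) -> R) -> Prop :=
| cylinder_component i u : 0 <= u <= s -> cylinder s (fun f => component i (f u))
| cylinderD F G : cylinder s F -> cylinder s G -> cylinder s (fun f => F f + G f)
| cylinderM F G : cylinder s F -> cylinder s G -> cylinder s (fun f => F f * G f)
| cylinder_comp F (g : R -> R) : continuous g -> cylinder s F -> cylinder s (fun f => g (F f)).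

Lemma cylinder_cst s c : 0 <= s -> cylinder s (fun=> c).
Proof.
move=> s0; apply: (@cylinder_comp s (fun f => component 0 (f 0)) (fun=> c)).
  exact: cst_continuous.
by apply: (@cylinder_component s 0 0); rewrite lexx.
Qed.

Lemma cylinderZ s c F : cylinder s F -> cylinder s (fun f => c * F f).
Proof. by apply: (@cylinder_comp _ _ (fun x => c * x)); exact: mulrl_continuous. Qed.

Lemma cylinderB s F G : cylinder s F -> cylinder s G -> cylinder s (fun f => F f - G f).
Proof.
move=> hF hG; apply: cylinderD => //.
by apply: (@cylinder_comp _ _ -%R) => //; exact: opp_continuous.
Qed.

Lemma cylinder_sum s (n : nat) (F : nat -> (R -> state) -> R) : 0 <= s ->
  (forall i, (i < n)%N -> cylinder s (F i)) -> cylinder s (fun f => \sum_(i < n) F i f).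
Proof.
move=> s0; elim: n => [|n IH] hF.
  by under eq_fun do rewrite big_ord0; exact: cylinder_cst.
under eq_fun do rewrite big_ord_recr/=.
by apply: cylinderD; [apply: IH => i /ltnW iN; exact: hF|exact: hF].
Qed.

Lemma cylinder_norm s F : cylinder s F -> cylinder s (fun f => `|F f|).
Proof. by apply: cylinder_comp => x; exact: norm_continuous. Qed.

Lemma cylinder_max s F G : cylinder s F -> cylinder s G ->
  cylinder s (fun f => Num.max (F f) (G f)).
Proof.
move=> hF hG.
have -> : (fun f => Num.max (F f) (G f)) =
    fun f => 2^-1 * ((F f + G f) + `|F f - G f|).
  by apply/funext => f; rewrite maxr_absE mulrC.
apply: cylinderZ; apply: cylinderD; first exact: cylinderD.
by apply: cylinder_norm; exact: cylinderB.
Qed.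

Lemma cylinder_bigmax s (n : nat) (F : nat -> (R -> state) -> R) G : cylinder s G ->
  (forall i, (i < n)%N -> cylinder s (F i)) ->
  cylinder s (fun f => \big[Num.max/G f]_(i < n) F i f).
Proof.
move=> hG; elim: n F => [|n IH] F hF.
  by under eq_fun do rewrite big_ord0.
under eq_fun do rewrite big_ord_recl/=.
by apply: cylinder_max; [exact: hF|apply: (IH (fun i => F i.+1)) => i iN; exact: hF].
Qed.

Lemma cylinder_continuous s T F : s <= T -> cylinder s F ->
  continuous (F : {uniform` `[0, T] -> state} -> R).
Proof.
move=> sT; elim => {F} [i u us|F G _ hF _ hG|F G _ hF _ hG|F g cg _ hF] f.
- apply: (@cvg_comp _ _ _ (fun h : {uniform` `[0, T] -> state} => (h : R -> state) u)
    (component i) _ (nbhs (f u))); last exact: component_continuous.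
  move=> A; rewrite -(@nbhs_entourageE state) => -[E entE EA].
  apply/uniform_nbhs; exists E; split=> // h hE; apply: EA => /=; apply/xsectionP; apply: hE.
  by move: us; rewrite /= in_itv/= => /andP[-> /le_trans ->].
- exact: (cvgD (hF f) (hG f)).
- exact: (cvgM (hF f) (hG f)).
- exact: (cvg_comp _ _ (hF f) (cg (F f))).
Qed.

Lemma cylinder_measurable {d} {Omega : measurableType d} (s : R) (Z : R -> Omega -> state) F :
  (forall i (u : R), 0 <= u <= s -> measurable_fun setT (fun w => component i (Z u w))) ->
  cylinder s F -> measurable_fun setT (fun w => F (Z ^~ w)).
Proof.
move=> mZ; elim => {F} [i u us|F G _ hF _ hG|F G _ hF _ hG|F g cg _ hF].
- exact: mZ.
- exact: measurable_funD.
- exact: measurable_funM.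
- by apply: measurableT_comp => //; exact: continuous_measurable_fun.
Qed.

Lemma cylinder_le s s' F : s <= s' -> cylinder s F -> cylinder s' F.
Proof.
move=> ss'; elim => {F} [i u /andP[u0 us]|F G _ hF _ hG|F G _ hF _ hG|F g cg _ hF].
- by apply: cylinder_component; rewrite u0 (le_trans us).
- exact: cylinderD.
- exact: cylinderM.
- exact: cylinder_comp.
Qed.

End cylinder.

Lemma integrable_rv_of_bounded {R : realType} {d} {O : measurableType d} (Q : probability O R) (f : O -> R) c :
  measurable_fun setT f -> (forall w, `|f w| <= c) -> integrable_rv Q f.
Proof. by move=> mf fc; apply: integrable_rv_dom (integrable_rv_cst Q c) fc. Qed.

Section clip.
Context {R : realType}.
Implicit Types k x : R.

Definition clip (k x : R) : R := Num.max (- k) (Num.min x k).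

Lemma clip_bound k x : 0 <= k -> `|clip k x| <= k.
Proof.
move=> k0; rewrite /clip ler_norml le_max lexx/= ge_max ge_min lexx orbT andbT.
by rewrite lerNl (le_trans _ k0)// oppr_le0.
Qed.

Lemma clip_id k x : `|x| <= k -> clip k x = x.
Proof.
by rewrite ler_norml => /andP[h1 h2]; rewrite /clip min_l// max_r.
Qed.

(** Where clipping acts, the error is at most |x| and |x| > k. Uniformly bounded second moments
    therefore make the mean error of order 1 / k. *)
Lemma clip_error k x : 0 < k -> `|x - clip k x| <= x ^+ 2 / k.
Proof.
move=> k0; have [xk|kx] := leP `|x| k.
  by rewrite (clip_id xk) subrr normr0 divr_ge0 ?sqr_ge0 ?ltW.
apply: (@le_trans _ _ `|x|).
  rewrite /clip; case: (lerP 0 x) => x0.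
    rewrite ger0_norm// in kx; rewrite min_r ?(ltW kx)// max_r; last by lra.
    by rewrite !ger0_norm ?subr_ge0 ?(ltW kx)//; lra.
  rewrite ltr0_norm// in kx; rewrite min_l; last by lra.
  rewrite max_l; last by lra.
  by rewrite opprK !ler0_norm; lra.
by rewrite ler_pdivlMr// -[x ^+ 2]real_normK ?num_real// expr2 ler_wpM2l// ltW.
Qed.

Lemma clip_continuous k : continuous (clip k).
Proof.
rewrite (_ : clip k = (cst (- k) : R -> R^o) \max ((idfun : R -> R^o) \min cst k))// => x.
apply: continuous_max; first exact: cst_continuous.
by apply: continuous_min; [exact: cvg_id|exact: cst_continuous].
Qed.

End clip.

Section weak_limit.
Context {R : realType} {d d'} {Omega : measurableType d} {Omega' : measurableType d'}.
Variables (P : probability Omega R) (P' : probability Omega' R) (T : R).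
Local Notation state := (R * R * R * R * R)%type.
Variables (Z_ : nat -> R -> Omega -> state) (Z : R -> Omega' -> state).
Hypothesis T_ge0 : 0 <= T.
Hypothesis mZ_ : forall n i (u : R), 0 <= u <= T -> measurable_fun setT (fun w => component i (Z_ n u w)).
Hypothesis mZ : forall i (u : R), 0 <= u <= T -> measurable_fun setT (fun w => component i (Z u w)).
Hypothesis law : cvg_in_law P P' T Z_ Z.

Lemma cvg_mean_bounded F c : cylinder T F -> (forall f, `|F f| <= c) ->
  mean P (fun w => F (Z_ n ^~ w)) @[n --> \oo] --> mean P' (fun w => F (Z ^~ w)).
Proof.
move=> cF Fc.
have cF' := cylinder_continuous (lexx T) cF.
have := law (F := F) (continuous_subspaceT cF').
move=> /(_ (ex_intro _ c (fun f _ => Fc f))).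
have i : integrable_rv P' (fun w => F (Z ^~ w)).
  exact: (integrable_rv_of_bounded P' (cylinder_measurable mZ cF) (fun w => Fc _)).
have i_ n : integrable_rv P (fun w => F (Z_ n ^~ w)).
  exact: (integrable_rv_of_bounded P (cylinder_measurable (mZ_ n) cF) (fun w => Fc _)).
rewrite unlock (meanE i).
under eq_fun do rewrite (meanE (i_ _)).
by move/fine_cvgP => [_].
Qed.

(** A Fatou property in law: min(G^2, k) is a bounded continuous functional, so its limiting mean is
    at most [C]; monotone convergence in k concludes. *)
Lemma lim_square G C : cylinder T G ->
  (\forall n \near \oo, integrable_rv P (fun w => G (Z_ n ^~ w) ^+ 2) /\
     mean P (fun w => G (Z_ n ^~ w) ^+ 2) <= C) ->
  integrable_rv P' (fun w => G (Z ^~ w) ^+ 2) /\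
  mean P' (fun w => G (Z ^~ w) ^+ 2) <= C.
Proof.
move=> cG GC.
have mG := cylinder_measurable mZ cG.
pose m k f : R := Num.min (G f ^+ 2) k%:R.
have m0 k f : 0 <= m k f by rewrite /m le_min sqr_ge0 ler0n.
have mb k f : `|m k f| <= k%:R by rewrite ger0_norm// /m ge_min lexx orbT.
have cm k : cylinder T (m k).
  (* The minimum is written as minus a maximum in order to reuse [cylinder_max]. *)
  have -> : m k = fun f => - Num.max (-1 * (G f * G f)) (- k%:R).
    by apply/funext => f; rewrite mulN1r -oppr_min opprK /m expr2.
  apply: (@cylinder_comp _ _ _ -%R); first exact: opp_continuous.
  apply: cylinder_max; last exact: cylinder_cst.
  by apply: cylinderZ; exact: cylinderM.
have mm k := cylinder_measurable mZ (cm k).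
have im k : integrable_rv P' (fun w => m k (Z ^~ w)).
  exact: (integrable_rv_of_bounded P' (mm k)).
have mC k : mean P' (fun w => m k (Z ^~ w)) <= C.
  have cv := cvg_mean_bounded (cm k) (mb k).
  rewrite -(cvg_lim _ cv)//; apply: limr_le; first by apply/cvg_ex; eexists; exact: cv.
  near=> n; have [i2 le2] : integrable_rv P (fun w => G (Z_ n ^~ w) ^+ 2) /\
     mean P (fun w => G (Z_ n ^~ w) ^+ 2) <= C by near: n.
  apply: le_trans le2; apply: le_mean => //.
    exact: (integrable_rv_of_bounded P (cylinder_measurable (mZ_ n) (cm k)) (fun w => mb k _)).
  by move=> w; rewrite /m ge_min lexx.
pose g k w := (m k (Z ^~ w))%:E.
have gcv w : g k w @[k --> \oo] --> (G (Z ^~ w) ^+ 2)%:E.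
  apply: cvg_near_cst; near=> k; rewrite /g /m min_l//.
  by near: k; exact: nbhs_infty_ger.
have E : (\int[P']_w (G (Z ^~ w) ^+ 2)%:E <= C%:E)%E.
  under eq_integral do rewrite -(cvg_lim _ (gcv _))//.
  rewrite monotone_convergence//.
  - apply: lime_le.
      apply: ereal_nondecreasing_is_cvgn => a b ab; apply: ge0_le_integral => //.
      + by move=> w _; rewrite lee_fin.
      + exact/measurable_EFinP.
      + exact/measurable_EFinP.
      + by move=> w _; rewrite lee_fin /m le_min ge_min lexx/= ge_min ler_nat ab orbT.
    by near=> k; rewrite /g (meanE (im k)) lee_fin.
  - by move=> k; exact/measurable_EFinP.
  - by move=> k w _; rewrite lee_fin.
  - by move=> w _ a b ab; rewrite lee_fin /m le_min ge_min lexx/= ge_min ler_nat ab orbT.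
have i : integrable_rv P' (fun w => G (Z ^~ w) ^+ 2).
  apply/integrableP; split; first by apply/measurable_EFinP; exact: measurable_funX.
  under eq_integral do rewrite /= ger0_norm ?sqr_ge0//.
  exact: le_lt_trans E (ltry _).
by split => //; rewrite -lee_fin -(meanE i).
Unshelve. all: by end_near. Qed.

(* Second moments give the uniform integrability needed to pass to the limit. *)
Lemma lim_mean_mul_eq0 G h C c : cylinder T G -> cylinder T h -> (forall f, `|h f| <= c) ->
  (\forall n \near \oo, integrable_rv P (fun w => G (Z_ n ^~ w) ^+ 2) /\
     mean P (fun w => G (Z_ n ^~ w) ^+ 2) <= C) ->
  (\forall n \near \oo, mean P (fun w => G (Z_ n ^~ w) * h (Z_ n ^~ w)) = 0) ->
  mean P' (fun w => G (Z ^~ w) * h (Z ^~ w)) = 0.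
Proof.
move=> cG ch hc GC Gh0.
have c0 : 0 <= c := le_trans (normr_ge0 _) (hc (fun=> (0, 0, 0, 0, 0))).
have C0 : 0 <= C.
  by near \oo => n; have [_] : integrable_rv P (fun w => G (Z_ n ^~ w) ^+ 2) /\
     mean P (fun w => G (Z_ n ^~ w) ^+ 2) <= C; [near: n|apply: le_trans; apply: mean_ge0 => w; exact: sqr_ge0].
pose cl k f := clip k (G f) * h f.
have ccl k : cylinder T (cl k).
  by apply: cylinderM => //; apply: cylinder_comp => //; exact: clip_continuous.
(* The clipping error is stated for an arbitrary probability space because it is needed for the
   scheme and for the limit. *)
have err (k : R) (d0 : measure_display) (O : measurableType d0) (Q : probability O R) (Y : R -> O -> state) : 0 < k ->
    (forall i (u : R), 0 <= u <= T -> measurable_fun setT (fun w => component i (Y u w))) ->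
    integrable_rv Q (fun w => G (Y ^~ w) ^+ 2) -> mean Q (fun w => G (Y ^~ w) ^+ 2) <= C ->
    `|mean Q (fun w => G (Y ^~ w) * h (Y ^~ w)) - mean Q (fun w => cl k (Y ^~ w))| <= c * C / k.
  move=> k0 mY i2 le2.
  have mG := cylinder_measurable mY cG.
  have mh := cylinder_measurable mY ch.
  have iG : integrable_rv Q (fun w => G (Y ^~ w)).
    apply: (integrable_rv_dom mG (integrable_rvD (integrable_rv_cst Q 1) i2)) => w.
    have := weighted_amgm (G (Y ^~ w)) 1 ltr01; rewrite mulr1 divr1 expr1n mulr1 => /le_trans; apply.
    by have := sqr_ge0 (G (Y ^~ w)); lra.
  have i1 := integrable_rv_mul_bounded iG mh (fun w => hc (Y ^~ w)).
  have icl : integrable_rv Q (fun w => cl k (Y ^~ w)).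
    apply: (integrable_rv_of_bounded Q (cylinder_measurable mY (ccl k)) (_ : forall w, _ <= k * c)) => w.
    by rewrite normrM ler_pM// clip_bound// ltW.
  rewrite -(meanB i1 icl); apply: (le_trans (le_norm_mean (integrable_rvB i1 icl))).
  have i3 := integrable_rvZ (c / k) i2.
  apply: (@le_trans _ _ (mean Q (fun w => c / k * G (Y ^~ w) ^+ 2))).
    apply: le_mean => //; first exact: integrable_rv_norm (integrable_rvB i1 icl).
    move=> w; rewrite -mulrBl normrM mulrC.
    apply: (@le_trans _ _ (c * (G (Y ^~ w) ^+ 2 / k))); last by rewrite mulrA mulrAC.
    by rewrite ler_pM// clip_error.
  rewrite (meanZ _ i2) mulrAC; apply: ler_wpM2r; first by rewrite invr_ge0 ltW.
  exact: ler_wpM2l.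
have [iZ leZ] := lim_square cG GC.
set m := mean P' _.
have bd k : `|m| <= 2 * c * C / k.+1%:R.
  have k0 : 0 < k.+1%:R :> R by rewrite ltr0n.
  have e1 := err _ _ _ P' Z k0 mZ iZ leZ; rewrite -/m in e1.
  have bcl f : `|cl k.+1%:R f| <= k.+1%:R * c.
    by rewrite normrM ler_pM// clip_bound.
  have cv := cvg_mean_bounded (ccl k.+1%:R) bcl.
  have e2 : `|mean P' (fun w => cl k.+1%:R (Z ^~ w))| <= c * C / k.+1%:R.
    have cvn : `|mean P (fun w => cl k.+1%:R (Z_ n ^~ w))| @[n --> \oo] -->
        `|mean P' (fun w => cl k.+1%:R (Z ^~ w))| by exact: cvg_norm cv.
    rewrite -(cvg_lim _ cvn)//; apply: limr_le; first by apply/cvg_ex; eexists; exact: cvn.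
    near=> n; have [i2 le2] : integrable_rv P (fun w => G (Z_ n ^~ w) ^+ 2) /\
       mean P (fun w => G (Z_ n ^~ w) ^+ 2) <= C by near: n.
    have := err _ _ _ P (Z_ n) k0 (mZ_ n) i2 le2.
    have -> : mean P (fun w => G (Z_ n ^~ w) * h (Z_ n ^~ w)) = 0 by near: n.
    by rewrite sub0r normrN.
  have -> : 2 * c * C / k.+1%:R = c * C / k.+1%:R + c * C / k.+1%:R by ring.
  apply: le_trans (lerD e1 e2).
  by rewrite -[in leLHS](subrK (mean P' (fun w => cl k.+1%:R (Z ^~ w))) m) ler_normD.
have cv : 2 * c * C / k.+1%:R @[k --> \oo] --> (0 : R).
  rewrite -[X in _ --> X](mulr0 (2 * c * C)); apply: cvgM; first exact: cvg_cst.
  exact: cvg_harmonic.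
apply/eqP; rewrite -normr_le0 -(cvg_lim _ cv)//.
by apply: limr_ge; [apply/cvg_ex; exists 0|near=> k].
Unshelve. all: by end_near. Qed.

(** The bounds [e m] pass to the limit because min(1, |F|) is a bounded functional. Markov's
    inequality then bounds the probability that all [F m] stay above a threshold by a multiple of
    each [e m], hence by 0; asking for one good index only, no summability is required. *)
Lemma lim_frequently_small (F : nat -> (R -> state) -> R) (e : nat -> R) :
  (forall m, cylinder T (F m)) -> e m @[m --> \oo] --> (0 : R) ->
  (forall m, \forall n \near \oo, mean P (fun w => Num.min 1 `|F m (Z_ n ^~ w)|) <= e m) ->
  {ae P', forall w, forall x : R, 0 < x -> exists m, `|F m (Z ^~ w)| < x}.
Proof.
move=> cF e0 Fe.
suff H k : {ae P', forall w, exists m, `|F m (Z ^~ w)| < k.+1%:R^-1}.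
  have := ae_foralln H; apply: filterS => w Hw x x0.
  near \oo => k; have [m hm] := Hw k; exists m; apply: lt_trans hm _.
  by near: k; exact: near_infty_natSinv_lt (PosNum x0).
pose A m := [set w | k.+1%:R^-1 <= `|F m (Z ^~ w)|].
have mF m := cylinder_measurable mZ (cF m).
have mA m : measurable (A m).
  have -> : A m = (fun w => `|F m (Z ^~ w)|) @^-1` `[k.+1%:R^-1, +oo[%classic.
    by apply/seteqP; split => w; rewrite /A/= in_itv/= andbT.
  by rewrite -[X in measurable X]setTI; exact: (measurableT_comp (@normr_measurable _ _) (mF m)).
exists (\bigcap_m A m); split; last 1 first.
- by move=> w /= hw m _; rewrite /A/= leNgt; apply/negP => h; apply: hw; exists m.
- exact: bigcapT_measurable.
have k0 : 0 < k.+1%:R^-1 :> R by rewrite invr_gt0.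
have k1 : k.+1%:R^-1 <= 1 :> R by rewrite invf_le1// ler1n.
pose G m f : R := Num.min 1 `|F m f|.
have G0 m f : 0 <= G m f by rewrite le_min ler01 normr_ge0.
have cG m : cylinder T (G m).
  have -> : G m = fun f => - Num.max (- 1) (-1 * `|F m f|).
    by apply/funext => f; rewrite mulN1r -oppr_min opprK.
  apply: (@cylinder_comp _ _ _ -%R); first exact: opp_continuous.
  by apply: cylinder_max; [exact: cylinder_cst|apply: cylinderZ; exact: cylinder_norm].
have bG m f : `|G m f| <= 1 by rewrite ger0_norm// ge_min lexx.
have iG m : integrable_rv P' (fun w => G m (Z ^~ w)).
  exact: (integrable_rv_of_bounded P' (cylinder_measurable mZ (cG m))).
have mGe m : mean P' (fun w => G m (Z ^~ w)) <= e m.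
  have cv := cvg_mean_bounded (cG m) (bG m).
  rewrite -(cvg_lim _ cv)//; apply: limr_le; first by apply/cvg_ex; eexists; exact: cv.
  exact: Fe.
have PA m : (P' (A m) <= (e m * k.+1%:R)%:E)%E.
  have -> : (P' (A m) = \int[P']_w (\1_(A m) w)%:E)%E by rewrite integral_indic// setIT.
  have iA : integrable_rv P' (\1_(A m) : _ -> R) by exact: integrable_indic.
  rewrite (meanE iA) lee_fin -ler_pdivrMr ?ltr0n//; apply: le_trans (mGe m).
  rewrite mulrC -(meanZ _ iA); apply: le_mean => //; first exact: integrable_rvZ.
  move=> w; rewrite indicE; case: (boolP (w \in A m)) => [|_].
    by rewrite inE /A/= mulr1 le_min k1.
  by rewrite mulr0.
have mI : measurable (\bigcap_m A m) by exact: bigcapT_measurable.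
apply/eqP; rewrite eq_le measure_ge0 andbT -(fineK (fin_num_measure P' _ mI)) lee_fin.
have cv : e m * k.+1%:R @[m --> \oo] --> (0 : R).
  by rewrite -[X in _ --> X](mul0r k.+1%:R); apply: cvgM => //; exact: cvg_cst.
rewrite -(cvg_lim _ cv)//; apply: limr_ge; first by apply/cvg_ex; exists 0.
near=> m; rewrite -lee_fin (fineK (fin_num_measure P' _ mI)).
apply: le_trans (PA m).
by apply: le_measure; rewrite ?inE// => w; exact.
Unshelve. all: by end_near. Qed.

(** The previous lemma applied to every tail makes the sequence small infinitely often, which is
    incompatible with a nonzero pathwise limit. *)
Lemma lim_cvg_eq0 (F : nat -> (R -> state) -> R) (e : nat -> R) :
  (forall m, cylinder T (F m)) -> e m @[m --> \oo] --> (0 : R) ->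
  (forall m, \forall n \near \oo, mean P (fun w => Num.min 1 `|F m (Z_ n ^~ w)|) <= e m) ->
  {ae P', forall w, forall l : R, F m (Z ^~ w) @[m --> \oo] --> l -> l = 0}.
Proof.
move=> cF e0 Fe.
have H N : {ae P', forall w, forall x : R, 0 < x -> exists m, `|F (m + N)%N (Z ^~ w)| < x}.
  apply: (@lim_frequently_small (fun m => F (m + N)%N) (fun m => e (m + N)%N)) => //.
  by rewrite (cvg_shiftn N).
have := ae_foralln H; apply: filterS => w Hw l Fl.
apply/eqP; apply/negPn/negP => l0.
have l2 : 0 < `|l| / 2 by rewrite divr_gt0// normr_gt0.
have [N _ HN] : \forall m \near \oo, `|l - F m (Z ^~ w)| < `|l| / 2.
  by move/cvgrPdist_lt : Fl; exact.
have [m hm] := Hw N _ l2.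
have := HN _ (leq_addl m N) => /= h.
by have := ler_distD (F (m + N)%N (Z ^~ w)) l 0; rewrite !subr0; lra.
Qed.

End weak_limit.

(** * Identification of the limit *)

Section kernel_comparison.
Context {d} {Omega : measurableType d} {R : realType} (P : probability Omega R).
Local Notation mu := (@lebesgue_measure R).
Variables (T : R) (n n' : nat) (t t' : nat -> R) (K : R -> R) (g : Omega -> R -> R).
Hypotheses (t_grid : is_grid T n t) (t'_grid : is_grid T n' t').
Hypothesis K_ge0 : forall s, s \in `]0, T] -> 0 <= K s.
Variables (A om : R).
Hypothesis gi : forall v, 0 <= v <= T -> integrable_rv P (g^~ v).
Hypothesis gA : forall v, 0 <= v <= T -> mean P (fun w => `|g w v|) <= A.
Hypothesis gom : forall s, 0 <= s <= T ->
  mean P (fun w => `|g w (eta T n t s) - g w (eta T n' t' s)|) <= om.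

Let cell (m : nat) (r : nat -> R) k : set R := `[r k, r k.+1[%classic.

(** With a, b the two frozen kernels and g, g' the drift frozen on the two grids, a g - b g' = (a -
    b) g + b (g - g'). Tonelli brings the mean inside the time integral, where [A] bounds the first
    factor g and [om] the second difference. *)
Lemma mean_kernel_sum_diff u : 0 <= u <= T ->
  mu.-integrable `[0, u[ (EFin \o (fun s => K (u - eta T n t s))) ->
  mu.-integrable `[0, u[ (EFin \o (fun s => K (u - eta T n' t' s))) ->
  mean P (fun w => `|kernel_sum n t K u (g w) - kernel_sum n' t' K u (g w)|) <=
  A * \int[mu]_(s in `[0, u[) `|K (u - eta T n t s) - K (u - eta T n' t' s)|
  + om * \int[mu]_(s in `[0, u[) K (u - eta T n' t' s).
Proof.
move=> /andP[u0 uT] ia ib.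
set D : set (measurableTypeR R) := `[0, u[%classic.
have mD : measurable D by exact: measurable_itv.
set a := fun s => K (u - eta T n t s); set b := fun s => K (u - eta T n' t' s).
have tT k : (k <= n)%N -> 0 <= t k <= T by move=> /(grid_itv t_grid); rewrite in_itv.
have t'T k : (k <= n')%N -> 0 <= t' k <= T by move=> /(grid_itv t'_grid); rewrite in_itv.
pose c k j w : R := `|K (u - t k) * g w (t k) - K (u - t' j) * g w (t' j)|.
(* The integrand as a finite double sum over pairs of cells: joint measurability is then immediate,
   although nothing is assumed on [g] as a function of time. *)
pose h (z : Omega * measurableTypeR R) : R := \sum_(k < n)
  (\sum_(j < n') c k j z.1 * \1_(`[t' j, t' j.+1[%classic : set R) z.2)
  * \1_(`[t k, t k.+1[%classic : set R) z.2 * \1_D z.2.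
have hE w (s : R) : D s -> h (w, s) = `|a s * g w (eta T n t s) - b s * g w (eta T n' t' s)|.
  move=> Ds; have sT : 0 <= s < T.
    by move: Ds; rewrite /D/= in_itv/= => /andP[-> /lt_le_trans ->].
  have [k kn sk] := grid_cell t_grid sT; have [j jn sj] := grid_cell t'_grid sT.
  rewrite /h /= -mulr_suml indicE mem_set// mulr1.
  rewrite (sum_cell t_grid (fun k => \sum_(j < n') c k j w * \1_`[t' j, t' j.+1[ s) kn sk).
  rewrite (sum_cell t'_grid (fun j => c k j w) jn sj).
  by rewrite /c /a /b (eta_cell t_grid kn sk) (eta_cell t'_grid jn sj).
have mc k j : (k < n)%N -> (j < n')%N -> measurable_fun setT (c k j).
  move=> kn jn; apply: measurableT_comp => //; apply: measurable_funB; apply: measurable_funM => //.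
    by apply: integrable_rv_measurable; apply: gi; apply: tT; exact: ltnW.
  by apply: integrable_rv_measurable; apply: gi; apply: t'T; exact: ltnW.
have mh : measurable_fun setT h.
  apply: measurable_sum => k; apply: measurable_funM; first apply: measurable_funM.
  - apply: measurable_sum => j; apply: measurable_funM.
      by apply: measurableT_comp => //; exact: mc.
    by apply: measurableT_comp => //; exact: measurable_indic.
  - by apply: measurableT_comp => //; exact: measurable_indic.
  - by apply: measurableT_comp => //; exact: measurable_indic.
have h0 z : 0 <= h z.
  apply: sumr_ge0 => k _; rewrite !mulr_ge0 ?sumr_ge0// => j _.
  by apply: mulr_ge0 => //; exact: normr_ge0.
have hD w (s : R) : ~ D s -> h (w, s) = 0.
  by move=> Ds; rewrite /h big1// => k _; rewrite [\1_D _]indicE memNset// mulr0.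
have sI (s : R) : D s -> 0 <= s <= T.
  by rewrite /D/= in_itv/= => /andP[-> /ltW /le_trans ->].
have path_le w : (`|kernel_sum n t K u (g w) - kernel_sum n' t' K u (g w)|%:E <=
    \int[mu]_s (h (w, s))%:E)%E.
  have i1 := step_integrable t_grid (fun x => K (u - x) * g w x) (lexx 0) uT.
  have i2 := step_integrable t'_grid (fun x => K (u - x) * g w x) (lexx 0) uT.
  have mI : measurable (`[0, u]%classic : set (measurableTypeR R)) by exact: measurable_itv.
  have i12 := integrableB mI i1 i2.
  rewrite -(kernel_sumE t_grid) ?u0// -(kernel_sumE t'_grid) ?u0//.
  rewrite -RintegralB//; apply: (@le_trans _ _ (\int[mu]_(s in `[0, u])
     `|a s * g w (eta T n t s) - b s * g w (eta T n' t' s)|)%:E).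
    by rewrite lee_fin; exact: le_normr_Rintegral.
  have i12n := integrable_norm i12.
  rewrite /Rintegral fineK; last exact: integrable_fin_num i12n.
  rewrite -integral_itv_bndo_bndc; last first.
    by have /integrableP[m12 _] := i12n; apply: (measurable_funS mI) m12; apply: subset_itvl; rewrite bnd_simp.
  rewrite integral_mkcond le_eqVlt; apply/orP; left; apply/eqP; apply: eq_integral => s _.
  rewrite patchE; case: ifPn => [|]; first by rewrite inE => Ds; rewrite hE.
  by rewrite notin_setE => Ds; rewrite hD.
have sec_le (s : R) : (\int[P]_w (h (w, s))%:E <=
    ((fun s => (A * `|a s - b s| + om * b s)%:E) \_ D) s)%E.
  rewrite patchE; case: ifPn => [|]; last first.
    by rewrite notin_setE => Ds; under eq_integral do rewrite hD//; rewrite integral0.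
  rewrite inE => Ds; under eq_integral do rewrite hE//.
  have /andP[e0 es] := eta_le t_grid (sI _ Ds); have /andP[e'0 e's] := eta_le t'_grid (sI _ Ds).
  have /andP[s0 sT] := sI _ Ds.
  have eI : 0 <= eta T n t s <= T by rewrite e0 (le_trans es).
  have e'I : 0 <= eta T n' t' s <= T by rewrite e'0 (le_trans e's).
  have b0 : 0 <= b s.
    apply: K_ge0; rewrite in_itv/= subr_gt0; move: Ds; rewrite /D/= in_itv/= => /andP[_ su].
    by rewrite (le_lt_trans e's su) (le_trans _ uT)// gerBl.
  have j1 := integrable_rvZ (a s) (gi eI); have j2 := integrable_rvZ (b s) (gi e'I).
  rewrite (meanE (integrable_rv_norm (integrable_rvB j1 j2))) lee_fin.
  have j3 := integrable_rv_norm (gi eI).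
  have j4 := integrable_rv_norm (integrable_rvB (gi eI) (gi e'I)).
  have j5 := integrable_rvD (integrable_rvZ `|a s - b s| j3) (integrable_rvZ (b s) j4).
  apply: (@le_trans _ _ (mean P (fun w => `|a s - b s| * `|g w (eta T n t s)| +
      b s * `|g w (eta T n t s) - g w (eta T n' t' s)|))).
    apply: le_mean => //; first exact: integrable_rv_norm (integrable_rvB j1 j2).
    move=> w; rewrite -normrM -{3}(ger0_norm b0) -normrM.
    apply: le_trans (ler_normD _ _); rewrite le_eqVlt; apply/orP; left; apply/eqP.
    by congr (`|_|); ring.
  rewrite (meanD (integrable_rvZ _ j3) (integrable_rvZ _ j4)) (meanZ _ j3) (meanZ _ j4).
  rewrite lerD//; first by rewrite mulrC ler_wpM2r// gA.
  by rewrite mulrC ler_wpM2r// gom// s0.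
have iab : mu.-integrable D (EFin \o (fun s => `|a s - b s|)).
  exact: integrable_norm (integrableB mD ia ib).
have irhs : mu.-integrable D (EFin \o (fun s => A * `|a s - b s| + om * b s)).
  exact: (integrableD mD (integrableZl mD A iab) (integrableZl mD om ib)).
have mhE : measurable_fun setT (EFin \o h) by exact/measurable_EFinP.
have h0E z : (0 <= (EFin \o h) z)%E by rewrite lee_fin.
have key : (\int[P]_w \int[mu]_s (h (w, s))%:E = \int[mu]_s \int[P]_w (h (w, s))%:E)%E.
  exact: (fubini_tonelli _ mhE h0E).
have ks (m : nat) (r : nat -> R) : is_grid T m r -> integrable_rv P (fun w => kernel_sum m r K u (g w)).
  move=> rg; apply: integrable_rv_sum => k; apply: integrable_rvZ; apply: gi.
  by have := grid_itv rg (ltnW (ltn_ord k)); rewrite in_itv.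
have iks := integrable_rv_norm (integrable_rvB (ks _ _ t_grid) (ks _ _ t'_grid)).
rewrite -lee_fin -(meanE iks).
apply: (@le_trans _ _ (\int[P]_w \int[mu]_s (h (w, s))%:E)%E).
  apply: ge0_le_integral => //.
  - by apply/measurable_EFinP; exact: integrable_rv_measurable iks.
  - exact: (measurable_fun_fubini_tonelli_F _ mhE h0E).
rewrite key.
apply: (@le_trans _ _ (\int[mu]_s ((fun s => (A * `|a s - b s| + om * b s)%:E) \_ D) s)%E).
  apply: ge0_le_integral => //.
  - by move=> s _; apply: integral_ge0 => w _; rewrite lee_fin.
  - exact: (measurable_fun_fubini_tonelli_G _ mhE h0E).
  - by apply/(measurable_restrictT _ mD); case/integrableP: irhs.
rewrite -integral_mkcond.
have i1 := integrableZl mD A iab; have i2 := integrableZl mD om ib.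
have := RintegralD mD i1 i2; rewrite RintegralZl// RintegralZl// => <-.
by rewrite /Rintegral fineK//; exact: integrable_fin_num irhs.
Qed.
End kernel_comparison.

(** * The filtration generated by the limit, tested by continuous functionals *)

Section history.
Context {R : realType} {d} {Omega : measurableType d} (P : probability Omega R).
Local Notation state := (R * R * R * R * R)%type.
Variables (T : R) (Z : R -> Omega -> state).
Hypothesis mZ : forall i (u : R), 0 <= u <= T -> measurable_fun setT (fun w => component i (Z u w)).

Definition history (s : R) : set (set Omega) := \bigcup_(u in `[0, s]) \bigcup_(i in [set: nat])
  preimage_set_system setT (fun w => component i (Z u w)) measurable.

Lemma history_le s s' : s <= s' -> <<s history s >> `<=` <<s history s' >>.
Proof.
move=> ss'; apply: sub_sigma_algebra2; apply: bigcup_subset => u /=.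
by rewrite !in_itv/= => /andP[-> us]; exact: le_trans ss'.
Qed.

Lemma history_measurable s : s <= T -> history s `<=` measurable.
Proof.
move=> sT A [u]; rewrite /= in_itv/= => /andP[u0 us] [i _ [U mU <-]].
by apply: mZ => //; rewrite u0 (le_trans us).
Qed.

Lemma history_sigma_measurable s : s <= T -> <<s history s >> `<=` measurable.
Proof.
by move=> sT; apply: smallest_sub; [exact: sigma_algebra_measurable|exact: history_measurable].
Qed.

Lemma measurable_wrt_history s i (u : R) : 0 <= u <= s ->
  measurable_wrt (history s) (fun w => component i (Z u w)).
Proof.
move=> us; apply: measurable_wrt_preimage_system => A hA; apply: sub_gen_smallest.
by exists u; [rewrite /= in_itv|exists i].
Qed.

Lemma cylinder_history s F : cylinder s F -> measurable_wrt (history s) (fun w => F (Z ^~ w)).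
Proof.
apply: (@cylinder_measurable R _ (g_sigma_algebraType (history s)) s Z) => i u us.
exact: measurable_wrt_history.
Qed.

(* The sets whose indicator is a pointwise limit of continuous cylinder
   functionals form a pi-system generating the history. *)
Definition approximable (s : R) : set (set Omega) := [set A |
  exists h : nat -> (R -> state) -> R, [/\ forall k, cylinder s (h k),
    forall k f, 0 <= h k f <= 1 &
    forall w, h k (Z ^~ w) @[k --> \oo] --> (\1_A w : R)]].

Lemma approximableI s : setI_closed (approximable s).
Proof.
move=> A A' [h [ch hI hA]] [h' [ch' hI' hA']].
exists (fun k f => h k f * h' k f); split.
- by move=> k; exact: cylinderM.
- move=> k f; have /andP[h0 h1] := hI k f; have /andP[h0' h1'] := hI' k f.
  by rewrite mulr_ge0// mulr_ile1.
- by move=> w; rewrite indicI; apply: cvgM; [exact: hA|exact: hA'].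
Qed.

(** Continuous approximations of the indicator of the positive half-line; they show that the
    generating events where a component exceeds a level are [approximable]. *)
Let ramp (k : nat) (x : R) : R := Num.max 0 (Num.min 1 (k%:R * x)).

Let ramp_continuous k : continuous (ramp k).
Proof.
rewrite (_ : ramp k = (cst 0 : R -> R^o) \max ((cst 1 : R -> R^o) \min (fun x => k%:R * x)))// => x.
apply: continuous_max; first exact: cst_continuous.
by apply: continuous_min; [exact: cst_continuous|exact: mulrl_continuous].
Qed.

Let ramp_cvg (x : R) : ramp k x @[k --> \oo] --> ((0 < x)%R%:R : R).
Proof.
have [x0|x0] := ltP 0 x; apply: cvg_near_cst; near=> k; last first.
  rewrite /ramp max_l// ge_min; apply/orP; right.
  by rewrite mulr_ge0_le0.
rewrite /ramp min_l ?max_r//.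
rewrite -ler_pdivrMr//; near: k; exact: nbhs_infty_ger.
Unshelve. all: by end_near. Qed.

Lemma history_approximable s : <<s history s >> `<=` <<s approximable s >>.
Proof.
apply: smallest_sub; first exact: smallest_sigma_algebra.
move=> A [u us [i _ [U mU <-]]].
suff m : measurable_wrt (approximable s) (fun w => component i (Z u w)).
  by rewrite setTI; exact: measurable_wrt_preimage.
apply: (measurability _ (RGenOInfty.measurableE R)) => _ [_ [a ->] <-].
rewrite setTI; apply: sub_gen_smallest.
have us' : 0 <= u <= s by move: us; rewrite /= in_itv.
have s0 : 0 <= s by case/andP: us' => /le_trans; exact.
exists (fun k f => ramp k (component i (f u) - a)); split.
- move=> k; apply: (@cylinder_comp _ _ _ (ramp k)) => //.
  by apply: cylinderB; [exact: cylinder_component|exact: cylinder_cst].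
- by move=> k f; rewrite /ramp le_max lexx/= ge_max ler01/= ge_min lexx.
- move=> w; have := @ramp_cvg (component i (Z u w) - a); rewrite subr_gt0 indicE.
  have -> // : (a < component i (Z u w)) =
      (w \in (fun w => component i (Z u w)) @^-1` `]a, +oo[%classic).
  apply/idP/idP; first by move=> h; rewrite inE/= in_itv/= h.
  by rewrite inE /= in_itv/= andbT.
Qed.

(** The events over which [D] integrates to 0 form a Dynkin system. It contains the approximable
    events by dominated convergence with bound |D|. *)
Lemma integral_history_eq0 s D : 0 <= s -> s <= T -> integrable_rv P D ->
  (forall h c, cylinder s h -> (forall f, `|h f| <= c) -> mean P (fun w => D w * h (Z ^~ w)) = 0) ->
  forall A, <<s history s >> A -> (\int[P]_(w in A) (D w)%:E = 0)%E.
Proof.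
move=> s0 sT iD D0.
pose L : set (set Omega) := [set A | measurable A /\ (\int[P]_(w in A) (D w)%:E = 0)%E].
have mDE : measurable_fun setT (EFin \o D) by apply/measurable_EFinP; exact: integrable_rv_measurable iD.
have iS A : measurable A -> P.-integrable A (EFin \o D).
  by move=> mA; apply: (integrableS measurableT mA _ iD).
have LT : L setT.
  split => //; have := D0 (fun=> 1) 1 (cylinder_cst 1 s0) (fun f => _).
  under [in mean _ _]eq_fun do rewrite mulr1.
  by rewrite (meanE iD) => ->//; rewrite normr1.
have dL : dynkin L.
  split => //.
  - move=> A [mA A0]; split; first exact: measurableC.
    have iU : P.-integrable (A `|` ~` A) (EFin \o D) by rewrite setUv.
    have := Rintegral_setU mA (measurableC mA) iU.
    rewrite setUv => /(_ _)/wrap[]; first by apply/disj_setPS; rewrite setICr.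
    have e1 : \int[P]_(w in A) D w = 0 by rewrite /Rintegral A0.
    have e2 : \int[P]_w D w = 0 by rewrite /Rintegral; case: LT => _ ->.
    rewrite e1 e2 add0r => /esym e3; rewrite -[LHS]fineK; last first.
      exact: (integrable_fin_num (measurableC mA) (iS _ (measurableC mA))).
    by congr EFin.
  - move=> F tF LF; have mF k : measurable (F k) by case: (LF k).
    split; first exact: bigcupT_measurable.
    rewrite (integral_bigcup tF mF); last by apply: iS; exact: bigcupT_measurable.
    by apply: eseries0 => k _ _; case: (LF k).
have AL : approximable s `<=` L.
  move=> A [h [ch hI hA]].
  have mh k : measurable_fun setT (fun w => h k (Z ^~ w)).
    apply: cylinder_measurable (ch k) => i u /andP[u0 us]; apply: mZ.
    by rewrite u0 (le_trans us).
  have mA : measurable A.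
    have mI : measurable_fun setT (\1_A : Omega -> R).
      apply: (measurable_fun_cvg mh) => w _; exact: hA.
    rewrite -(setTI A) (_ : A = (\1_A : Omega -> R) @^-1` [set 1]); last first.
      by apply/seteqP; split => w /=; rewrite indicE; have [|] := boolP (w \in A);
        rewrite ?inE ?notin_setE// => _ /eqP; rewrite eq_sym oner_eq0.
    exact: mI.
  split=> //.
  have -> : (\int[P]_(w in A) (D w)%:E = \int[P]_w (D w * \1_A w)%:E)%E.
    rewrite integral_mkcond; apply: eq_integral => w _; rewrite patchE indicE.
    by case: ifP => _; rewrite ?mulr1 ?mulr0.
  have hb k f : `|h k f| <= 1 by have /andP[h0 h1] := hI k f; rewrite ger0_norm.
  have c1 : (\int[P]_w (D w * h k (Z ^~ w))%:E)%E @[k --> \oo] --> (\int[P]_w (D w * \1_A w)%:E)%E.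
    apply: (@dominated_cvg _ _ _ P setT measurableT (fun k w => (D w * h k (Z ^~ w))%:E) _ (fun w => `|D w|%:E)) => //.
    - move=> k; apply/measurable_EFinP; apply: measurable_funM => //.
      exact: integrable_rv_measurable iD.
    - move=> w _; apply: cvg_EFin; first by near=> k.
      by apply: cvgM; [exact: cvg_cst|exact: hA].
    - exact: integrable_rv_norm iD.
    - by move=> k w _; rewrite lee_fin normrM ler_piMr.
  have c2 : (\int[P]_w (D w * h k (Z ^~ w))%:E)%E @[k --> \oo] --> 0%E.
    apply: cvg_near_cst; near=> k.
    rewrite (meanE (integrable_rv_mul_bounded iD (mh k) (fun w => hb k _))).
    by rewrite (D0 _ 1 (ch k) (hb k)).
  exact: (cvg_unique _ c1 c2).
move=> A hA; suff : L A by case.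
have := @setI_closed_g_dynkin_g_sigma_algebra _ _ (@approximableI s) => E.
have : <<d approximable s >> A by rewrite E; exact: history_approximable.
by apply: smallest_sub.
Unshelve. all: by end_near. Qed.

End history.

Lemma powR_cvg_seq (R : realType) (H : R) (u : nat -> R) : 0 < H -> (forall n, 0 < u n) ->
  u n @[n --> \oo] --> (0 : R) -> u n `^ H @[n --> \oo] --> (0 : R).
Proof.
move=> H0 u0 cu; apply: (@cvg_comp _ _ _ u (fun x => x `^ H) _ (0%R^'+)); last exact: powR_cvg0.
move=> U hU; have h : \forall n \near \oo, 0 < u n -> U (u n) by exact: (cu _ hU).
by apply: filterS h => n; apply; exact: u0.
Qed.

Section limit.
Context {R : realType}.
Local Notation mu := (@lebesgue_measure R).
Local Notation state := (R * R * R * R * R)%type.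
Variables (T rho S0 V0 theta lambda nu : R).
Hypotheses (T_gt0 : 0 < T) (V0_gt0 : 0 < V0) (theta_gt0 : 0 < theta).
Hypotheses (lambda_gt0 : 0 < lambda) (nu_gt0 : 0 < nu).
Variables (t_ : nat -> nat -> R).
Hypothesis t_grid : forall n, (0 < n)%N -> is_grid T n (t_ n).
Hypothesis t_mesh : mesh n (t_ n) @[n --> \oo] --> (0 : R).
Variables (K : R -> R) (K_ok : kernel_assumption T t_ K).
Variables (C H : R) (C0 : 0 < C) (H0 : 0 < H).
Hypothesis moduli : forall (n : nat) (t delta : R), (0 < n)%N ->
  t \in `[0, T] -> delta \in `]0, T - t] ->
  let e := eta T n (t_ n) in
  (\int[mu]_(s in `[t, (t + delta)%R])
      (`|K (t + delta - e s)| ^+ 2)%:E <= (C * delta `^ (2 * H))%:E)%E /\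
  (\int[mu]_(s in `[0%R, t])
      (`|K (t + delta - e s) - K (t - e s)| ^+ 2)%:E
    <= (C * delta `^ (2 * H))%:E)%E.
Context {d : measure_display} {Omega : measurableType d} (P : probability Omega R).
Variables (B B' : R -> Omega -> R).
Hypotheses (B_bm : brownian_motion P T B) (B'_bm : brownian_motion P T B').
Hypothesis BB' : independent_systems P (sigma_generated `[0, T] B) (sigma_generated `[0, T] B').
Variables (phi : nat -> nat) (phi_gt : forall n, (n < phi n)%N).
Variables (Xn Xbn Mn Mpn : nat -> R -> Omega -> R).
Hypothesis scheme : forall n, is_scheme T V0 theta lambda nu (phi n) (t_ (phi n)) K B B'
  (Xn n) (Xbn n) (Mn n) (Mpn n).
Context {d' : measure_display} {Omega' : measurableType d'} (P' : probability Omega' R).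
Variables (X Xb S M Mp : R -> Omega' -> R).

Definition scheme_state n (t : R) (w : Omega) : state :=
  (Xn n t w, Xbn n t w, scheme_price S0 rho (Xbn n) (Mn n) (Mpn n) t w, Mn n t w, Mpn n t w).
Definition limit_state (t : R) (w : Omega') : state := (X t w, Xb t w, S t w, M t w, Mp t w).
Local Notation Z_ := scheme_state.
Local Notation Z := limit_state.

Hypothesis lim_measurable : forall t : R, t \in `[0, T] ->
  [/\ measurable_fun setT (X t), measurable_fun setT (Xb t), measurable_fun setT (S t),
      measurable_fun setT (M t) & measurable_fun setT (Mp t)].
Hypothesis lim_continuous : [/\ continuous_paths T X, continuous_paths T Xb,
  continuous_paths T S, continuous_paths T M & continuous_paths T Mp].
Hypothesis law : cvg_in_law P P' T Z_ Z.

Let T_ge0 : 0 <= T := ltW T_gt0.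
Let phi_gt0 n : (0 < phi n)%N := leq_ltn_trans (leq0n n) (phi_gt n).
Let grid n : is_grid T (phi n) (t_ (phi n)) := t_grid (phi_gt0 n).
Let moduli_n n := fun t delta => @moduli (phi n) t delta (phi_gt0 n).
Let K_ge0 := kernel_ge0 K_ok.

Let phi_cvg : phi n @[n --> \oo] --> \oo.
Proof.
move=> A [N _ hN]; exists N => // n /= Nn; apply: hN => /=.
exact: leq_trans Nn (ltnW (phi_gt n)).
Qed.

Let mesh_n n := mesh (phi n) (t_ (phi n)).
Let mesh_cvg : mesh_n n @[n --> \oo] --> (0 : R).
Proof. exact: (cvg_comp _ _ phi_cvg t_mesh). Qed.
Let mesh_n_ge0 n : 0 <= mesh_n n.
Proof. by rewrite /mesh_n /mesh; elim/big_rec : _ => // i x _ x0; rewrite le_max x0 orbT. Qed.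

Lemma scheme_state_measurable n i (u : R) : 0 <= u <= T ->
  measurable_fun setT (fun w => component i (Z_ n u w)).
Proof.
move=> uT; have [[mX _] [mXb _] [mM _] [mM' _]] := scheme_adapted4 (phi_gt0 n) (grid n) B_bm B'_bm BB' (scheme n) uT.
have pm : past B B' u `<=` measurable.
  apply: (past_measurable (T := T)); [exact: bm_measurable B_bm|exact: bm_measurable B'_bm|].
  by case/andP: uT.
have m (Y : Omega -> R) : measurable_wrt (past B B' u) Y -> measurable_fun setT Y.
  exact: measurable_wrt_measurable.
case: i => [|[|[|[|i]]]] /=; [exact: m|exact: m| |exact: m|exact: m].
apply: (measurableT_comp (@measurable_expR R)).
apply: measurable_funB; last by apply: measurable_funM => //; exact: m.
apply: measurable_funD; last by apply: measurable_funM => //; exact: m.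
by apply: measurable_funD => //; apply: measurable_funM => //; exact: m.
Qed.

Lemma limit_state_measurable i (u : R) : 0 <= u <= T ->
  measurable_fun setT (fun w => component i (Z u w)).
Proof.
move=> uT; have [] := lim_measurable (t := u); first by rewrite in_itv.
by case: i => [|[|[|[|i]]]].
Qed.

Local Notation b3 := (holder_mean_bound T V0 theta lambda nu C H).

Lemma modulus_cvg0 (u : nat -> R) : (forall n, 0 < u n) -> u n @[n --> \oo] --> (0 : R) ->
  modulus V0 H (u n) @[n --> \oo] --> (0 : R).
Proof.
move=> u0 cu; rewrite -[X in _ --> X](addr0 0); apply: cvgD; last exact: powR_cvg_seq.
by rewrite -[X in _ --> X](mulr0 V0); apply: cvgM => //; exact: cvg_cst.
Qed.

Let harm_cvg : (m.+1%:R^-1 : R) @[m --> \oo] --> (0 : R).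
Proof. exact: cvg_harmonic. Qed.
Let harm_gt0 m : 0 < (m.+1%:R^-1 : R). Proof. by rewrite invr_gt0 ltr0n. Qed.

Let mesh_small m : \forall n \near \oo, mesh_n n <= m.+1%:R^-1.
Proof.
have /cvgrPdist_lt/(_ _ (harm_gt0 m)) := mesh_cvg.
by apply: filterS => n; rewrite sub0r normrN => h; apply: ltW; apply: le_lt_trans h; exact: ler_norm.
Qed.

Let mean_min1 (f : Omega -> R) c : integrable_rv P f ->
  mean P (fun w => `|f w|) <= c -> mean P (fun w => Num.min 1 `|f w|) <= c.
Proof.
move=> fi; have mf := integrable_rv_measurable fi; apply: le_trans; apply: le_mean => //.
- apply: (integrable_rv_of_bounded P _ (_ : forall w, _ <= 1)).
    by apply: measurable_minr => //; exact: measurableT_comp.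
  by move=> w; rewrite ger0_norm ?le_min ?ler01 ?normr_ge0// ge_min lexx.
- exact: integrable_rv_norm.
- by move=> w; rewrite ge_min lexx orbT.
Qed.

Definition path_drift (f : R -> state) (v : R) : R :=
  theta * v - lambda * component 1 (f v) + nu * component 3 (f v).

Let kernel_step_integrable m u : (0 < m)%N -> 0 <= u <= T ->
  mu.-integrable `[0, u[ (EFin \o (fun s => K (u - eta T m (t_ m) s))).
Proof.
move=> m0 /andP[u0 uT].
have i := step_integrable (t_grid m0) (fun x => K (u - x)) (lexx 0) uT.
have mI : measurable (`[0, u]%classic : set (measurableTypeR R)) by exact: measurable_itv.
have mJ : measurable (`[0, u[%classic : set (measurableTypeR R)) by exact: measurable_itv.
by apply: (integrableS mI mJ) i; apply: subset_itvl; rewrite bnd_simp.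
Qed.

Let step_error m u := \int[mu]_(s in `[0, u[) `|K (u - eta T m.+1 (t_ m.+1) s) - K (u - s)|.
Let kernel_mass u := \int[mu]_(s in `[0, u[) K (u - s).

Let step_error_sum n m u : 0 <= u <= T ->
  \int[mu]_(s in `[0, u[) `|K (u - eta T (phi n) (t_ (phi n)) s) - K (u - eta T m.+1 (t_ m.+1) s)|
  <= step_error (phi n).-1 u + step_error m u.
Proof.
move=> uT; rewrite /step_error prednK//.
have mD : measurable (`[0, u[%classic : set (measurableTypeR R)) by exact: measurable_itv.
have i0 := kernel_integrable T_gt0 t_grid t_mesh K_ok uT.
have i1 := kernel_step_integrable (phi_gt0 n) uT.
have i2 := kernel_step_integrable (ltn0Sn m) uT.
have j1 := integrable_norm (integrableB mD i1 i0).
have j2 := integrable_norm (integrableB mD i2 i0).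
have j3 := integrable_norm (integrableB mD i1 i2).
rewrite -(RintegralD mD j1 j2); apply: le_Rintegral => //.
- exact: (integrableD mD j1 j2).
- by move=> s _; rewrite [X in _ <= _ + X]distrC; exact: ler_distD.
Qed.

Let step_mass_le m u : 0 <= u <= T ->
  \int[mu]_(s in `[0, u[) K (u - eta T m.+1 (t_ m.+1) s) <= kernel_mass u + step_error m u.
Proof.
move=> uT.
have mD : measurable (`[0, u[%classic : set (measurableTypeR R)) by exact: measurable_itv.
have i0 := kernel_integrable T_gt0 t_grid t_mesh K_ok uT.
have i2 := kernel_step_integrable (ltn0Sn m) uT.
have j2 := integrable_norm (integrableB mD i2 i0).
rewrite -(RintegralD mD i0 j2); apply: le_Rintegral => //.
- exact: (integrableD mD i0 j2).
- by move=> s _; rewrite -lerBlDl ler_norm.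
Qed.

(* The residual of the limit equation for the kernel frozen on the grid m + 1. *)
Let volterra_error m (t : R) (f : R -> state) : R :=
  component 0 (f t) - V0 * t - kernel_sum m.+1 (t_ m.+1) K t (path_drift f).

Let path_drift_cylinder (u : R) : 0 <= u <= T -> cylinder T (fun f => path_drift f u).
Proof.
move=> uT; apply: cylinderD; last by apply: cylinderZ; exact: cylinder_component.
apply: cylinderB; first exact: cylinder_cst.
by apply: cylinderZ; exact: cylinder_component.
Qed.

Let volterra_cylinder m t : 0 <= t <= T -> cylinder T (volterra_error m t).
Proof.
move=> tT; apply: cylinderB.
  by apply: cylinderB; [exact: cylinder_component|exact: cylinder_cst].
apply: (@cylinder_sum _ T m.+1 (fun k f => kernel_weight (t_ m.+1) K t k * path_drift f (t_ m.+1 k))) => //.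
move=> k km; apply: cylinderZ; apply: path_drift_cylinder.
by have := grid_itv (t_grid (ltn0Sn m)) (ltnW km); rewrite in_itv.
Qed.

(** Once the mesh of the scheme is at most 1 / (m + 1), it dominates the distance between the two
    frozen times (one mesh of each grid) plus the two meshes of [mean_drift_increment]. *)
Let window m : R := mesh m.+1 (t_ m.+1) + 3 * m.+1%:R^-1.
(** The bound of [mean_kernel_sum_diff], made free of [n]. The second argument of [drift_modulus] is
    the square root of the modulus, which balances e + modulus / e. *)
Let volterra_bound t m : R := drift_bound T V0 theta lambda nu C H * (m.+1%:R^-1 + step_error m t)
  + drift_modulus T V0 theta lambda nu C H (window m) (Num.sqrt (modulus V0 H (window m)))
    * (kernel_mass t + step_error m t).

Let window_gt0 m : 0 < window m.
Proof.
rewrite /window ltr_wpDl// ?mulr_gt0//.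
by rewrite /mesh; elim/big_rec : _ => // i x _ x0; rewrite le_max x0 orbT.
Qed.

Let window_cvg : window m @[m --> \oo] --> (0 : R).
Proof.
rewrite -[X in _ --> X](addr0 0); apply: cvgD.
  by have := t_mesh; rewrite -(cvg_shiftS (fun n => mesh n (t_ n))).
by rewrite -[X in _ --> X](mulr0 3); apply: cvgM => //; exact: cvg_cst.
Qed.

Let modulus_window_gt0 m : 0 < modulus V0 H (window m).
Proof. by rewrite ltr_pwDl ?powR_ge0// mulr_gt0. Qed.

Let volterra_bound_cvg t : 0 <= t <= T -> volterra_bound t m @[m --> \oo] --> (0 : R).
Proof.
move=> tT; have ce := @kernel_step_cvg _ _ _ _ T_gt0 t_grid t_mesh K_ok _ tT.
have cm := modulus_cvg0 window_gt0 window_cvg.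
have cs : Num.sqrt (modulus V0 H (window m)) @[m --> \oo] --> (0 : R).
  rewrite -[X in _ --> X]sqrtr0.
  by apply: (@cvg_comp _ _ _ _ Num.sqrt) cm _; exact: sqrt_continuous.
have cst_ (c : R) : c @[m --> \oo] --> c by exact: cvg_cst.
have mul0 (c : R) (u : nat -> R) : u m @[m --> \oo] --> (0 : R) -> c * u m @[m --> \oo] --> (0 : R).
  by move=> cu; rewrite -[X in _ --> X](mulr0 c); exact: cvgM.
have add0 (u v : nat -> R) : u m @[m --> \oo] --> (0 : R) -> v m @[m --> \oo] --> (0 : R) ->
    u m + v m @[m --> \oo] --> (0 : R).
  by move=> cu cv; rewrite -[X in _ --> X](addr0 0); exact: cvgD.
apply: (add0 (fun m => _) (fun m => _)).
  by apply: (mul0 _ (fun m => _)); exact: (add0 (fun m => m.+1%:R^-1) (fun m => step_error m t)).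
rewrite -[X in _ --> X](mul0r (kernel_mass t + 0)); apply: cvgM; last exact: cvgD.
apply: (add0 (fun m => _) (fun m => _)).
  apply: (add0 (fun m => _) (fun m => _)); first exact: (mul0 _ window).
  apply: (mul0 _ (fun m => _)).
  have -> : (fun m => modulus V0 H (window m) * b3) = fun m => b3 * modulus V0 H (window m).
    by apply/funext => m; rewrite mulrC.
  exact: (mul0 _ (fun m => modulus V0 H (window m))).
apply: (mul0 _ (fun m => _)); apply: (add0 (fun m => _) (fun m => _)) => //.
have -> : (fun m => modulus V0 H (window m) * b3 / Num.sqrt (modulus V0 H (window m))) =
   fun m => b3 * Num.sqrt (modulus V0 H (window m)).
  apply/funext => m; have := sqr_sqrtr (ltW (modulus_window_gt0 m)).
  have := modulus_window_gt0 m; rewrite -sqrtr_gt0.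
  set r := Num.sqrt _ => r0 <-; field; exact: lt0r_neq0.
exact: (mul0 _ (fun m => Num.sqrt (modulus V0 H (window m)))).
Qed.

(** On the scheme X is exactly a kernel sum on its own grid, so the residual is the difference
    between kernel sums of the same drift on two grids. *)
Let volterra_mean t m : 0 <= t <= T ->
  \forall n \near \oo, mean P (fun w => Num.min 1 `|volterra_error m t (Z_ n ^~ w)|) <= volterra_bound t m.
Proof.
move=> tT.
have ce := @kernel_step_cvg _ _ _ _ T_gt0 t_grid t_mesh K_ok _ tT.
(* [step_error] at index k refers to the grid k + 1, hence the predecessor. *)
have cpred : (phi n).-1 @[n --> \oo] --> \oo.
  move=> U [N _ hN]; exists N => // n /= Nn; apply: hN => /=.
  by apply: (leq_trans Nn); rewrite -ltnS prednK.
have b_small : \forall n \near \oo, step_error (phi n).-1 t <= m.+1%:R^-1.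
  have c := cvg_comp _ _ cpred ce.
  have /cvgrPdist_lt/(_ _ (harm_gt0 m)) := c.
  by apply: filterS => n; rewrite sub0r normrN => h; apply: ltW; apply: le_lt_trans h; exact: ler_norm.
near=> n.
have bn : step_error (phi n).-1 t <= m.+1%:R^-1 by near: n.
have mn : mesh_n n <= m.+1%:R^-1 by near: n; exact: mesh_small.
set e := Num.sqrt (modulus V0 H (window m)).
have e0 : 0 < e by rewrite sqrtr_gt0.
pose dr w := drift theta lambda nu (Xbn n) (Mn n) w.
have gi v : 0 <= v <= T -> integrable_rv P (fun w => dr w v).
  exact: (drift_integrable (phi_gt0 n) (grid n) B_bm B'_bm BB' (scheme n)).
have gA v : 0 <= v <= T -> mean P (fun w => `|dr w v|) <= drift_bound T V0 theta lambda nu C H.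
  exact: (mean_drift_le (phi_gt0 n) (grid n) B_bm B'_bm BB' (scheme n) C0 H0 (@moduli_n n) K_ge0).
have gom s : 0 <= s <= T -> mean P (fun w => `|dr w (eta T (phi n) (t_ (phi n)) s) -
     dr w (eta T m.+1 (t_ m.+1) s)|) <= drift_modulus T V0 theta lambda nu C H (window m) e.
  move=> sT.
  have g' := t_grid (ltn0Sn m).
  have /andP[x0 xs] := eta_le (grid n) sT; have /andP[y0 ys] := eta_le g' sT.
  have mx := eta_mesh (grid n) sT; have my := eta_mesh g' sT.
  have sT' : s <= T by case/andP: sT.
  apply: (le_trans (mean_drift_increment (delta := mesh_n n + mesh m.+1 (t_ m.+1))
    (phi_gt0 n) (grid n) B_bm B'_bm BB' (scheme n) C0 H0 (@moduli_n n) K_ge0 V0_gt0 theta_gt0 lambda_gt0 nu_gt0 _ _ e0 _)).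
  - by rewrite y0 (le_trans ys).
  - by rewrite x0 (le_trans xs).
  - by rewrite ler_norml /mesh_n; apply/andP; split; lra.
  apply: (drift_modulus_le (phi_gt0 n) (grid n) B_bm B'_bm BB' (scheme n) C0 H0 (@moduli_n n)
    K_ge0 V0_gt0 theta_gt0 lambda_gt0 nu_gt0 _ _ e0).
    have mm : 0 <= mesh m.+1 (t_ m.+1) by apply: le_trans my; rewrite subr_ge0.
    by have := mesh_n_ge0 n; rewrite /mesh_n; lra.
  have aux (a b q : R) : a <= q -> a + b + 2 * a <= b + 3 * q by lra.
  exact: aux mn.
have := mean_kernel_sum_diff (grid n) (t_grid (ltn0Sn m)) K_ge0 gi gA gom tT
  (kernel_step_integrable (phi_gt0 n) tT) (kernel_step_integrable (ltn0Sn m) tT).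
move=> le1.
have E w : volterra_error m t (Z_ n ^~ w) =
   kernel_sum (phi n) (t_ (phi n)) K t (dr w) - kernel_sum m.+1 (t_ m.+1) K t (dr w).
  rewrite /volterra_error /= (scheme_XE (grid n) (scheme n) w tT) /dr.
  by rewrite [V0 * t + _]addrC addrK.
have Eint : integrable_rv P (fun w => volterra_error m t (Z_ n ^~ w)).
  under eq_fun do rewrite E.
  have ks (j : nat) : (0 < j)%N -> integrable_rv P (fun w => kernel_sum j (t_ j) K t (dr w)).
    move=> j0; apply: integrable_rv_sum => k; apply: integrable_rvZ; apply: gi.
    by have := grid_itv (t_grid j0) (ltnW (ltn_ord k)); rewrite in_itv.
  by apply: integrable_rvB; exact: ks.
apply: mean_min1 => //.
under eq_fun do rewrite E.
apply: (le_trans le1); rewrite /volterra_bound.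
have I0 : 0 <= (0 : R) <= T by rewrite lexx.
have A0 : 0 <= drift_bound T V0 theta lambda nu C H.
  by apply: le_trans (gA _ I0); apply: mean_ge0.
have m0 : 0 <= drift_modulus T V0 theta lambda nu C H (window m) e.
  by apply: le_trans (gom _ I0); apply: mean_ge0.
apply: lerD; apply: ler_wpM2l => //; last exact: step_mass_le.
by apply: (le_trans (step_error_sum n m tT)); rewrite lerD2r.
Unshelve. all: by end_near. Qed.

Lemma path_drift_continuous w : {within `[0, T], continuous (path_drift (Z ^~ w))}.
Proof.
have [_ cXb _ cM _] := lim_continuous.
move=> x; apply: cvgD; first apply: cvgB.
- apply: cvgM; first exact: cvg_cst.
  by apply: continuous_subspaceT => y; exact: cvg_id.
- by apply: cvgM; [exact: cvg_cst|exact: cXb].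
- by apply: cvgM; [exact: cvg_cst|exact: cM].
Qed.

Lemma path_drift_bounded w : exists G : R, forall s : R, s \in `[0, T] -> `|path_drift (Z ^~ w) s| <= G.
Proof.
have cn : {within `[0, T], continuous (fun s => `|path_drift (Z ^~ w) s|)}.
  by move=> x; apply: cvg_norm; exact: path_drift_continuous.
have [c cI hc] := EVT_max T_ge0 cn.
by exists `|path_drift (Z ^~ w) c|.
Qed.

Lemma limit_volterra (t : R) : 0 <= t <= T ->
  {ae P', forall w, X t w = V0 * t + kernel_conv K t (path_drift (Z ^~ w))}.
Proof.
move=> tT.
have := lim_cvg_eq0 T_ge0 scheme_state_measurable limit_state_measurable law
  (fun m => volterra_cylinder m tT) (volterra_bound_cvg tT) (fun m => volterra_mean m tT).
apply: filterS => w /(_ (X t w - V0 * t - kernel_conv K t (path_drift (Z ^~ w)))).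
have [G Gb] := path_drift_bounded w.
have c := @kernel_sum_cvg _ _ _ _ T_gt0 t_grid t_mesh K_ok _ _ (@path_drift_continuous w) Gb _ tT.
move=> h; apply/eqP; rewrite -subr_eq0 opprD addrA; apply/eqP; apply: h.
by apply: cvgB; [exact: cvg_cst|exact: c].
Qed.

Let mean_min1_modulus n F (delta : R) : cylinder T F -> 0 <= delta ->
  (forall w, `|F (Z_ n ^~ w)| <= modulus V0 H delta *
     holder_const theta lambda nu (phi n) (t_ (phi n)) (Xbn n) (Mn n) C w) ->
  mean P (fun w => Num.min 1 `|F (Z_ n ^~ w)|) <= modulus V0 H delta * b3.
Proof.
move=> cF d0 Fle.
have [ih lh] := holder_const_mean (phi_gt0 n) (grid n) B_bm B'_bm BB' (scheme n) C0 H0 (@moduli_n n)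
  K_ge0 V0_gt0 lambda_gt0 nu_gt0.
have i := integrable_rvZ (modulus V0 H delta) ih.
have iF : integrable_rv P (fun w => F (Z_ n ^~ w)).
  by apply: integrable_rv_dom i Fle; exact: (cylinder_measurable (scheme_state_measurable n) cF).
apply: mean_min1 => //; apply: (le_trans (le_mean (integrable_rv_norm iF) i Fle)).
by rewrite (meanZ _ ih) ler_wpM2l// modulus_ge0.
Qed.

Let cylinder_pos F : cylinder T F -> cylinder T (fun f => Num.max (F f) 0).
Proof. by move=> cF; apply: cylinder_max => //; exact: cylinder_cst. Qed.

Let pos_norm_le (x y : R) : 0 <= y -> x <= y -> `|Num.max x 0| <= y.
Proof.
by move=> y0 xy; rewrite ger0_norm ?ge_max ?xy// le_max lexx orbT.
Qed.

Let err_cvg (c : R) : 0 < c -> modulus V0 H (c * m.+1%:R^-1) * b3 @[m --> \oo] --> (0 : R).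
Proof.
move=> c0; rewrite -[X in _ --> X](mul0r b3); apply: cvgM; last exact: cvg_cst.
apply: modulus_cvg0 => [m|]; first by rewrite mulr_gt0.
by rewrite -[X in _ --> X](mulr0 c); apply: cvgM => //; exact: cvg_cst.
Qed.

Let hc_ge0 n w : 0 <= holder_const theta lambda nu (phi n) (t_ (phi n)) (Xbn n) (Mn n) C w.
Proof. exact: le_trans ler01 (holder_const_ge1 theta lambda nu (Xbn n) (Mn n) (grid n) C0 w). Qed.

(** The positive part of the defect is one fixed functional. On the scheme its mean is of the order
    of the modulus at the mesh, hence arbitrarily small. *)
Lemma limit_X_le_Xbar (s t : R) : 0 <= s -> s <= t -> t <= T ->
  {ae P', forall w, X s w <= Xb t w}.
Proof.
move=> s0 st tT.
have sI : 0 <= s <= T by rewrite s0 (le_trans st).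
have tI : 0 <= t <= T by rewrite tT (le_trans s0).
pose F f : R := Num.max (component 0 (f s) - component 1 (f t)) 0.
have cF : cylinder T F.
  by apply: cylinder_pos; apply: cylinderB; exact: cylinder_component.
have Fe m : \forall n \near \oo, mean P (fun w => Num.min 1 `|F (Z_ n ^~ w)|) <=
    modulus V0 H (1 * m.+1%:R^-1) * b3.
  near=> n; have mn : mesh_n n <= 1 * m.+1%:R^-1 by rewrite mul1r; near: n; exact: mesh_small.
  have d0 := ltW (mulr_gt0 ltr01 (harm_gt0 m)).
  apply: mean_min1_modulus => // w; apply: pos_norm_le.
    by rewrite mulr_ge0 ?modulus_ge0.
  rewrite lerBlDl /=.
  apply: (le_trans (X_le_Xbar (phi_gt0 n) (grid n) (scheme n) C0 H0 (@moduli_n n) V0_gt0 w s0 st tT)).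
  by rewrite lerD2l ler_wpM2r// (modulus_le H0 V0_gt0 (mesh_n_ge0 n)).
have := lim_frequently_small T_ge0 scheme_state_measurable limit_state_measurable law
  (fun m => cF) (err_cvg ltr01) Fe.
apply: filterS => w Hw; apply/ler_addgt0Pr => e e0.
have [_] := Hw e e0; rewrite ger0_norm ?le_max ?lexx ?orbT// /F gt_max e0 andbT /=.
by rewrite ltrBlDl => /ltW.
Unshelve. all: by end_near. Qed.

(** Each finite maximum is at most the maximum of the continuous limit path, attained at a point
    that does not depend on m; so the error in m can be sent to 0. *)
Lemma limit_Xbar_le (u : R) : 0 <= u <= T ->
  {ae P', forall w, exists2 c, 0 <= c <= u & Xb u w <= X c w}.
Proof.
move=> /[dup] uI /andP[u0 uT].
pose F m f : R := Num.max (component 1 (f u) -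
  \big[Num.max/component 0 (f 0)]_(i < m.+2) component 0 (f (u * (i%:R / m.+1%:R)))) 0.
have pt m i : (i < m.+2)%N -> 0 <= u * (i%:R / m.+1%:R) <= u.
  move=> im; have m1 : 0 < m.+1%:R :> R by rewrite ltr0n.
  rewrite mulr_ge0 ?divr_ge0 ?ler0n ?(ltW m1)//=.
  by rewrite ler_piMr// ler_pdivrMr// mul1r ler_nat.
have cF m : cylinder T (F m).
  apply: cylinder_pos; apply: cylinderB; first exact: cylinder_component.
  apply: (@cylinder_bigmax _ T m.+2 (fun i f => component 0 (f (u * (i%:R / m.+1%:R))))
      (fun f => component 0 (f 0))); first by apply: cylinder_component; rewrite lexx.
  move=> i im; apply: cylinder_component.
  by have /andP[-> /le_trans] := pt m i im; exact.
have uT1 : 0 < u + 1 by rewrite ltr_wpDl.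
have Fe m : \forall n \near \oo, mean P (fun w => Num.min 1 `|F m (Z_ n ^~ w)|) <=
    modulus V0 H ((u + 1) * m.+1%:R^-1) * b3.
  near=> n; have mn : mesh_n n <= m.+1%:R^-1 by near: n; exact: mesh_small.
  have d0 := ltW (mulr_gt0 uT1 (harm_gt0 m)).
  apply: mean_min1_modulus => // w; apply: pos_norm_le.
    by rewrite mulr_ge0 ?modulus_ge0.
  rewrite lerBlDl /=.
  apply: (le_trans (Xbar_le_max (phi_gt0 n) (grid n) (scheme n) C0 H0 (@moduli_n n) V0_gt0 m w uI)).
  rewrite lerD2l ler_wpM2r// modulus_le//.
    by rewrite (addr_ge0 _ (mesh_n_ge0 n))// mulr_ge0// ltW.
  by rewrite mulrDl mul1r lerD2l.
have := lim_frequently_small T_ge0 scheme_state_measurable limit_state_measurable law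
  cF (err_cvg uT1) Fe.
apply: filterS => w Hw.
have cX : {within `[0, u], continuous (X ^~ w)}.
  have [cX _ _ _ _] := lim_continuous.
  by apply: continuous_subspaceW (cX w); apply: subset_itvl; rewrite bnd_simp.
have [c cI hc] := EVT_max u0 cX.
exists c; first by move: cI; rewrite in_itv.
apply/ler_addgt0Pr => e e0; have [m] := Hw e e0.
rewrite ger0_norm ?le_max ?lexx ?orbT// /F gt_max e0 andbT /= ltrBlDl => /ltW h.
apply: (le_trans h); rewrite lerD2r; apply: bigmax_le.
  by apply: hc; rewrite in_itv/= lexx.
by move=> i _; apply: hc; rewrite in_itv/= pt.
Unshelve. all: by end_near. Qed.

(** Relations that hold exactly on the scheme and involve finitely many times: the constant sequence
    with error 0 in [lim_cvg_eq0]. *)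
Let limit_exact F : cylinder T F -> (forall n w, F (Z_ n ^~ w) = 0) ->
  {ae P', forall w, F (Z ^~ w) = 0}.
Proof.
move=> cF F0.
have c0 : (fun=> (0 : R)) m @[m --> \oo] --> (0 : R) by exact: cvg_cst.
have := lim_cvg_eq0 T_ge0 scheme_state_measurable limit_state_measurable law (fun m => cF) c0.
have Fe (m : nat) : \forall n \near \oo, mean P (fun w => Num.min 1 `|F (Z_ n ^~ w)|) <= 0.
  near=> n; under eq_fun do rewrite F0 normr0 min_r ?ler01//.
  by rewrite mean_cst.
move/(_ Fe); apply: filterS => w; apply; exact: cvg_cst.
Unshelve. all: by end_near. Qed.

Lemma limit_price (t : R) : 0 <= t <= T ->
  {ae P', forall w, S t w = scheme_price S0 rho Xb M Mp t w}.
Proof.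
move=> tT.
pose F f : R := component 2 (f t) - expR (ln S0 + rho * component 3 (f t)
   + Num.sqrt (1 - rho ^+ 2) * component 4 (f t) - 2^-1 * component 1 (f t)).
have cF : cylinder T F.
  apply: cylinderB; first exact: cylinder_component.
  apply: (@cylinder_comp _ _ _ expR); first exact: continuous_expR.
  apply: cylinderB; last by apply: cylinderZ; exact: cylinder_component.
  apply: cylinderD; last by apply: cylinderZ; exact: cylinder_component.
  apply: cylinderD; first exact: cylinder_cst.
  by apply: cylinderZ; exact: cylinder_component.
have := limit_exact cF (fun n w => subrr _).
by apply: filterS => w /eqP; rewrite subr_eq0 => /eqP.
Qed.

Lemma limit_start : {ae P', forall w, [/\ Xb 0 w = 0, M 0 w = 0 & Mp 0 w = 0]}.
Proof.
have I0 : 0 <= (0 : R) <= T by rewrite lexx.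
have h i := limit_exact (cylinder_component i I0).
have h1 := h 1%N (fun n w => scheme_Xbar0 (phi_gt0 n) (grid n) (scheme n) w).
have h3 := h 3%N (fun n w => scheme_M0 (scheme n) w).
have h4 := h 4%N (fun n w => scheme_Mperp0 (scheme n) w).
by apply: filterS3 h1 h3 h4 => w /= -> -> ->.
Qed.

(** The multiples of T / (n + 1) form a countable set, on which almost sure statements at fixed
    times hold simultaneously. Rounding down keeps the approximation inside [[0, t]]. *)
Let floor_time (n : nat) (t : R) : R := T * ((Num.trunc (t / T * n.+1%:R))%:R / n.+1%:R).

Let floor_time_itv n (t : R) : 0 <= t <= T -> 0 <= floor_time n t <= t /\ t - floor_time n t <= T * n.+1%:R^-1.
Proof.
move=> /andP[t0 tT].
have n1 : 0 < n.+1%:R :> R by rewrite ltr0n.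
have q0 : 0 <= t / T * n.+1%:R by rewrite mulr_ge0 ?divr_ge0 ?(ltW n1).
have /andP[i1 i2] := truncn_itv q0.
have e : t = T * (t / T * n.+1%:R / n.+1%:R) by field; rewrite !gt_eqF.
split.
  rewrite mulr_ge0 ?divr_ge0 ?(ltW n1)//= [leRHS]e ler_pM2l// ler_pM2r ?invr_gt0//.
rewrite [in X in X - _]e /floor_time -mulrBr -mulrBl ler_pM2l// -[leRHS]mul1r ler_pM2r ?invr_gt0//.
by rewrite lerBlDl natr1 ltW.
Qed.

Let floor_time_le n (s t : R) : 0 <= s -> s <= t -> floor_time n s <= floor_time n t.
Proof.
move=> s0 st; rewrite ler_pM2l// ler_pM2r ?invr_gt0 ?ltr0n// ler_nat.
have h : s / T * n.+1%:R <= t / T * n.+1%:R by rewrite ler_wpM2r// ler_wpM2r// invr_ge0.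
have q0 : 0 <= s / T * n.+1%:R by rewrite mulr_ge0 ?divr_ge0.
by rewrite truncn_ge_nat ?(le_trans q0)//; apply: le_trans h; rewrite truncn_le.
Qed.

Let floor_time_cvg (t : R) : 0 <= t <= T -> floor_time n t @[n --> \oo] --> t.
Proof.
move=> tT; apply: (@squeeze_cvgr _ _ _ _ (fun n => t - T * n.+1%:R^-1) (fun=> t)).
- near=> n; have [/andP[_ ->] h] := floor_time_itv n tT; rewrite andbT.
  by move: h; rewrite lerBlDr addrC -lerBlDr.
- rewrite -[X in _ --> X]subr0; apply: cvgB; first exact: cvg_cst.
  by rewrite -[X in _ --> X](mulr0 T); apply: cvgM => //; exact: cvg_cst.
- exact: cvg_cst.
Unshelve. all: by end_near. Qed.

Let ae_floor_times (Q : R -> Omega' -> Prop) :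
  (forall t, 0 <= t <= T -> {ae P', forall w, Q t w}) ->
  {ae P', forall w, forall n t, 0 <= t <= T -> Q (floor_time n t) w}.
Proof.
move=> aeQ.
have H1 n i : {ae P', forall w, 0 <= T * (i%:R / n.+1%:R) <= T -> Q (T * (i%:R / n.+1%:R)) w}.
  have [/aeQ|] := boolP (0 <= T * (i%:R / n.+1%:R) <= T); first by apply: filterS.
  by move=> _; apply: aeW.
have := ae_foralln (fun n => ae_foralln (H1 n)).
apply: filterS => w Hw n t tT; apply: Hw.
by have [/andP[-> /le_trans]] := floor_time_itv n tT; case/andP: tT => _ tT /(_ _ tT).
Qed.

(** For relations between two ordered times: rounding both on the same level preserves their
    order. *)
Let ae_floor_times2 (Q : R -> R -> Omega' -> Prop) :
  (forall s t, 0 <= s -> s <= t -> t <= T -> {ae P', forall w, Q s t w}) ->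
  {ae P', forall w, forall n s t, 0 <= s -> s <= t -> t <= T -> Q (floor_time n s) (floor_time n t) w}.
Proof.
move=> aeQ.
pose p (n i : nat) : R := T * (i%:R / n.+1%:R).
have H1 n i j : {ae P', forall w, 0 <= p n i -> p n i <= p n j -> p n j <= T -> Q (p n i) (p n j) w}.
  have [/and3P[h1 h2 h3]|h] := boolP [&& 0 <= p n i, p n i <= p n j & p n j <= T].
    by apply: filterS (aeQ _ _ h1 h2 h3).
  by apply: aeW => w h1 h2 h3; rewrite h1 h2 h3 in h.
have := ae_foralln (fun n => ae_foralln (fun i => ae_foralln (H1 n i))).
apply: filterS => w Hw n s t s0 st tT.
have sI : 0 <= s <= T by rewrite s0 (le_trans st).
have tI : 0 <= t <= T by rewrite tT (le_trans s0).
have [/andP[h1 _] _] := floor_time_itv n sI; have [/andP[_ h2] _] := floor_time_itv n tI.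
by apply: Hw; rewrite /p -/(floor_time n s) -/(floor_time n t)//; [exact: floor_time_le|exact: le_trans tT].
Qed.

Let path_cvg (Y : R -> Omega' -> R) w (t : R) : continuous_paths T Y -> 0 <= t <= T ->
  Y (floor_time n t) w @[n --> \oo] --> Y t w.
Proof.
move=> cY tT; apply: (within_cvg_seq (cY w)) => //.
- move=> n; rewrite /= in_itv/=; have [/andP[-> h] _] := floor_time_itv n tT.
  by apply: (le_trans h); case/andP: tT.
- exact: floor_time_cvg.
Qed.

(** All relations are transported from the rounded times by continuity of the limit paths. For the
    maximum, the point given by [limit_Xbar_le] at the rounded time lies in [[0, t]], so its value
    is at most the maximum over that interval. *)
Lemma limit_paths : {ae P', forall w, forall t : R, t \in `[0, T] ->
  [/\ X t w = V0 * t + kernel_conv K t (path_drift (Z ^~ w)),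
      [set X s w | s in `[0, t]] (Xb t w) /\ ubound [set X s w | s in `[0, t]] (Xb t w) &
      S t w = scheme_price S0 rho Xb M Mp t w]}.
Proof.
have [cX cXb cS cM cMp] := lim_continuous.
have h1 := ae_floor_times limit_volterra.
have h2 := ae_floor_times2 limit_X_le_Xbar.
have h3 := ae_floor_times limit_Xbar_le.
have h4 := ae_floor_times limit_price.
apply: filterS (filterI (filterI h1 h2) (filterI h3 h4)) => w [[{}h1 {}h2] [{}h3 {}h4]] t.
rewrite in_itv/= => /[dup] tI /andP[t0 tT].
have cn (Y : R -> Omega' -> R) (cY : continuous_paths T Y) := @path_cvg Y w t cY tI.
split.
- have [G Gb] := path_drift_bounded w.
  have [C' [H' [C'0 H'0 hol]]] :=
    kernel_conv_holder T_gt0 t_grid t_mesh K_ok (@path_drift_continuous w) Gb.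
  have ck : kernel_conv K (floor_time n t) (path_drift (Z ^~ w)) @[n --> \oo] -->
      kernel_conv K t (path_drift (Z ^~ w)).
    apply/cvgrPdist_le => e e0.
    have c : (T * n.+1%:R^-1) `^ H' * C' @[n --> \oo] --> (0 : R).
      rewrite -[X in _ --> X](mul0r C'); apply: cvgM; last exact: cvg_cst.
      apply: powR_cvg_seq => // [n|]; first by rewrite mulr_gt0.
      by rewrite -[X in _ --> X](mulr0 T); apply: cvgM => //; exact: cvg_cst.
    have /cvgrPdist_le/(_ _ e0) := c; apply: filterS => n.
    rewrite sub0r normrN => /(le_trans (ler_norm _)); apply: le_trans.
    have [/andP[f0 ft] fT] := floor_time_itv n tI.
    apply: (le_trans (hol _ _ f0 ft tT)); rewrite ler_wpM2r ?(ltW C'0)//.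
    by rewrite ge0_ler_powR ?nnegrE ?(ltW H'0) ?subr_ge0// mulr_ge0// ltW.
  have c1 := cn _ cX.
  have c2 : X (floor_time n t) w @[n --> \oo] --> V0 * t + kernel_conv K t (path_drift (Z ^~ w)).
    under eq_fun do rewrite h1//.
    by apply: cvgD => //; apply: cvgM; [exact: cvg_cst|exact: floor_time_cvg].
  exact: (cvg_unique _ c1 c2).
- have ub s : 0 <= s <= t -> X s w <= Xb t w.
    move=> /andP[s0 st]; have sI : 0 <= s <= T by rewrite s0 (le_trans st).
    have c : Xb (floor_time n t) w - X (floor_time n s) w @[n --> \oo] --> Xb t w - X s w.
      by apply: cvgB; [exact: (cn _ cXb)|exact: path_cvg].
    rewrite -subr_ge0 -(cvg_lim _ c)//; apply: limr_ge; first by apply/cvg_ex; eexists; exact: c.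
    by near=> n; rewrite subr_ge0; apply: h2.
  have [c cI hc] : exists2 c, 0 <= c <= t & forall s, 0 <= s <= t -> X s w <= X c w.
    have cXt : {within `[0, t], continuous (X ^~ w)}.
      by apply: continuous_subspaceW (cX w); apply: subset_itvl; rewrite bnd_simp.
    have [c cI hc] := EVT_max t0 cXt.
    by exists c; [move: cI; rewrite in_itv|move=> s sI; apply: hc; rewrite in_itv].
  split; last by move=> _ [s sI <-]; apply: ub; move: sI; rewrite /= in_itv.
  exists c; first by rewrite /= in_itv.
  apply/eqP; rewrite eq_le ub//=.
  rewrite -(cvg_lim _ (cn _ cXb))//; apply: limr_le; first by apply/cvg_ex; eexists; exact: (cn _ cXb).
  near=> n; have [c' /andP[c'0 c'n] le1] := h3 n t tI; apply: (le_trans le1); apply: hc.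
  by rewrite c'0 (le_trans c'n)//; have [/andP[_ ->]] := floor_time_itv n tI.
- have cp : scheme_price S0 rho Xb M Mp (floor_time n t) w @[n --> \oo] -->
      scheme_price S0 rho Xb M Mp t w.
    apply: (@cvg_comp _ _ _ _ expR); last exact: continuous_expR.
    apply: cvgB; last by apply: cvgM; [exact: cvg_cst|exact: cn].
    apply: cvgD; last by apply: cvgM; [exact: cvg_cst|exact: cn].
    by apply: cvgD; [exact: cvg_cst|apply: cvgM; [exact: cvg_cst|exact: cn]].
  have c1 := cn _ cS.
  have c2 : S (floor_time n t) w @[n --> \oo] --> scheme_price S0 rho Xb M Mp t w.
    by under eq_fun do rewrite h4//.
  exact: (cvg_unique _ c1 c2).
Unshelve. all: by end_near. Qed.

(** * Martingale property and brackets of the limit *)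

Lemma scheme_cylinder_past n s F : s <= T -> cylinder s F ->
  measurable_wrt (past B B' s) (fun w => F (Z_ n ^~ w)).
Proof.
move=> sT; apply: (@cylinder_measurable R _ (g_sigma_algebraType (past B B' s)) s (Z_ n)) => i u /andP[u0 us].
have uT : 0 <= u <= T by rewrite u0 (le_trans us).
have [[mX _] [mXb _] [mM _] [mM' _]] := scheme_adapted4 (phi_gt0 n) (grid n) B_bm B'_bm BB' (scheme n) uT.
have m (Y : Omega -> R) : measurable_wrt (past B B' u) Y -> measurable_wrt (past B B' s) Y.
  by apply: measurable_wrt_sub; exact: past_le.
have {}mX := m _ mX; have {}mXb := m _ mXb; have {}mM := m _ mM; have {}mM' := m _ mM'.
case: i => [|[|[|[|i]]]] //=.
apply: (measurableT_comp (@measurable_expR R)).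
apply: measurable_funB; last exact: measurable_funM.
apply: measurable_funD; last exact: measurable_funM.
by apply: measurable_funD => //; exact: measurable_funM.
Qed.

Local Notation b2 := (Xbar_sq_bound T V0 theta nu C H).
Local Notation F_ s := (<<s history Z s >>).

Let F_measurable s : s <= T -> F_ s `<=` measurable.
Proof. exact: (history_sigma_measurable limit_state_measurable). Qed.

(** One variable dominating the squares of M, Mperp, M^2 - Xbar, Mperp^2 - Xbar and M Mperp. In the
    bound of its mean, 144 is 2 (36 + 36), from the two fourth moments. *)
Definition fourth_moments n (u : R) w : R :=
  1 + 2 * (Mn n u w ^+ 4 + Mpn n u w ^+ 4) + 2 * Xbn n u w ^+ 2.

Lemma fourth_moments_mean n (u : R) : 0 <= u <= T ->
  integrable_rv P (fourth_moments n u) /\ mean P (fourth_moments n u) <= 1 + 144 * b2 + 2 * b2.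
Proof.
move=> uT.
have [_ hX hM hM'] := scheme_adapted4 (phi_gt0 n) (grid n) B_bm B'_bm BB' (scheme n) uT.
have [_ _ _ [iX2 _ _ _]] := scheme_integrable (phi_gt0 n) (grid n) B_bm B'_bm BB' (scheme n) uT.
have iM4 : integrable_rv P (fun w => Mn n u w ^+ 4) by case: hM.
have iM'4 : integrable_rv P (fun w => Mpn n u w ^+ 4) by case: hM'.
have i4 := integrable_rvZ 2 (integrable_rvD iM4 iM'4).
have i1 := integrable_rvD (integrable_rv_cst P 1) i4.
have i2 := integrable_rvZ 2 iX2.
split; first exact: integrable_rvD.
rewrite /fourth_moments (meanD i1 i2) (meanD (integrable_rv_cst P 1) i4) mean_cst.
rewrite (meanZ _ (integrable_rvD iM4 iM'4)) (meanD iM4 iM'4) (meanZ _ iX2).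
have := mean_Xbar_sq (phi_gt0 n) (grid n) B_bm B'_bm BB' (scheme n) C0 H0 (@moduli_n n)
  K_ge0 V0_gt0 lambda_gt0 nu_gt0 uT.
have := mean_M_fourth (phi_gt0 n) (grid n) B_bm B'_bm BB' (scheme n) uT.
have := mean_Mperp_fourth (phi_gt0 n) (grid n) B_bm B'_bm BB' (scheme n) uT.
have aux (x y z b : R) : x <= 36 * z -> y <= 36 * z -> z <= b ->
   1 + 2 * (y + x) + 2 * z <= 1 + 144 * b + 2 * b by lra.
by move=> h1 h2 h3; exact: aux h1 h2 h3.
Qed.

Section limit_martingale.
Variable G : R -> (R -> state) -> R.
Hypothesis cG : forall u : R, 0 <= u <= T -> cylinder u (G u).
Hypothesis G_sq : forall n (u : R) w, 0 <= u <= T -> G u (Z_ n ^~ w) ^+ 2 <= fourth_moments n u w.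
Hypothesis G_fair : forall n, fair P T B B' (fun u w => G u (Z_ n ^~ w)).

Let G_moment n (u : R) : 0 <= u <= T -> integrable_rv P (fun w => G u (Z_ n ^~ w) ^+ 2) /\
  mean P (fun w => G u (Z_ n ^~ w) ^+ 2) <= 1 + 144 * b2 + 2 * b2.
Proof.
move=> uT; have [i le4] := fourth_moments_mean n uT.
have uT' : u <= T by case/andP: uT.
have i2 : integrable_rv P (fun w => G u (Z_ n ^~ w) ^+ 2).
  apply: (integrable_rv_dom _ i).
    apply: measurable_funX.
    exact: (cylinder_measurable (scheme_state_measurable n) (cylinder_le uT' (cG uT))).
  by move=> w; rewrite ger0_norm ?sqr_ge0// G_sq.
by split => //; apply: le_trans le4; apply: le_mean => // w; exact: G_sq.
Qed.

Let sq_integrable {d0} {O : measurableType d0} (Q : probability O R) (f : O -> R) :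
  measurable_fun setT f -> integrable_rv Q (fun w => f w ^+ 2) -> integrable_rv Q f.
Proof.
move=> mf i2; apply: (integrable_rv_dom mf (integrable_rvD (integrable_rv_cst Q 1) i2)) => w.
have := weighted_amgm (f w) 1 ltr01; rewrite mulr1 divr1 expr1n mulr1 => /le_trans; apply.
by have := sqr_ge0 (f w); lra.
Qed.

Let limit_integrable (u : R) : 0 <= u <= T -> integrable_rv P' (fun w => G u (Z ^~ w)).
Proof.
move=> uT; have uT' : u <= T by case/andP: uT.
have cGT := cylinder_le uT' (cG uT).
apply: sq_integrable; first exact: (cylinder_measurable limit_state_measurable cGT).
have [] // := lim_square T_ge0 scheme_state_measurable limit_state_measurable law cGT
  (C := 1 + 144 * b2 + 2 * b2).
by near=> n; exact: G_moment.
Unshelve. all: by end_near. Qed.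

(** A bounded cylinder functional up to [s], evaluated on the scheme, is a function of the driving
    past, so [G_fair] annihilates it for each n. The second-moment bound carries this to the limit,
    where functionals are replaced by events of the history. The factor 4 comes from (a - b)^2 <= 2
    (a^2 + b^2) with the same bound on both terms. *)
Lemma limit_martingale : martingale P' T (fun s => F_ s) (fun u w => G u (Z ^~ w)).
Proof.
split.
- move=> u; rewrite in_itv/= => uT A [U mU <-]; rewrite setTI.
  by apply: measurable_wrt_preimage mU; apply: cylinder_history; exact: cG.
- by move=> u; rewrite in_itv/= => uT; exact: limit_integrable.
move=> s u; rewrite !in_itv/= => sI uI su A FA.
have [s0 sT] := andP sI; have [u0 uT] := andP uI.
have mA : measurable A by exact: (F_measurable sT).
have iu := limit_integrable uI; have is_ := limit_integrable sI.
have cGu := cylinder_le uT (cG uI); have cGs := cylinder_le sT (cG sI).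
have key : (\int[P']_(w in A) (G u (Z ^~ w) - G s (Z ^~ w))%:E = 0)%E.
  apply: (integral_history_eq0 limit_state_measurable s0 sT (integrable_rvB iu is_)) => // h c ch hc.
  apply: (lim_mean_mul_eq0 T_ge0 scheme_state_measurable limit_state_measurable law
    (G := fun f => G u f - G s f) (C := 4 * (1 + 144 * b2 + 2 * b2)) (c := c)) => //.
  - exact: cylinderB.
  - exact: cylinder_le sT ch.
  - near=> n.
    have [iu2 leu] := G_moment n uI; have [is2 les] := G_moment n sI.
    have i := integrable_rvZ 2 (integrable_rvD iu2 is2).
    have le2 w : (G u (Z_ n ^~ w) - G s (Z_ n ^~ w)) ^+ 2 <=
        2 * (G u (Z_ n ^~ w) ^+ 2 + G s (Z_ n ^~ w) ^+ 2).
      by rewrite mulrDr -[X in _ <= _ + 2 * X]sqrrN; exact: sqrD_le.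
    have i2 : integrable_rv P (fun w => (G u (Z_ n ^~ w) - G s (Z_ n ^~ w)) ^+ 2).
      apply: (integrable_rv_dom _ i) => [|w]; last by rewrite ger0_norm ?sqr_ge0.
      apply: measurable_funX.
      exact: (cylinder_measurable (scheme_state_measurable n) (cylinderB cGu cGs)).
    split => //; apply: (le_trans (le_mean i2 i le2)).
    rewrite (meanZ _ (integrable_rvD iu2 is2)) (meanD iu2 is2).
    have aux (x y z : R) : x <= z -> y <= z -> 2 * (x + y) <= 4 * z by lra.
    exact: aux.
  - near=> n; apply: (G_fair n s0 su uT _ (fun w => hc _)).
    exact: scheme_cylinder_past.
have iA (v : R) : 0 <= v <= T -> P'.-integrable A (EFin \o (fun w => G v (Z ^~ w))).
  by move=> vI; apply: (integrableS measurableT mA _ (limit_integrable vI)).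
have iuA := iA _ uI; have isA := iA _ sI.
move: key; under eq_integral do rewrite EFinB.
rewrite (integralB mA iuA isA) => /eqP; rewrite sube_eq//.
- by rewrite add0e => /eqP.
- exact: integrable_fin_num iuA.
Unshelve. all: by end_near. Qed.

End limit_martingale.

Lemma history_filtration : filtration T (fun s => F_ s).
Proof.
split.
- move=> u; rewrite in_itv/= => /andP[_ uT]; split; first exact: smallest_sigma_algebra.
  exact: F_measurable.
- by move=> s u _ _ su; exact: history_le.
Qed.

Lemma history_adapted i : adapted T (fun s => F_ s) (fun u w => component i (Z u w)).
Proof.
move=> u; rewrite in_itv/= => /andP[u0 uT] A [U mU <-]; rewrite setTI.
by apply: measurable_wrt_preimage mU; apply: measurable_wrt_history; rewrite u0 lexx.
Qed.

(** The constant time [T] localises. The definition subtracts the initial value, which is harmless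
    because it is integrable and belongs to every sigma-algebra of the filtration. *)
Lemma martingale_local (N : R -> Omega' -> R) : continuous_paths T N ->
  martingale P' T (fun s => F_ s) N -> continuous_local_martingale P' T (fun s => F_ s) N.
Proof.
move=> cN [aN iN mN]; split => //.
have i0 : (0 : R) \in `[0, T] by rewrite in_itv/= lexx.
exists (fun _ _ => T); split.
- move=> k u uI; have -> : [set w : Omega' | T <= u] = if T <= u then setT else set0.
    by case: ifP => h; apply/seteqP; split => w //=; rewrite h.
  have [sF0 sFC _] := smallest_sigma_algebra setT (history Z u).
  by case: ifP => _ //; rewrite -[X in F_ _ X]setD0; exact: sFC.
- by move=> k w; rewrite lexx T_ge0.
- by apply: aeW => w; exists 0%N.
move=> k; have minT (u : R) : u \in `[0, T] -> Num.min u T = u.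
  by rewrite in_itv/= => /andP[_ uT]; rewrite min_l.
have wrt u : u \in `[0, T] -> measurable_wrt (history Z u) (N u).
  by move=> uI; apply: measurable_wrt_preimage_system; exact: aN.
have iB (u : R) : u \in `[0, T] -> integrable_rv P' (fun w => N u w - N 0 w).
  by move=> uI; apply: integrable_rvB; exact: iN.
split.
- move=> u uI A [U mU <-]; rewrite setTI minT//.
  apply: measurable_wrt_preimage mU; apply: measurable_funB; first exact: wrt.
  apply: measurable_wrt_sub (wrt _ i0); apply: history_le.
  by move: uI; rewrite in_itv/= => /andP[].
- by move=> u uI; rewrite minT//; exact: iB.
move=> s u sI uI su A FA; rewrite !minT//.
have mA : measurable A.
  by apply: (@F_measurable s) => //; move: sI; rewrite in_itv/= => /andP[].
have iA v : v \in `[0, T] -> P'.-integrable A (EFin \o N v).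
  by move=> vI; apply: (integrableS measurableT mA _ (iN _ vI)).
under eq_integral do rewrite EFinB.
rewrite (integralB mA (iA _ uI) (iA _ i0)).
under [RHS]eq_integral do rewrite EFinB.
by rewrite (integralB mA (iA _ sI) (iA _ i0)) (mN _ _ sI uI su _ FA).
Qed.

Let sq_le_fourth (x y z : R) : 0 <= y -> 0 <= z -> x ^+ 2 <= 1 + 2 * (x ^+ 4 + y) + 2 * z.
Proof.
move=> y0 z0; have -> : x ^+ 4 = (x ^+ 2) ^+ 2 by rewrite -exprM.
by have := sqr_ge0 (x ^+ 2 - 1); have := sqr_ge0 (x ^+ 2); lra.
Qed.

Let fourth_ge0 (x : R) : 0 <= x ^+ 4.
Proof. by rewrite (exprM x 2 2) sqr_ge0. Qed.

Let square_sub_le (x y z : R) : 0 <= y ->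
  (x * x - z) ^+ 2 <= 1 + 2 * (x ^+ 4 + y) + 2 * z ^+ 2.
Proof.
move=> y0; have -> : x ^+ 4 = (x * x) ^+ 2 by rewrite -expr2 -exprM.
by have := sqr_ge0 (x * x + z); lra.
Qed.

Let product_le (x y z : R) : 0 <= z -> (x * y - 0) ^+ 2 <= 1 + 2 * (x ^+ 4 + y ^+ 4) + 2 * z.
Proof.
move=> z0; have -> : x ^+ 4 = (x ^+ 2) ^+ 2 by rewrite -exprM.
have -> : y ^+ 4 = (y ^+ 2) ^+ 2 by rewrite -exprM.
rewrite subr0 exprMn.
have := sqr_ge0 (x ^+ 2 - y ^+ 2); have := sqr_ge0 (x ^+ 2); have := sqr_ge0 (y ^+ 2); lra.
Qed.

Let u_le_u (u : R) : 0 <= u <= T -> 0 <= u <= u.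
Proof. by case/andP => ->; rewrite lexx. Qed.

Lemma limit_martingale_M : martingale P' T (fun s => F_ s) M.
Proof.
apply: (@limit_martingale (fun u f => component 3 (f u))).
- by move=> u /u_le_u uu; exact: cylinder_component.
- by move=> n u w uT; exact: sq_le_fourth (fourth_ge0 _) (sqr_ge0 _).
- by move=> n; exact: fair_M (phi_gt0 n) (grid n) B_bm B'_bm BB' (scheme n).
Qed.

Lemma limit_martingale_Mperp : martingale P' T (fun s => F_ s) Mp.
Proof.
apply: (@limit_martingale (fun u f => component 4 (f u))).
- by move=> u /u_le_u uu; exact: cylinder_component.
- move=> n u w uT; rewrite /fourth_moments [_ ^+ 4 + _]addrC.
  exact: sq_le_fourth (fourth_ge0 _) (sqr_ge0 _).
- by move=> n; exact: fair_Mperp (phi_gt0 n) (grid n) B_bm B'_bm BB' (scheme n).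
Qed.

Lemma limit_martingale_M_square : martingale P' T (fun s => F_ s) (fun u w => M u w * M u w - Xb u w).
Proof.
apply: (@limit_martingale (fun u f => component 3 (f u) * component 3 (f u) - component 1 (f u))).
- move=> u /u_le_u uu; apply: cylinderB; last exact: cylinder_component.
  by apply: cylinderM; exact: cylinder_component.
- by move=> n u w uT; exact: square_sub_le (fourth_ge0 _).
- by move=> n; exact: fair_M_square (phi_gt0 n) (grid n) B_bm B'_bm BB' (scheme n).
Qed.

Lemma limit_martingale_Mperp_square :
  martingale P' T (fun s => F_ s) (fun u w => Mp u w * Mp u w - Xb u w).
Proof.
apply: (@limit_martingale (fun u f => component 4 (f u) * component 4 (f u) - component 1 (f u))).
- move=> u /u_le_u uu; apply: cylinderB; last exact: cylinder_component.
  by apply: cylinderM; exact: cylinder_component.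
- move=> n u w uT; rewrite /fourth_moments [_ ^+ 4 + _]addrC.
  exact: square_sub_le (fourth_ge0 _).
- by move=> n; exact: fair_Mperp_square (phi_gt0 n) (grid n) B_bm B'_bm BB' (scheme n).
Qed.

(** The subtracted zero is the bracket process, kept so that the statement has the shape required by
    [is_bracket]. *)
Lemma limit_martingale_product :
  martingale P' T (fun s => F_ s) (fun u w => M u w * Mp u w - (fun=> 0) w).
Proof.
apply: (@limit_martingale (fun u f => component 3 (f u) * component 4 (f u) - 0)).
- move=> u /[dup] uT /u_le_u uu; apply: cylinderB; last by apply: cylinder_cst; case/andP: uT.
  by apply: cylinderM; exact: cylinder_component.
- by move=> n u w uT; exact: product_le (sqr_ge0 _).
- move=> n s u h c s0 su uT mh hc; under eq_fun do rewrite !subr0.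
  exact: (fair_product (phi_gt0 n) (grid n) B_bm B'_bm BB' (scheme n) s0 su uT mh hc).
Qed.

Let continuous_paths_mul_sub (N N' A : R -> Omega' -> R) : continuous_paths T N ->
  continuous_paths T N' -> continuous_paths T A ->
  continuous_paths T (fun u w => N u w * N' u w - A u w).
Proof.
move=> cN cN' cA w x; apply: cvgB; last exact: cA.
by apply: cvgM; [exact: cN|exact: cN'].
Qed.

(** Monotonicity is inherited from the running maximum, hence known only almost surely. *)
Lemma limit_Xbar_bounded_variation : {ae P', forall w, bounded_variation 0 T (Xb ^~ w)}.
Proof.
apply: filterS limit_paths => w Hw; apply: nondecreasing_bounded_variation => s u sI uI su.
have [_ [[c cI <-] _] _] := Hw _ sI; have [_ [_ ub] _] := Hw _ uI.
apply: ub; exists c => //; move: cI; rewrite /= !in_itv/= => /andP[-> cs].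
exact: le_trans su.
Qed.

Lemma limit_brackets : let F s := F_ s in
  [/\ is_bracket P' T F M M Xb, is_bracket P' T F Mp Mp Xb & is_bracket P' T F M Mp (fun _ _ => 0)].
Proof.
have [_ cXb _ cM cMp] := lim_continuous.
have c0 : continuous_paths T (fun _ (_ : Omega') => 0 : R) by move=> w; exact: cst_continuous.
split; split => //.
- exact: (@history_adapted 1%N).
- by apply: filterS limit_start => w [].
- exact: limit_Xbar_bounded_variation.
- apply: martingale_local limit_martingale_M_square; exact: continuous_paths_mul_sub.
- exact: (@history_adapted 1%N).
- by apply: filterS limit_start => w [].
- exact: limit_Xbar_bounded_variation.
- apply: martingale_local limit_martingale_Mperp_square; exact: continuous_paths_mul_sub.
- move=> u uI A [U mU <-]; rewrite setTI.
  by apply: (@measurable_wrt_preimage _ _ _ (fun=> 0)) mU; exact: measurable_cst.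
- by apply: aeW.
- by apply: aeW => w; exact: nondecreasing_bounded_variation.
- apply: martingale_local limit_martingale_product; exact: continuous_paths_mul_sub.
Qed.

End limit.

Theorem proposition4p12 (R : realType)
  (T rho S0 V0 theta lambda nu : R)
  (T_gt0 : 0 < T) (rho_itv : -1 <= rho <= 1)
  (S0_gt0 : 0 < S0) (V0_gt0 : 0 < V0) (theta_gt0 : 0 < theta)
  (lambda_gt0 : 0 < lambda) (nu_gt0 : 0 < nu)
  (* grids *)
  (t_ : nat -> nat -> R)
  (t_grid : forall n, (0 < n)%N -> is_grid T n (t_ n))
  (t_mesh : mesh n (t_ n) @[n --> \oo] --> (0 : R))
  (* kernel *)
  (K : R -> R) (K_ok : kernel_assumption T t_ K)
  (* driving Brownian motions *)
  (d : measure_display) (Omega : measurableType d) (P : probability Omega R)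
  (B Bperp : R -> Omega -> R)
  (B_bm : brownian_motion P T B) (Bperp_bm : brownian_motion P T Bperp)
  (B_indep : independent_systems P
     (sigma_generated `[0, T] B) (sigma_generated `[0, T] Bperp))
  (* discrete scheme *)
  (Xn Xbarn Mn Mperpn : nat -> R -> Omega -> R)
  (scheme : forall n, (0 < n)%N ->
     is_scheme T V0 theta lambda nu n (t_ n) K B Bperp
       (Xn n) (Xbarn n) (Mn n) (Mperpn n))
  (* weak limit along a subsequence *)
  (phi : nat -> nat) (phi_incr : {homo phi : m n / (m < n)%N})
  (d' : measure_display) (Omega' : measurableType d')
  (P' : probability Omega' R)
  (X Xbar S M Mperp : R -> Omega' -> R)
  (lim_measurable : forall t : R, t \in `[0, T] ->
     [/\ measurable_fun setT (X t), measurable_fun setT (Xbar t),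
         measurable_fun setT (S t), measurable_fun setT (M t) &
         measurable_fun setT (Mperp t)])
  (lim_continuous : [/\ continuous_paths T X, continuous_paths T Xbar,
     continuous_paths T S, continuous_paths T M & continuous_paths T Mperp])
  (lim_law : cvg_in_law P P' T
     (fun n t w => let m := phi n in
        (Xn m t w, Xbarn m t w,
         scheme_price S0 rho (Xbarn m) (Mn m) (Mperpn m) t w,
         Mn m t w, Mperpn m t w))
     (fun t w => (X t w, Xbar t w, S t w, M t w, Mperp t w))) :
  {ae P', forall w, forall t : R, t \in `[0, T] ->
    [/\ X t w = V0 * t + \int[@lebesgue_measure R]_(s in `[0, t])
                  (K (t - s) * (theta * s - lambda * Xbar s w + nu * M s w)),
        [set X s w | s in `[0, t]] (Xbar t w)
          /\ ubound [set X s w | s in `[0, t]] (Xbar t w) &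
        S t w = S0 * expR (rho * M t w + Num.sqrt (1 - rho ^+ 2) * Mperp t w
                           - 2^-1 * Xbar t w)]} /\
  exists F : R -> set (set Omega'),
    [/\ filtration T F,
        [/\ adapted T F X, adapted T F Xbar, adapted T F S,
            adapted T F M & adapted T F Mperp],
        [/\ continuous_paths T M, continuous_paths T Mperp,
            martingale P' T F M & martingale P' T F Mperp],
        [/\ is_bracket P' T F M M Xbar, is_bracket P' T F Mperp Mperp Xbar &
            is_bracket P' T F M Mperp (fun _ _ => 0)] &
        {ae P', forall w, M 0 w = 0 /\ Mperp 0 w = 0}].
Proof.
have [C [H [C0 H0 moduli]]] := kernel_moduli K_ok.
have moduli' (n : nat) (t delta : R) : (0 < n)%N -> t \in `[0, T] -> delta \in `]0, T - t] ->
  let e := Defs.eta T n (t_ n) in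
  (\int[@lebesgue_measure R]_(s in `[t, (t + delta)%R])
      (`|K (t + delta - e s)| ^+ 2)%:E <= (C * delta `^ (2 * H))%:E)%E /\
  (\int[@lebesgue_measure R]_(s in `[0%R, t])
      (`|K (t + delta - e s) - K (t - e s)| ^+ 2)%:E
    <= (C * delta `^ (2 * H))%:E)%E.
  by move=> n0 tT dT; exact: moduli.
(* The scheme is specified for positive indices only and [phi 0] may be 0. Dropping the first term
   gives n < [psi n] and does not change the limit in law. *)
pose psi n := phi n.+1.
have phi_ge n : (n <= phi n)%N.
  by elim: n => [//|n IH]; apply: leq_ltn_trans IH (phi_incr _ _ (ltnSn n)).
have psi_gt n : (n < psi n)%N by exact: phi_ge.
have psi_gt0 n : (0 < psi n)%N by exact: leq_ltn_trans (leq0n n) (psi_gt n).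
have sch n := scheme (psi n) (psi_gt0 n).
have law : cvg_in_law P P' T
    (scheme_state rho S0 (fun n => Xn (psi n)) (fun n => Xbarn (psi n))
       (fun n => Mn (psi n)) (fun n => Mperpn (psi n)))
    (limit_state X Xbar S M Mperp).
  have cvgS : n.+1 @[n --> \oo] --> \oo.
    by move=> A [N _ hN]; exists N => // n /= Nn; apply: hN => /=; exact: leqW.
  by move=> F cF bF; exact: (cvg_comp _ _ cvgS (lim_law F cF bF)).
have [cX cXb cS cM cMp] := lim_continuous.
split.
  have := limit_paths T_gt0 V0_gt0 theta_gt0 lambda_gt0 nu_gt0 t_grid t_mesh K_ok C0 H0 moduli'
    B_bm Bperp_bm B_indep psi_gt sch lim_measurable lim_continuous law.
  apply: filterS => w Hw t tT; have [h1 h2 h3] := Hw t tT; split => //.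
  have lnS0 : expR (ln S0) = S0 by rewrite lnK ?posrE.
  rewrite h3 /scheme_price -[X in X * expR _]lnS0 -expRD.
  by congr expR; rewrite !addrA.
exists (fun s => <<s history (limit_state X Xbar S M Mperp) s >>).
have ad i := @history_adapted R T d' Omega' X Xbar S M Mperp i.
split.
- exact: history_filtration lim_measurable.
- by split; [exact: (ad 0%N)|exact: (ad 1%N)|exact: (ad 2%N)|exact: (ad 3%N)|exact: (ad 4%N)].
- split => //.
  + exact: (limit_martingale_M T_gt0 V0_gt0 lambda_gt0 nu_gt0 t_grid K_ok C0 H0 moduli'
      B_bm Bperp_bm B_indep psi_gt sch lim_measurable law).
  + exact: (limit_martingale_Mperp T_gt0 V0_gt0 lambda_gt0 nu_gt0 t_grid K_ok C0 H0 moduli'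
      B_bm Bperp_bm B_indep psi_gt sch lim_measurable law).
- exact: (limit_brackets T_gt0 V0_gt0 theta_gt0 lambda_gt0 nu_gt0 t_grid t_mesh K_ok C0 H0 moduli'
    B_bm Bperp_bm B_indep psi_gt sch lim_measurable lim_continuous law).
- have := limit_start T_gt0 t_grid B_bm Bperp_bm B_indep psi_gt sch lim_measurable law.
  by apply: filterS => w [].
Qed.
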